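(* Let $k\ge1$, $d,n_1,\dots,n_k\ge1$, let $\mathcal{S}_w\subset\mathbb{R}^d$ and $\mathcal{S}_{v_\ell}\subset\mathbb{R}^{n_\ell}$ be compact convex sets, $\mathcal{S}_v:=\mathcal{S}_{v_1}\times\dots\times\mathcal{S}_{v_k}$ with elements $v=(v_1,\dots,v_k)$, and let $\psi:\mathcal{S}_w\times\mathcal{S}_v\to\mathbb{R}$ be continuous and convex-concave (convex in $w$ for each fixed $v$, concave in $v$ for each fixed $w$). Let $\alpha_\ell(w)=A_\ell w+a_\ell$ and $\beta_\ell(u)=B_\ell u+b_\ell$ be affine maps, with $A_\ell\in\mathbb{R}^{d\times d}$, $a_\ell\in\mathbb{R}^d$, $B_\ell\in\mathbb{R}^{n_\ell\times n_\ell}$, $b_\ell\in\mathbb{R}^{n_\ell}$. Let $G_\ell\in\mathbb{R}^{n_\ell\times d}$, $g_\ell\in\mathbb{R}^d$, $h_\ell\in\mathbb{R}^{n_\ell}$ be mutually independent with i.i.d. $\mathcal{N}(0,1)$ entries, and define $$\Phi(G):=\min_{w\in\mathcal{S}_w}\max_{v\in\mathcal{S}_v}\sum_{\ell=1}^k\beta_\ell(v_\ell)^TG_\ell\,\alpha_\ell(w)+\psi(w,v),$$ $$\phi(g,h):=\min_{w\in\mathcal{S}_w}\max_{v\in\mathcal{S}_v}\sum_{\ell=1}^k\Big[\|\beta_\ell(v_\ell)\|_2\,g_\ell^T\alpha_\ell(w)+\|\alpha_\ell(w)\|_2\,h_\ell^T\beta_\ell(v_\ell)\Big]+\psi(w,v).$$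 Then for all $c\in\mathbb{R}$ and $\eta>0$, $$\mathbb{P}(|\Phi(G)-c|>\eta)\le 2^k\,\mathbb{P}(|\phi(g,h)-c|>\eta).$$
   Context: Norms are Euclidean. $G=(G_1,\dots,G_k)$, $g=(g_1,\dots,g_k)$, $h=(h_1,\dots,h_k)$. *)

(* Defs.v *)
From HB Require Import structures.
From mathcomp Require Import all_boot all_order all_algebra.
From mathcomp Require Import all_classical all_reals all_analysis.
Set Implicit Arguments.
Unset Strict Implicit.
Unset Printing Implicit Defensive.
Import Order.TTheory GRing.Theory Num.Theory.
Import numFieldNormedType.Exports.
Local Open Scope classical_set_scope.
Local Open Scope ring_scope.

Definition enorm {R : realType} {m : nat} (x : 'cV[R]_m) : R :=
  Num.sqrt (\sum_(i < m) x i 0 ^+ 2).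

Definition cvx_set {R : realType} {m : nat} (S : set 'cV[R]_m) : Prop :=
  forall x y, S x -> S y -> forall t : R, 0 <= t <= 1 ->
    S (t *: x + (1 - t) *: y).

Section gmt.
Variables (R : realType) (k d : nat) (n : 'I_k -> nat).

Definition vtuple := forall l : 'I_k, 'cV[R]_(n l).

Definition in_prod (Sv : forall l : 'I_k, set 'cV[R]_(n l)) (v : vtuple) : Prop :=
  forall l, Sv l (v l).

Definition continuous_on_prod (Sw : set 'cV[R]_d)
    (Sv : forall l : 'I_k, set 'cV[R]_(n l)) (psi : 'cV[R]_d -> vtuple -> R) :=
  forall w v, Sw w -> in_prod Sv v -> forall e : R, 0 < e ->
    exists2 del : R, 0 < del & forall w' v', Sw w' -> in_prod Sv v' ->
      enorm (w' - w) < del -> (forall l, enorm (v' l - v l) < del) ->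
      `|psi w' v' - psi w v| < e.

Definition convex_concave (Sw : set 'cV[R]_d)
    (Sv : forall l : 'I_k, set 'cV[R]_(n l)) (psi : 'cV[R]_d -> vtuple -> R) :=
  (forall v, in_prod Sv v -> forall w1 w2, Sw w1 -> Sw w2 ->
     forall t : R, 0 <= t <= 1 ->
     psi (t *: w1 + (1 - t) *: w2) v <= t * psi w1 v + (1 - t) * psi w2 v) /\
  (forall w, Sw w -> forall v1 v2, in_prod Sv v1 -> in_prod Sv v2 ->
     forall t : R, 0 <= t <= 1 ->
     t * psi w v1 + (1 - t) * psi w v2 <= psi w (fun l => t *: v1 l + (1 - t) *: v2 l)).

(* min_{w in Sw} max_{v in Sv} F w v, written with inf/sup (attained here) *)
Definition minmax (Sw : set 'cV[R]_d) (Sv : forall l : 'I_k, set 'cV[R]_(n l))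
    (F : 'cV[R]_d -> vtuple -> R) : R :=
  inf [set (sup [set F w v | v in in_prod Sv]) | w in Sw].

Definition PhiG Sw Sv (A : 'I_k -> 'M[R]_d) (a : 'I_k -> 'cV[R]_d)
    (B : forall l, 'M[R]_(n l)) (b : forall l, 'cV[R]_(n l)) psi
    (G : forall l, 'M[R]_(n l, d)) : R :=
  minmax Sw Sv (fun w v =>
    \sum_(l < k) ((B l *m v l + b l)^T *m G l *m (A l *m w + a l)) 0 0 + psi w v).

Definition phigh Sw Sv (A : 'I_k -> 'M[R]_d) (a : 'I_k -> 'cV[R]_d)
    (B : forall l, 'M[R]_(n l)) (b : forall l, 'cV[R]_(n l)) psi
    (g : 'I_k -> 'cV[R]_d) (h : forall l, 'cV[R]_(n l)) : R :=
  minmax Sw Sv (fun w v =>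
    \sum_(l < k) (enorm (B l *m v l + b l) * ((g l)^T *m (A l *m w + a l)) 0 0
                  + enorm (A l *m w + a l) * ((h l)^T *m (B l *m v l + b l)) 0 0)
    + psi w v).

(* index set of all scalar Gaussian entries: (G_l)_{ij}, (g_l)_j, (h_l)_i *)
Definition gidx := {l : 'I_k & ('I_(n l) * 'I_d + 'I_d + 'I_(n l))%type}.

Variables (dT : measure_display) (T : measurableType dT).

Definition gentry (G : forall l, T -> 'M[R]_(n l, d)) (g : 'I_k -> T -> 'cV[R]_d)
    (h : forall l, T -> 'cV[R]_(n l)) (j : gidx) : T -> R :=
  match j with
  | existT l (inl (inl (i, c))) => fun t => G l t i c
  | existT l (inl (inr c)) => fun t => g l t c 0
  | existT l (inr i) => fun t => h l t i 0
  end.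

End gmt.

Definition mutually_independent {R : realType} {dT : measure_display}
    {T : measurableType dT} (P : probability T R) {I : finType} (X : I -> T -> R) :=
  (forall i, measurable_fun setT (X i)) /\
  forall (J : {set I}) (Bs : I -> set R), (forall i, measurable (Bs i)) ->
    P (\bigcap_(i in [set` J]) (X i @^-1` Bs i)) =
    (\prod_(i in J) P (X i @^-1` Bs i))%E.

Definition std_normal {R : realType} {dT : measure_display}
    {T : measurableType dT} (P : probability T R) (X : T -> R) :=
  forall B : set R, measurable B -> P (X @^-1` B) = normal_prob 0 1 B.

(* Main.v *)
Require Import Defs.
From HB Require Import structures.
From mathcomp Require Import all_boot all_order all_algebra.
From mathcomp Require Import all_classical all_reals all_analysis.
From mathcomp Require Import measurable_realfun ring lra.
Set Implicit Arguments.
Unset Strict Implicit.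
Unset Printing Implicit Defensive.
Import Order.TTheory GRing.Theory Num.Theory.
Import numFieldNormedType.Exports.
Local Open Scope classical_set_scope.
Local Open Scope ring_scope.

(** Gordon's comparison argument, with the Gaussian interpolation replaced by a Lindeberg exchange.

   Adding [k] independent variables [gamma_l |alpha_l w| |beta_l v|] to the bilinear process, its
   covariances minus those of the decoupled process equal
   [sum_l (|alpha||alpha'| - alpha.alpha') (|beta||beta'| - beta.beta')], which is nonnegative by
   Cauchy-Schwarz and vanishes when [w = w'] or [v = v'].  For finite families of [w] and [v] the
   indicator of [min max >= c] is approximated by a product [f] of [C^2] functions of the rows whose
   mixed second derivatives between distinct rows are nonnegative.  Each Gaussian is a sum of [N]
   small independent Gaussians, which may be replaced by signs with an error [O(1 / sqrt N)]; then
   all expectations are finite averages, and exchanging the [N] packets of signs of one process for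
   those of the other one compares the second order terms of [f].  The event [gamma_l <= 0 for all l]
   has probability at least [2^-k], whence [P(Phi < c) <= 2^k P(phi < c)], after passing from finite
   nets to the compact sets.  For the upper tail the same inequality is applied to the negated
   process with the roles of [w] and [v] exchanged: [Phi] is also a max-min by the minimax theorem,
   while the max-min of the decoupled process is at most [phi]. *)

(** * The minimax theorem for convex-concave functions *)

(** The probability space carries only the entries of [G], [g] and [h], so the variables [gamma_l]
    are never realized as Gaussians: inside the Rademacher averages they are merely extra vectors in
    a list, and the bound [2^-k] becomes a reflection argument on finite averages. Both processes
    are linear in the same family of Gaussians, with zero coefficients at the entries that they do
    not use, so only their covariances enter and no coupling has to be built. Smoothing and passing
    to nets both shift the threshold [c]. This is why the lower tail is described by an event with a
    strictly positive margin: it is the increasing limit of the same events at lower thresholds, so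
    the shift disappears by continuity of the measure. Convexity enters through the minimax theorem
    for [Phi]. That theorem is proved when finitely many values of [v] suffice for all [w], which a
    net provides, and it asks only for points that do as well as a convex combination, so it applies
    to tuples without a vector space structure on them. *)

Definition convexlike (R : realType) (W V : Type) (A : set W) (B : set V) (F : W -> V -> R) :=
  forall w1 w2, A w1 -> A w2 -> forall t : R, 0 <= t <= 1 ->
    exists2 w, A w & forall v, B v -> F w v <= t * F w1 v + (1 - t) * F w2 v.

(** A point with [g w < 0] forces [t] to be at least [- g w / (f w - g w)], a point with [f w < 0]
    forces it to be at most [g w / (g w - f w)]. The inequality [key] says that no lower bound
    exceeds an upper bound, so the supremum of the lower bounds is admissible. *)
Lemma convexlike_alternative (R : realType) (W : Type) (A : set W) (f g : W -> R) :
  (forall w1 w2, A w1 -> A w2 -> forall t : R, 0 <= t <= 1 ->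
    exists w, [/\ A w, f w <= t * f w1 + (1 - t) * f w2 &
      g w <= t * g w1 + (1 - t) * g w2]) ->
  (forall w, A w -> 0 <= f w \/ 0 <= g w) ->
  exists2 t : R, 0 <= t <= 1 & forall w, A w -> 0 <= t * f w + (1 - t) * g w.
Proof.
move=> cvxfg fg0.
have [fA|] := pselect (forall w, A w -> 0 <= f w).
  by exists 1; [lra|move=> w /fA; lra].
move=> /existsNP[a /not_implyP[Aa /negP]]; rewrite -ltNge => fa.
have [gA|] := pselect (forall w, A w -> 0 <= g w).
  by exists 0; [lra|move=> w /gA; lra].
move=> /existsNP[b /not_implyP[Ab /negP]]; rewrite -ltNge => gb.
have key a' b' : A a' -> A b' -> f a' < 0 -> g b' < 0 ->
    g b' * f a' <= f b' * g a'.
  move=> Aa' Ab' fa' gb'; rewrite leNgt; apply/negP => H.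
  have fb' : 0 <= f b' by case: (fg0 _ Ab'); lra.
  have ga' : 0 <= g a' by case: (fg0 _ Aa'); lra.
  set p := f b' - g b'; set q := g a' - f a'.
  have p0 : 0 < p by rewrite /p; lra.
  have q0 : 0 < q by rewrite /q; lra.
  have pq0 : 0 < p + q by rewrite addr_gt0.
  (* At this weight the convex combinations of [f] and of [g] at [a'] and [b'] coincide, both being
     [(f b' * g a' - g b' * f a') / (p + q)]; if that is negative, a single point makes both
     functions negative. *)
  have t01 : 0 <= p / (p + q) <= 1.
    by apply/andP; split; [rewrite divr_ge0 ?ltW|rewrite ler_pdivrMr// mul1r lerDl ltW].
  have [w [Aw fw gw]] := cvxfg _ _ Aa' Ab' _ t01.
  have e : 1 - p / (p + q) = q / (p + q).
    by rewrite -[X in X - _](@divff _ (p + q)) ?gt_eqF// -mulrBl addrC addKr.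
  have neg : (f b' * g a' - g b' * f a') / (p + q) < 0.
    by rewrite pmulr_llt0 ?invr_gt0//; lra.
  have fw0 : f w < 0.
    apply: le_lt_trans fw _; rewrite e; apply: le_lt_trans neg.
    by rewrite ![_ / (p + q) * _]mulrAC -mulrDl ler_pM2r ?invr_gt0// /p /q; lra.
  have gw0 : g w < 0.
    apply: le_lt_trans gw _; rewrite e; apply: le_lt_trans neg.
    by rewrite ![_ / (p + q) * _]mulrAC -mulrDl ler_pM2r ?invr_gt0// /p /q; lra.
  by case: (fg0 _ Aw); lra.
pose S := [set - g w / (f w - g w) | w in [set w | A w /\ g w < 0]].
have Sub a' : A a' -> f a' < 0 -> ubound S (g a' / (g a' - f a')).
  move=> Aa' fa' _ [w [Aw gw] <-].
  have fw : 0 <= f w by case: (fg0 _ Aw); lra.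
  have ga' : 0 <= g a' by case: (fg0 _ Aa'); lra.
  rewrite ler_pdivrMr ?subr_gt0; last by lra.
  rewrite mulrAC ler_pdivlMr ?subr_gt0; last by lra.
  have := key _ _ Aa' Aw fa' gw; nra.
have S0 : S !=set0 by exists (- g b / (f b - g b)), b.
have Slub w : A w -> g w < 0 -> - g w / (f w - g w) <= sup S.
  move=> Aw gw; apply: ub_le_sup; last by exists w.
  by exists (g a / (g a - f a)); exact: Sub.
have Sle a' : A a' -> f a' < 0 -> sup S <= g a' / (g a' - f a').
  by move=> Aa' fa'; apply: ge_sup => //; exact: Sub.
exists (sup S).
  apply/andP; split.
    apply: le_trans (Slub b Ab gb).
    have fb : 0 <= f b by case: (fg0 _ Ab); lra.
    by rewrite divr_ge0; lra.
  apply: le_trans (Sle a Aa fa) _.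
  have ga : 0 <= g a by case: (fg0 _ Aa); lra.
  by rewrite ler_pdivrMr; lra.
move=> w Aw.
have t01 : 0 <= sup S <= 1.
  apply/andP; split.
    apply: le_trans (Slub b Ab gb).
    have fb : 0 <= f b by case: (fg0 _ Ab); lra.
    by rewrite divr_ge0; lra.
  apply: le_trans (Sle a Aa fa) _.
  have ga : 0 <= g a by case: (fg0 _ Aa); lra.
  by rewrite ler_pdivrMr; lra.
have [gw|gw] := ltP (g w) 0.
  have fw : 0 <= f w by case: (fg0 _ Aw); lra.
  have := Slub w Aw gw; rewrite ler_pdivrMr; lra.
have [fw|fw] := ltP (f w) 0.
  have := Sle w Aw fw; rewrite ler_pdivlMr; lra.
nra.
Qed.

Lemma convex_comb_lt (R : realType) (t x y c : R) : 0 <= t <= 1 ->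
  x < c -> y < c -> t * x + (1 - t) * y < c.
Proof.
move=> /andP[t0 t1] xc yc; have [xy|yx] := leP x y.
  have : 0 <= t * (y - x) by rewrite mulr_ge0// subr_ge0.
  lra.
have : 0 <= (1 - t) * (x - y) by rewrite mulr_ge0// subr_ge0// ltW.
lra.
Qed.

(** Induction on the number of test points. On the part of [A] where the first point fails, which is
    still convexlike, the others yield [v1]; everywhere on [A] the first point or [v1] succeeds, and
    the alternative turns this disjunction into a convex combination, realized by a point of [B]. *)
Lemma convexlike_finite_minimax (R : realType) (W V : Type) (A : set W)
    (B : set V) (F : W -> V -> R) (c : R) (p : nat) (vs : 'I_p -> V) :
  convexlike A B F -> convexlike B A (fun v w => - F w v) -> B !=set0 ->
  (forall i, B (vs i)) -> (forall w, A w -> exists i, c <= F w (vs i)) ->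
  exists2 v, B v & forall w, A w -> c <= F w v.
Proof.
move=> + + [vB BvB]; elim: p vs A => [|p IH] vs A cA cB Bvs cov.
  by exists vB => // w /cov[[]].
have [||||v1 Bv1 Fv1] := IH (vs \o lift ord0) [set w | A w /\ F w (vs ord0) < c].
- move=> w1 w2 [Aw1 w1c] [Aw2 w2c] t t01.
  have [w Aw Fw] := cA _ _ Aw1 Aw2 _ t01; exists w => //; split => //.
  by apply: le_lt_trans (Fw _ (Bvs ord0)) _; exact: convex_comb_lt.
- move=> v1 v2 Bv1 Bv2 t t01; have [v Bv Fv] := cB _ _ Bv1 Bv2 _ t01.
  by exists v => // w [Aw _]; exact: Fv.
- by move=> i; exact: Bvs.
- move=> w [Aw wc]; have [i] := cov _ Aw.
  by case: (unliftP ord0 i) => [j ->|->]; [exists j|lra].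
have [t t01 Ht] : exists2 t : R, 0 <= t <= 1 & forall w, A w ->
    0 <= t * (F w (vs ord0) - c) + (1 - t) * (F w v1 - c).
  apply: convexlike_alternative => [w1 w2 Aw1 Aw2 t t01|w Aw].
    have [w Aw Fw] := cA _ _ Aw1 Aw2 _ t01; exists w; split => //.
      by have := Fw _ (Bvs ord0); lra.
    by have := Fw _ Bv1; lra.
  have [|h] := leP c (F w (vs ord0)); first by left; lra.
  by right; have := Fv1 w (conj Aw h); lra.
have [v Bv Fv] := cB _ v1 (Bvs ord0) Bv1 _ t01.
exists v => // w Aw; have := Fv _ Aw; have := Ht w Aw; lra.
Qed.

(** * The one-dimensional Gaussian *)

(** [normal_prob] is integrated through its Radon-Nikodym derivative, which agrees almost everywhere
    with the explicit density because both have the same integral over every measurable set. *)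
Lemma integral_normal_prob (R : realType) (m s : R) (f : R -> \bar R) :
  measurable_fun [set: R] f -> (forall x, (0 <= f x)%E) ->
  (\int[normal_prob m s]_x f x =
   \int[lebesgue_measure]_x (f x * (normal_pdf m s x)%:E))%E.
Proof.
move=> mf f0.
have dom := normal_prob_dominates m s.
rewrite -(Radon_Nikodym_SigmaFinite.change_of_variables dom f0 measurableT mf).
apply: ae_eq_integral => //.
- apply: emeasurable_funM => //.
  apply: (measurable_int lebesgue_measure).
  exact: Radon_Nikodym_SigmaFinite.f_integrable.
- apply: emeasurable_funM => //; apply/measurable_EFinP.
  exact: measurable_normal_pdf.
- apply: ae_eqe_mul2l => /=.
  apply: integral_ae_eq => //=.
  + exact: Radon_Nikodym_SigmaFinite.f_integrable.
  + apply/measurable_EFinP; exact: measurable_normal_pdf.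
  + move=> E _ mE.
    by rewrite -Radon_Nikodym_SigmaFinite.f_integral.
Qed.

Lemma integral_affine (R : realType) (G : R -> R) (c e : R) : 0 < c ->
  continuous G -> (forall x, 0 <= G x) ->
  (\int[lebesgue_measure]_x (G x)%:E =
   \int[lebesgue_measure]_x (G (c * x + e) * c)%:E)%E.
Proof.
move=> c0 cG G0.
have dF (x : R) : is_derive x 1 (fun x => c * x + e : R^o) c.
  by apply: is_derive_eq; rewrite addr0 scaler1.
have dFE : derive1 (fun x : R => c * x + e : R^o) = cst c.
  by apply/funext => x; rewrite derive1E derive_val.
rewrite (@increasing_ge0_integration_by_substitutionT _ (fun x => c * x + e))//.
- by apply: eq_integral => x _; rewrite dFE.
- by move=> x y xy; rewrite ltrD2r ltr_pM2l.
- by rewrite dFE; move=> x; exact: cvg_cst.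
- by rewrite dFE; exact: is_cvg_cst.
- by rewrite dFE; exact: is_cvg_cst.
- apply/cvgrNyPle => A.
  apply: filterS (nbhs_ninfty_le (num_real ((A - e) / c))) => x.
  by rewrite ler_pdivlMr// mulrC lerBrDr.
- apply/cvgryPge => A.
  apply: filterS (nbhs_pinfty_ge (num_real ((A - e) / c))) => x.
  by rewrite ler_pdivrMr// mulrC lerBlDr.
Qed.

Lemma normal_pdf01E (R : realType) (z : R) :
  normal_pdf 0 1 z = normal_peak 1 * expR (- z ^+ 2 / 2).
Proof. by rewrite normal_pdfE ?oner_neq0// /normal_fun subr0 expr1n. Qed.

(** Both exponents are [-1/2] times [(s^2 y^2 - 2 a s y z + s^2 z^2) / b^2], which is symmetric in
    [y] and [z]: this is the rotation invariance of the planar Gaussian law. *)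
Lemma normal_pdf01_rotate (R : realType) (a b s y z : R) : 0 < b ->
  s ^+ 2 = a ^+ 2 + b ^+ 2 ->
  normal_pdf 0 1 (s / b * y + - (a * z / b)) * normal_pdf 0 1 z =
  normal_pdf 0 1 y * normal_pdf 0 1 (s / b * z + - (a * y / b)).
Proof.
move=> b0 sE; rewrite !normal_pdf01E mulrACA [RHS]mulrACA -!expRD; congr (_ * expR _).
have b0' : b != 0 by rewrite gt_eqF.
have -> : s / b * y + - (a * z / b) = (s * y - a * z) / b by ring.
have -> : s / b * z + - (a * y / b) = (s * z - a * y) / b by ring.
rewrite -!mulrDl -!opprD !exprMn !exprVn; congr (- _ / _).
apply: (@mulIf _ (b ^+ 2)); first by rewrite expf_neq0.
rewrite !mulrDl divfK ?expf_neq0// divfK ?expf_neq0//.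
have -> : b ^+ 2 = s ^+ 2 - a ^+ 2 by rewrite sE; ring.
ring.
Qed.

(** The substitution [z' = (s y - a z) / b] turns the argument of [u] into [x + s y]. After
    exchanging the integrals and applying [normal_pdf01_rotate], the integral in [z] is that of a
    probability density. The value [a = 0] is allowed, as the first increment in [gauss_rademacher]
    requires. *)
Lemma normal_prob_convolution (R : realType) (u : R -> R) (x a b s : R) :
  continuous u -> (forall y, 0 <= u y) -> 0 < b -> 0 < s ->
  s ^+ 2 = a ^+ 2 + b ^+ 2 ->
  (\int[normal_prob 0 1]_z \int[normal_prob 0 1]_z' (u (x + a * z + b * z'))%:E =
   \int[normal_prob 0 1]_z (u (x + s * z))%:E)%E.
Proof.
move=> cu u0 b0 s0 sE.
have p0 (z : R) : 0 <= normal_pdf 0 1 z by exact: normal_pdf_ge0.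
have cp : continuous (normal_pdf 0 1 : R -> R) by exact/continuous_normal_pdf/oner_neq0.
have mp : measurable_fun setT (normal_pdf 0 1 : R -> R) by exact: measurable_normal_pdf.
have mu : measurable_fun setT u by exact: continuous_measurable_fun.
have caff (c e : R) : continuous (fun z => e + c * z).
  by move=> z; apply: cvgD; [exact: cvg_cst|apply: cvgM; [exact: cvg_cst|exact: cvg_id]].
rewrite integral_normal_prob; last 2 first.
- apply: (@measurable_fun_fubini_tonelli_F _ _ _ _ _ (normal_prob 0 1)
    (fun zz : R * R => (u (x + a * zz.1 + b * zz.2))%:E)).
    apply/measurable_EFinP; apply: measurableT_comp => //.
    apply: measurable_funD; [apply: measurable_funD => //|];
      by apply: measurable_funM.
  by move=> zz; rewrite lee_fin.
- by move=> z; apply: integral_ge0 => z' _; rewrite lee_fin.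
transitivity (\int[lebesgue_measure]_z \int[lebesgue_measure]_y
   (u (x + s * y) * normal_pdf 0 1 (s / b * y + - (a * z / b)) * (s / b) * normal_pdf 0 1 z)%:E)%E.
  apply: eq_integral => z _; rewrite integral_normal_prob; last 2 first.
  - apply/measurable_EFinP; apply: measurableT_comp => //.
    by apply: measurable_funD => //; apply: measurable_funM.
  - by move=> z'; rewrite lee_fin.
  under eq_integral do rewrite -EFinM.
  rewrite (@integral_affine _ (fun z' => u (x + a * z + b * z') * normal_pdf 0 1 z')
    (s / b) (- (a * z / b))); last 3 first.
  - by rewrite divr_gt0.
  - move=> z'; apply: cvgM; last exact: cp.
    by apply: continuous_comp; [exact: caff|exact: cu].
  - by move=> z'; rewrite mulr_ge0.
  rewrite -ge0_integralZr//=; last 3 first.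
  - apply/measurable_EFinP; apply: measurable_funM => //.
    apply: measurable_funM; apply: measurableT_comp => //.
      apply: measurable_funD => //; apply: measurable_funM => //.
      by apply: measurable_funD => //; apply: measurable_funM.
    by apply: measurable_funD => //; apply: measurable_funM.
  - by move=> y _; rewrite lee_fin !mulr_ge0// ltW// invr_gt0.
  - by rewrite lee_fin.
  apply: eq_integral => y _; rewrite -EFinM; congr ((u _ * _ * _ * _)%:E).
  by field; rewrite gt_eqF.
have fub := @fubini_tonelli _ _ _ _ _ (@lebesgue_measure R) (@lebesgue_measure R)
  (fun zy : R * R => (u (x + s * zy.2) *
  normal_pdf 0 1 (s / b * zy.2 + - (a * zy.1 / b)) * (s / b) *
    normal_pdf 0 1 zy.1)%:E).
rewrite /= in fub; rewrite {}fub; last 2 first.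
- apply/measurable_EFinP; apply: measurable_funM; last exact: measurableT_comp.
  apply: measurable_funM => //; apply: measurable_funM; apply: measurableT_comp => //.
    by apply: measurable_funD => //; apply: measurable_funM.
  apply: measurable_funD; first by apply: measurable_funM.
  apply: measurableT_comp => //; apply: measurable_funM => //.
  by apply: measurable_funM.
- by move=> zy; rewrite lee_fin !mulr_ge0// ltW// invr_gt0.
rewrite integral_normal_prob; last 2 first.
- apply/measurable_EFinP; apply: measurableT_comp => //.
  by apply: measurable_funD => //; apply: measurable_funM.
- by move=> z'; rewrite lee_fin.
apply: eq_integral => y _.
transitivity (\int[lebesgue_measure]_z ((u (x + s * y) * normal_pdf 0 1 y)%:E *
  (normal_pdf 0 1 (s / b * z + - (a * y / b)) * (s / b))%:E))%E.
  apply: eq_integral => z _; rewrite -EFinM; congr EFin.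
  have := normal_pdf01_rotate y z b0 sE; set q := normal_pdf 0 1 (s / b * y + _).
  move=> H.
  transitivity (u (x + s * y) * (s / b) * (q * normal_pdf 0 1 z)); first by ring.
  by rewrite H; ring.
rewrite ge0_integralZl//=; last 3 first.
- apply/measurable_EFinP; apply: measurable_funM => //.
  apply: measurableT_comp => //.
  by apply: measurable_funD => //; apply: measurable_funM.
- by move=> z _; rewrite lee_fin !mulr_ge0// ltW// invr_gt0.
- by rewrite lee_fin mulr_ge0.
rewrite -(@integral_affine _ (normal_pdf 0 1))//; last by rewrite divr_gt0.
by rewrite integral_normal_pdf mule1 EFinM.
Qed.

Lemma normal_prob_sym (R : realType) (f : R -> \bar R) :
  measurable_fun [set: R] f -> (forall x, (0 <= f x)%E) ->
  (\int[normal_prob 0 1]_z f (- z)%R = \int[normal_prob 0 1]_z f z)%E.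
Proof.
move=> mf f0; rewrite !integral_normal_prob//; last exact: measurableT_comp.
have mfp : measurable_fun [set: R] (fun z : R => f z * (normal_pdf 0 1 z)%:E)%E.
  apply: emeasurable_funM => //; apply/measurable_EFinP.
  exact: measurable_normal_pdf.
transitivity (\int[lebesgue_measure]_z ((fun z : R => f z * (normal_pdf 0 1 z)%:E) (- z)%R))%E.
  by apply: eq_integral => z _; rewrite !normal_pdf01E sqrrN.
have mopp : measurable_fun [set: measurableTypeR R] (-%R : measurableTypeR R -> measurableTypeR R).
  exact: oppr_measurable.
have H := @ge0_integral_pushforward _ _ (measurableTypeR R) (measurableTypeR R) R
  -%R mopp lebesgue_measure setT _ measurableT mfp.
rewrite -H//; last by move=> z _; rewrite mule_ge0// lee_fin normal_pdf_ge0.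
by apply: eq_measure_integral => //= A mA _; exact/lebesgue_measureN.
Qed.

Lemma bounded_integrable (R : realType) (d : measure_display)
    (T : measurableType d) (P : probability T R) (f : T -> R) (c : R) :
  measurable_fun setT f -> (forall x, `|f x| <= c) ->
  P.-integrable setT (EFin \o f).
Proof.
move=> mf fc; apply: (@le_integrable _ _ _ _ _ measurableT _ (cst c%:E)).
- exact/measurable_EFinP.
- by move=> x _ /=; rewrite lee_fin (le_trans (fc x))// ler_norm.
- exact: finite_measure_integrable_cst.
Qed.

Lemma Rintegral_dist (R : realType) (d : measure_display)
    (T : measurableType d) (P : probability T R) (f g : T -> R) (c : R) :
  P.-integrable setT (EFin \o f) -> P.-integrable setT (EFin \o g) ->
  (forall x, `|f x - g x| <= c) ->
  `|\int[P]_x f x - \int[P]_x g x| <= c.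
Proof.
move=> fi gi fg; rewrite -RintegralB//.
have bi : P.-integrable setT (EFin \o (fun x => f x - g x)).
  by have := integrableB measurableT fi gi; apply: eq_integrable => // x _; rewrite EFinB.
apply: (le_trans (le_normr_Rintegral measurableT bi)).
have -> : c = \int[P]_(x in setT) cst c x.
  transitivity (c * fine (P setT)); first by rewrite probability_setT mulr1.
  by rewrite Rintegral_cst.
apply: le_Rintegral => //; first exact: (integrable_norm bi).
exact: finite_measure_integrable_cst.
Qed.

(** Growth up to [expR (z ^+ 2 / 4)] is harmless because its product with the standard density is a
    multiple of the normal density of variance 2. *)
Lemma normal_prob_integrable (R : realType) (f : R -> R) (c : R) :
  measurable_fun setT f -> (forall z, `|f z| <= c * expR (z ^+ 2 / 4)) ->
  (normal_prob 0 1).-integrable setT (EFin \o f).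
Proof.
move=> mf fc; apply/integrableP; split; first exact/measurable_EFinP.
rewrite integral_normal_prob//; last first.
  by apply/measurableT_comp => //; exact/measurable_EFinP.
have s0 : Num.sqrt 2 != 0 :> R by rewrite gt_eqF// sqrtr_gt0.
set k := c * normal_peak 1 / normal_peak (Num.sqrt 2).
apply: (@le_lt_trans _ _ (\int[lebesgue_measure]_z (k%:E * (normal_pdf 0 (Num.sqrt 2) z)%:E))%E).
  apply: ge0_le_integral => //.
  - by move=> x _; rewrite mule_ge0// lee_fin normal_pdf_ge0.
  - apply: emeasurable_funM; last by apply/measurable_EFinP; exact: measurable_normal_pdf.
    by apply/measurableT_comp => //; exact/measurable_EFinP.
  - by apply: emeasurable_funM => //; apply/measurable_EFinP; exact: measurable_normal_pdf.
  - move=> z _ /=; rewrite -EFinM lee_fin.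
    apply: (@le_trans _ _ (c * expR (z ^+ 2 / 4) * normal_pdf 0 1 z)).
      by apply: ler_wpM2r => //; exact: normal_pdf_ge0.
    rewrite normal_pdf01E normal_pdfE// /normal_fun subr0 sqr_sqrtr//.
    rewrite le_eqVlt; apply/orP; left; apply/eqP.
    have -> : expR (- z ^+ 2 / (2 *+ 2)) = expR (z ^+ 2 / 4) * expR (- z ^+ 2 / 2).
      by rewrite -expRD; congr expR; rewrite -mulr_natr; field.
    rewrite /k; field; rewrite gt_eqF// normal_peak_gt0//.
rewrite integralZl//; last exact: integrable_normal_pdf.
by rewrite integral_normal_pdf mule1 ltry.
Qed.

Lemma sqr_le_expR (R : realType) (z : R) : z ^+ 2 <= 64 * expR (z ^+ 2 / 4).
Proof.
have := expR_ge1Dx (z ^+ 2 / 4); have := sqr_ge0 z; lra.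
Qed.

(** The constant 64 arises from [64 (1 + y^2 / 8)^2 = (8 + y^2)^2 >= y^4 + y^2 >= 2 y^3], the
    exponential being at least [(1 + y^2 / 8)^2]. *)
Lemma cube_le_expR (R : realType) (z : R) : `|z| ^+ 3 <= 64 * expR (z ^+ 2 / 4).
Proof.
have -> : expR (z ^+ 2 / 4) = expR (z ^+ 2 / 8) ^+ 2.
  by rewrite [RHS]expr2 -expRD; congr expR; field.
rewrite -(real_normK (num_real z)); have := normr_ge0 z; move: `|z| => y y0.
have h := expR_ge1Dx (y ^+ 2 / 8).
have h2 : (1 + y ^+ 2 / 8) ^+ 2 <= expR (y ^+ 2 / 8) ^+ 2.
  rewrite ler_pXn2r// nnegrE ?expR_ge0//.
  by have := sqr_ge0 y; lra.
have y4 : 0 <= y ^+ 2 * (y - 1) ^+ 2 by rewrite mulr_ge0 ?sqr_ge0.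
have := sqr_ge0 y; nra.
Qed.

Lemma normal_prob_integrable_sqr (R : realType) :
  (normal_prob 0 1).-integrable setT (fun z : R => (z ^+ 2)%:E).
Proof.
apply: (@normal_prob_integrable _ (fun z => z ^+ 2) 64).
  exact: measurable_funX.
by move=> z; rewrite ger0_norm ?sqr_ge0// sqr_le_expR.
Qed.

Lemma normal_prob_integrable_cube (R : realType) :
  (normal_prob 0 1).-integrable setT (fun z : R => (`|z| ^+ 3)%:E).
Proof.
apply: (@normal_prob_integrable _ (fun z => `|z| ^+ 3) 64).
  by apply: measurable_funX => //; exact: normr_measurable.
by move=> z; rewrite (@ger0_norm _ (_ ^+ 3)) ?exprn_ge0//; exact: cube_le_expR.
Qed.

(** * Rademacher averages and the central limit theorem *)

Definition savg (R : realType) (E : lmodType R) (e : E) (f : E -> R) (s : E) : R :=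
  (f (s + e) + f (s - e)) / 2.

(** The expectation of [f (s + sum_e eps_e e)] over independent uniform signs [eps_e]: a Rademacher
    sum handled as an iterated finite average. *)
Fixpoint ravg (R : realType) (E : lmodType R) (es : seq E) (f : E -> R) : E -> R :=
  if es is e :: es' then ravg es' (savg e f) else f.

(** Averaging over [t *: e] and its opposite cancels the odd terms, hence no first derivative. The
    coefficient [D] depends on [s] but not on [t], so the Gaussian and the sign share their second
    order term; this form is also stable under [savg]. *)
Definition sym_taylor (R : realType) (E : lmodType R) (f : E -> R) (e : E) (C : R) :=
  forall s, exists D, forall t : R,
    `|savg (t *: e) f s - f s - D * t ^+ 2| <= C * `|t| ^+ 3.

Lemma savgC (R : realType) (E : lmodType R) (e1 e2 : E) (f : E -> R) :
  savg e1 (savg e2 f) = savg e2 (savg e1 f).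
Proof.
apply/funext => s; rewrite /savg.
by rewrite !(addrAC _ e1) !(addrAC _ (- e1)); field.
Qed.

Lemma savg_sym_taylor (R : realType) (E : lmodType R) (f : E -> R) (e e' : E) C :
  sym_taylor f e C -> sym_taylor (savg e' f) e C.
Proof.
move=> fe s; have [D1 H1] := fe (s + e'); have [D2 H2] := fe (s - e').
exists ((D1 + D2) / 2) => t; rewrite savgC {1}/savg {3}/savg.
have := H1 t; have := H2 t.
by rewrite !ler_norml => /andP[? ?] /andP[? ?]; apply/andP; split; lra.
Qed.

Lemma savg_01 (R : realType) (E : lmodType R) (f : E -> R) (e : E) :
  (forall s, 0 <= f s <= 1) -> forall s, 0 <= savg e f s <= 1.
Proof.
by move=> f01 s; rewrite /savg; have := f01 (s + e); have := f01 (s - e); lra.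
Qed.

Definition line_continuous (R : realType) (E : lmodType R) (f : E -> R) :=
  forall s e, continuous (fun z : R => f (s + z *: e)).

Lemma savg_line_continuous (R : realType) (E : lmodType R) (f : E -> R) (e : E) :
  line_continuous f -> line_continuous (savg e f).
Proof.
move=> cf s e' z; rewrite /savg.
have h v : continuous (fun z : R => f (s + z *: e' + v)).
  have -> : (fun z : R => f (s + z *: e' + v)) = (fun z : R => f (s + v + z *: e')).
    by apply/funext => y; rewrite addrAC.
  exact: cf.
by apply: cvgM; [apply: cvgD; exact: h|exact: cvg_cst].
Qed.

Definition normal_moment2 (R : realType) : R := \int[normal_prob 0 1]_z (z ^+ 2).

Definition normal_moment3 (R : realType) : R := \int[normal_prob 0 1]_z (`|z| ^+ 3).

(* Signs are scaled by [normal_sd], so that the value 1 of the Gaussian variance plays no role. *)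
Definition normal_sd (R : realType) : R := Num.sqrt (normal_moment2 R).

Definition lindeberg_cst (R : realType) : R := normal_moment3 R + normal_sd R ^+ 3.

Lemma normal_sd_ge0 (R : realType) : 0 <= normal_sd R.
Proof. exact: sqrtr_ge0. Qed.

Lemma normal_sd_sqr (R : realType) : normal_sd R ^+ 2 = normal_moment2 R.
Proof.
by rewrite sqr_sqrtr// /normal_moment2; apply: Rintegral_ge0 => x _; exact: sqr_ge0.
Qed.

Lemma line_integrable (R : realType) (E : lmodType R) (f : E -> R) (s e : E) (a : R) :
  (forall s, 0 <= f s <= 1) -> line_continuous f ->
  (normal_prob 0 1).-integrable setT (EFin \o (fun z : R => f (s + (a * z) *: e))).
Proof.
move=> f01 cf; apply: (@bounded_integrable _ _ _ (normal_prob 0 1) _ 1).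
  have mf : measurable_fun [set: R] (fun z : R => f (s + z *: e)).
    by apply: continuous_measurable_fun; exact: cf.
  have ma : measurable_fun [set: R] (fun z : R => a * z) by exact: measurable_funM.
  exact: (measurableT_comp mf ma).
by move=> z; rewrite ger0_norm; have /andP[] := f01 (s + (a * z) *: e).
Qed.

(** Both terms are [f s + D * t ^+ 2 * normal_moment2 R] up to third order, with the same [D]; the
    third absolute moments of the Gaussian and of the scaled sign add up to [lindeberg_cst]. *)
Lemma gauss_step (R : realType) (E : lmodType R) (f : E -> R) (e s : E) (C t : R) :
  (forall s, 0 <= f s <= 1) -> line_continuous f -> sym_taylor f e C -> 0 <= t ->
  `|\int[normal_prob 0 1]_z f (s + (t * z) *: e)
     - savg ((t * normal_sd R) *: e) f s| <= C * lindeberg_cst R * t ^+ 3.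
Proof.
move=> f01 cf fe t0; have [D HD] := fe s.
have i1 := line_integrable s e t f01 cf.
(* The law is symmetric, so the one-sided expectation can be replaced by the symmetric average to
   which [sym_taylor] applies. *)
have symE : \int[normal_prob 0 1]_z f (s + (t * z) *: e) =
    \int[normal_prob 0 1]_z savg ((t * z) *: e) f s.
  have i2 : (normal_prob 0 1).-integrable setT
      (EFin \o (fun z : R => f (s - (t * z) *: e))).
    have := line_integrable s e (- t) f01 cf.
    by apply: eq_integrable => // z _ /=; rewrite mulNr scaleNr.
  rewrite /savg RintegralZr//; last first.
    by have := integrableD measurableT i1 i2; apply: eq_integrable => // z _.
  rewrite RintegralD//.
  have <- : \int[normal_prob 0 1]_z f (s + (t * z) *: e) =
      \int[normal_prob 0 1]_z f (s - (t * z) *: e); last by field.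
  congr fine.
  rewrite -(@normal_prob_sym _ (fun z => (f (s + (t * z) *: e))%:E)).
  - by apply: eq_integral => z _; rewrite mulrN scaleNr.
  - exact: (measurable_int _ i1).
  - by move=> z; rewrite lee_fin; have /andP[] := f01 (s + (t * z) *: e).
have i3 : (normal_prob 0 1).-integrable setT
      (EFin \o (fun z : R => savg ((t * z) *: e) f s)).
  apply: (@bounded_integrable _ _ _ (normal_prob 0 1) _ 1).
    apply: measurable_funM => //; apply: measurable_funD.
      by have /measurable_EFinP := measurable_int _ i1.
    have := line_integrable s e (- t) f01 cf.
    move=> /(measurable_int _) /measurable_EFinP; apply: eq_measurable_fun => z _.
    by rewrite mulNr scaleNr.
  by move=> z; have := savg_01 ((t * z) *: e) f01 s; rewrite ler_norml; lra.
have i4 : (normal_prob 0 1).-integrable setT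
      (EFin \o (fun z : R => f s + D * t ^+ 2 * z ^+ 2)).
  have := integrableD measurableT (finite_measure_integrable_cst (normal_prob 0 1) (f s) measurableT)
    (integrableZl measurableT (D * t ^+ 2) (normal_prob_integrable_sqr R)).
  by apply: eq_integrable => // z _ /=; rewrite EFinD EFinM.
have m2E : \int[normal_prob 0 1]_z (f s + D * t ^+ 2 * z ^+ 2) =
    f s + D * (t * normal_sd R) ^+ 2.
  rewrite RintegralD//; last 2 first.
  - exact: finite_measure_integrable_cst.
  - have := integrableZl measurableT (D * t ^+ 2) (normal_prob_integrable_sqr R).
    by apply: eq_integrable => // z _ /=; rewrite EFinM.
  rewrite RintegralZl//; last exact: normal_prob_integrable_sqr.
  rewrite -/(normal_moment2 R) -normal_sd_sqr; congr (_ + _); last by ring.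
  rewrite (Rintegral_cst (normal_prob 0 1) measurableT).
  transitivity (f s * fine 1%E); last by rewrite mulr1.
  congr (_ * fine _); exact: (@probability_setT _ _ _ (normal_prob 0 1)).
rewrite symE.
have A : `|\int[normal_prob 0 1]_z savg ((t * z) *: e) f s
    - \int[normal_prob 0 1]_z (f s + D * t ^+ 2 * z ^+ 2)| <=
    C * t ^+ 3 * normal_moment3 R.
  rewrite -RintegralB//.
  have bi : (normal_prob 0 1).-integrable setT (EFin \o (fun z : R =>
      savg ((t * z) *: e) f s - (f s + D * t ^+ 2 * z ^+ 2))).
    by have := integrableB measurableT i3 i4; apply: eq_integrable => // z _; rewrite EFinB.
  apply: (le_trans (le_normr_Rintegral measurableT bi)).
  rewrite -RintegralZl//; last exact: normal_prob_integrable_cube.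
  apply: le_Rintegral => //.
  - exact: (integrable_norm bi).
  - have := integrableZl measurableT (C * t ^+ 3) (normal_prob_integrable_cube R).
    by apply: eq_integrable => // z _ /=; rewrite EFinM.
  - move=> z _; have := HD (t * z); rewrite normrM (ger0_norm t0) !exprMn.
    by rewrite !mulrA opprD addrA.
have := HD (t * normal_sd R).
rewrite (ger0_norm (mulr_ge0 t0 (normal_sd_ge0 R))) => B.
move: A; rewrite m2E /lindeberg_cst.
rewrite !ler_norml in B *; move: B => /andP[B1 B2] /andP[A1 A2].
rewrite exprMn in B1, B2.
by apply/andP; split; lra.
Qed.

Lemma gauss_split (R : realType) (u : R -> R) (x a b s : R) :
  continuous u -> (forall y, 0 <= u y <= 1) -> 0 < b -> 0 < s ->
  s ^+ 2 = a ^+ 2 + b ^+ 2 ->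
  \int[normal_prob 0 1]_z (\int[normal_prob 0 1]_z' u (x + a * z + b * z')) =
   \int[normal_prob 0 1]_z u (x + s * z).
Proof.
move=> cu u01 b0 s0 sE; congr fine.
have u0 y : 0 <= u y by have /andP[] := u01 y.
rewrite -(normal_prob_convolution x cu u0 b0 s0 sE).
apply: eq_integral => z _; rewrite fineK//.
have mu : measurable_fun setT u by exact: continuous_measurable_fun.
apply: integrable_fin_num => //.
apply: (@bounded_integrable _ _ _ (normal_prob 0 1) (fun z' => u (x + a * z + b * z')) 1).
  by apply: (measurableT_comp mu); apply: measurable_funD => //; apply: measurable_funM.
by move=> z'; rewrite ger0_norm//; have /andP[] := u01 (x + a * z + b * z').
Qed.

Lemma gauss_inner_integrable (R : realType) (E : lmodType R) (f : E -> R)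
    (e s : E) (a b : R) :
  (forall s, 0 <= f s <= 1) -> line_continuous f ->
  (normal_prob 0 1).-integrable setT (EFin \o (fun z : R =>
     \int[normal_prob 0 1]_z' f (s + (a * z) *: e + (b * z') *: e))).
Proof.
move=> f01 cf.
have mfe : measurable_fun [set: R] (fun y : R => f (s + y *: e)).
  by apply: continuous_measurable_fun; exact: cf.
have f0 x : 0 <= f x by have /andP[] := f01 x.
have fin (z : R) : (\int[normal_prob 0 1]_z' (f (s + (a * z) *: e + (b * z') *: e))%:E)%E
    \is a fin_num.
  by apply: integrable_fin_num => //; exact: line_integrable.
apply: (@bounded_integrable _ _ _ (normal_prob 0 1) _ 1).
  apply/measurable_EFinP.
  rewrite (_ : EFin \o _ = fun z => \int[normal_prob 0 1]_z' (f (s + (a * z) *: e + (b * z') *: e))%:E)%E;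
    last by apply/funext => z /=; rewrite fineK.
  apply: (@measurable_fun_fubini_tonelli_F _ _ _ _ _ (normal_prob 0 1)
    (fun zz : R * R => (f (s + (a * zz.1) *: e + (b * zz.2) *: e))%:E)); last first.
    by move=> zz; rewrite lee_fin.
  apply/measurable_EFinP.
  rewrite (_ : (fun zz : R * R => _) =
    (fun y => f (s + y *: e)) \o (fun zz : R * R => a * zz.1 + b * zz.2)); last first.
    by apply/funext => zz /=; rewrite scalerDl addrA.
  by apply: (measurableT_comp mfe); apply: measurable_funD; apply: measurable_funM.
move=> z; rewrite ger0_norm; last exact: Rintegral_ge0.
rewrite -lee_fin fineK//.
apply: (@le_trans _ _ (\int[normal_prob 0 1]_(x in [set: R]) cst 1%E x)%E).
  apply: ge0_le_integral => //.
  - by move=> z' _; rewrite lee_fin.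
  - apply: measurable_int; exact: (line_integrable _ _ _ f01 cf).
  - by move=> z' _; rewrite lee_fin; have /andP[] := f01 (s + (a * z) *: e + (b * z') *: e).
rewrite integral_cst// mul1e.
exact: (@probability_le1 _ _ _ (normal_prob 0 1)).
Qed.

(* Lindeberg: the variance [t^2] increments of the Gaussian are replaced one at a time
   by signs of the same variance. *)
Lemma gauss_rademacher (R : realType) (E : lmodType R) (f : E -> R) (e s : E) (C t : R) (j : nat) :
  (forall s, 0 <= f s <= 1) -> line_continuous f -> sym_taylor f e C -> 0 < t ->
  `|\int[normal_prob 0 1]_z f (s + (Num.sqrt j%:R * t * z) *: e)
     - ravg (nseq j ((t * normal_sd R) *: e)) f s| <= j%:R * (C * lindeberg_cst R * t ^+ 3).
Proof.
move=> + + + t0; elim: j f => [|j IH] f f01 cf fe.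
  rewrite /= mul0r.
  have -> : \int[normal_prob 0 1]_z f (s + (Num.sqrt 0 * t * z) *: e) = f s.
    rewrite (_ : (fun z => _) = cst (f s)); last first.
      by apply/funext => z; rewrite sqrtr0 !mul0r scale0r addr0.
    rewrite (Rintegral_cst (normal_prob 0 1) measurableT).
    transitivity (f s * fine 1%E); last by rewrite mulr1.
    congr (_ * fine _); exact: (@probability_setT _ _ _ (normal_prob 0 1)).
  by rewrite subrr normr0.
set v := (t * normal_sd R) *: e.
have IH' := IH (savg v f) (savg_01 v f01) (@savg_line_continuous _ _ _ v cf) (@savg_sym_taylor _ _ _ _ v _ fe).
set r := Num.sqrt j%:R * t in IH'.
(* A Gaussian of variance [(j+1) t^2] is the sum of one of variance [j t^2], left to the induction
   hypothesis, and an increment of variance [t^2], which is replaced by a sign. The induction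
   hypothesis is taken for [savg v f] because this sign has then been averaged out. *)
have -> : \int[normal_prob 0 1]_z f (s + (Num.sqrt j.+1%:R * t * z) *: e) =
  \int[normal_prob 0 1]_z (\int[normal_prob 0 1]_z' f (s + (r * z) *: e + (t * z') *: e)).
  have := @gauss_split _ (fun y => f (s + y *: e)) 0 r t (Num.sqrt j.+1%:R * t) _ _ t0 _ _.
  move=> H; apply/esym; etransitivity; last first.
    etransitivity; first apply: H.
    - exact: cf.
    - by move=> y; exact: f01.
    - by rewrite mulr_gt0// sqrtr_gt0 ltr0n.
    - by rewrite /r !exprMn !sqr_sqrtr ?ler0n// -natr1; ring.
    - by apply: eq_Rintegral => z _; rewrite add0r.
  apply: eq_Rintegral => z _; apply: eq_Rintegral => z' _.
  by rewrite add0r scalerDl addrA.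
have step : `|\int[normal_prob 0 1]_z (\int[normal_prob 0 1]_z' f (s + (r * z) *: e + (t * z') *: e))
    - \int[normal_prob 0 1]_z savg v f (s + (r * z) *: e)| <= C * lindeberg_cst R * t ^+ 3.
  apply: (@Rintegral_dist _ _ _ (normal_prob 0 1)).
  - exact: gauss_inner_integrable.
  - apply: line_integrable; [exact: savg_01|exact: savg_line_continuous].
  - by move=> z; apply: gauss_step => //; exact: ltW.
move: step IH'; rewrite -[j.+1%:R]natr1 !ler_norml /=.
set I1 := Rintegral _ _ _; set I2 := Rintegral _ _ _; set I3 := ravg _ _ _.
by move=> /andP[? ?] /andP[? ?]; apply/andP; split; lra.
Qed.

(** * Independence *)

(** The first component of the pair is the sample point itself, seen through the sigma-algebra
    generated by the pi-system [G]. Independence extends from [G] to that sigma-algebra by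
    uniqueness of measures, so the law of the pair is a product measure and Tonelli applies. *)
Lemma integral_independent (R : realType) (d : measure_display) (T : measurableType d)
    (P : probability T R) (G : set (set T)) (Y : T -> R) :
  setI_closed G -> G setT -> G `<=` measurable -> measurable_fun setT Y ->
  (forall A B, G A -> measurable B ->
    P (A `&` Y @^-1` B) = (P A * normal_prob 0 1 B)%E) ->
  forall F : g_sigma_algebraType G * R -> \bar R,
    measurable_fun setT F -> (forall z, (0 <= F z)%E) ->
  (\int[P]_t F (t, Y t) = \int[P]_t \int[normal_prob 0 1]_z F (t, z))%E.
Proof.
move=> GI GT Gm mY GY F mF F0.
have sGm : <<s G >> `<=` measurable.
  by apply: smallest_sub => //; exact: sigma_algebra_measurable.
have mYB (B : set R) : measurable B -> measurable (Y @^-1` B).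
  by move=> mB; rewrite -[X in measurable X]setTI; exact: mY.
have sGY (A : set T) (B : set R) : <<s G >> A -> measurable B ->
    P (A `&` Y @^-1` B) = (P A * normal_prob 0 1 B)%E.
  move=> sGA mB.
  have finB : normal_prob 0 1 B \is a fin_num.
    exact: (@fin_num_measure _ _ _ (normal_prob 0 1)).
  have c0 : 0 <= fine (normal_prob 0 1 B) by rewrite fine_ge0.
  transitivity (mscale (NngNum c0) P A); last first.
    by rewrite /mscale muleC; congr (_ * _)%E; exact: fineK.
  apply: (g_sigma_algebra_measure_unique G Gm (fun=> setT) _ _
    (mrestr P (mYB _ mB)) (mscale (NngNum c0) P)) => //.
  - by rewrite bigcup_const//; exists 0%N.
  - move=> A' GA'; transitivity (P A' * normal_prob 0 1 B)%E; first exact: GY.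
    by rewrite /mscale muleC; congr (_ * _)%E; exact/esym/fineK.
  - move=> _; rewrite /= /mrestr setTI.
    by apply: (le_lt_trans (probability_le1 _ _)); [exact: mYB|exact: ltry].
have mid : measurable_fun setT (fun t : T => t : g_sigma_algebraType G).
  by move=> _ A mA; rewrite setTI; exact: sGm.
have mpair : measurable_fun setT
    (fun t : T => (t : g_sigma_algebraType G, Y t : measurableTypeR R)).
  exact: measurable_fun_pair.
pose P1 : {mfun T >-> g_sigma_algebraType G} :=
  HB.pack (fun t : T => t : g_sigma_algebraType G)
    (isMeasurableFun.Build _ _ _ _ _ mid).
pose P2 : {mfun T >-> (g_sigma_algebraType G * measurableTypeR R)%type} :=
  HB.pack (fun t : T => (t : g_sigma_algebraType G, Y t : measurableTypeR R))
    (isMeasurableFun.Build _ _ _ _ _ mpair).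
transitivity (\int[distribution P P2]_z F z)%E.
  by rewrite /distribution ge0_integral_pushforward.
transitivity (\int[(distribution P P1) \x (normal_prob 0 1)]_z F z)%E.
  apply: eq_measure_integral => A mA _; apply/esym.
  apply: (@product_measure_unique _ _ _ _ _ (distribution P P1) (normal_prob 0 1)
    (distribution P P2)) ; last exact: mA.
  move=> A1 A2 mA1 mA2.
  by transitivity (P (A1 `&` Y @^-1` A2)); [|rewrite (sGY A1 A2 mA1 mA2)].
rewrite (fubini_tonelli1 (m1 := distribution P P1) (m2 := normal_prob 0 1))//.
rewrite /distribution ge0_integral_pushforward//.
  exact: measurable_fun_fubini_tonelli_F.
by move=> x _; apply: integral_ge0.
Qed.

Lemma ravg_cat (R : realType) (E : lmodType R) (es1 es2 : seq E) (f : E -> R) :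
  ravg (es1 ++ es2) f = ravg es2 (ravg es1 f).
Proof. by elim: es1 f => //= e es1 IH f; rewrite IH. Qed.

Lemma ravg_01 (R : realType) (E : lmodType R) (es : seq E) (f : E -> R) :
  (forall s, 0 <= f s <= 1) -> forall s, 0 <= ravg es f s <= 1.
Proof. by elim: es f => //= e es IH f f01; apply: IH; exact: savg_01. Qed.

Lemma ravg_line_continuous (R : realType) (E : lmodType R) (es : seq E) (f : E -> R) :
  line_continuous f -> line_continuous (ravg es f).
Proof. by elim: es f => //= e es IH f cf; apply: IH; exact: savg_line_continuous. Qed.

Lemma ravg_sym_taylor (R : realType) (E : lmodType R) (es : seq E) (f : E -> R) (e : E) C :
  sym_taylor f e C -> sym_taylor (ravg es f) e C.
Proof. by elim: es f => //= e' es IH f fe; apply: IH; exact: savg_sym_taylor. Qed.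

(** Measurability for the product sigma-algebra of the entries, phrased through composition with an
    arbitrary random matrix. *)
Definition mx_measurable (R : realType) (m n : nat) (f : 'M[R]_(m, n) -> R) :=
  forall (d : measure_display) (T : measurableType d) (X : T -> 'M[R]_(m, n)),
    (forall i j, measurable_fun setT (fun t => X t i j)) ->
    measurable_fun setT (fun t => f (X t)).

Lemma ravg_mx_measurable (R : realType) (m n : nat) (es : seq 'M[R]_(m, n)) f :
  mx_measurable f -> mx_measurable (ravg es f).
Proof.
elim: es f => //= e es IH f mf; apply: IH => d T X mX; rewrite /savg.
apply: measurable_funM => //; apply: measurable_funD; apply: mf => i j.
  by under eq_fun do rewrite mxE; exact: measurable_funD.
by under eq_fun do rewrite !mxE; exact: measurable_funD.
Qed.

Lemma measurable_mx_sum (R : realType) (m n : nat) (d : measure_display)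
    (T : measurableType d) (I : eqType) (rs : seq I) (X : I -> T -> R)
    (e : I -> 'M[R]_(m, n)) (s : 'M[R]_(m, n)) :
  (forall i, i \in rs -> measurable_fun setT (X i)) ->
  forall i j, measurable_fun setT (fun t => (s + \sum_(r <- rs) X r t *: e r) i j).
Proof.
move=> mX i j.
have -> : (fun t => (s + \sum_(r <- rs) X r t *: e r) i j) =
    (fun t => s i j + \sum_(r <- rs) X r t * e r i j).
  apply/funext => t; rewrite mxE summxE; congr (_ + _).
  by apply: eq_bigr => r _; rewrite mxE.
apply: measurable_funD => //.
elim: rs mX => [|r rs IH] mX.
  rewrite (_ : (fun t => _) = cst 0)//.
  by apply/funext => t; rewrite big_nil.
rewrite (_ : (fun t => _) = fun t => X r t * e r i j + \sum_(r0 <- rs) X r0 t * e r0 i j); last first.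
  by apply/funext => t; rewrite big_cons.
apply: measurable_funD; last by apply: IH => r' r'rs; apply: mX; rewrite inE r'rs orbT.
by apply: measurable_funM => //; apply: mX; rewrite inE eqxx.
Qed.

(** The past is generated by the cylinder events of the variables in [rs]. Adding the index [r] to a
    cylinder turns the product formula of mutual independence into independence of [X r] from this
    pi-system. *)
Lemma integral_fresh_normal (R : realType) (m n : nat) (d : measure_display)
    (T : measurableType d) (P : probability T R) (I : finType) (X : I -> T -> R)
    (rs : seq I) (r : I) (e : I -> 'M[R]_(m, n)) (s v : 'M[R]_(m, n)) (f : 'M[R]_(m, n) -> R) :
  mutually_independent P X -> (forall i, std_normal P (X i)) ->
  r \notin rs -> (forall x, 0 <= f x) -> mx_measurable f ->
  (\int[P]_t (f (s + \sum_(i <- rs) X i t *: e i + X r t *: v))%:E =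
   \int[P]_t \int[normal_prob 0 1]_z (f (s + \sum_(i <- rs) X i t *: e i + z *: v))%:E)%E.
Proof.
move=> [mX indX] nX rrs f0 mf.
pose J := [set i in rs]%SET.
pose cyl (Bs : I -> set R) := \bigcap_(i in [set` J]) (X i @^-1` Bs i).
pose G := [set A | exists2 Bs, (forall i, measurable (Bs i)) & A = cyl Bs].
have mXB i (B : set R) : measurable B -> measurable (X i @^-1` B).
  by move=> mB; rewrite -[Y in measurable Y]setTI; exact: mX.
have Gm : G `<=` measurable.
  move=> _ [Bs mBs ->]; apply: fin_bigcap_measurable; first exact: finite_finset.
  by move=> i _; exact: mXB.
have mXG i : i \in rs -> measurable_fun setT (X i : g_sigma_algebraType G -> R).
  move=> irs _ B mB; rewrite setTI; apply: sub_sigma_algebra.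
  exists (fun j => if j == i then B else setT) => [j|]; first by case: ifP.
  apply/seteqP; split => t /=.
    by move=> XB j _ /=; case: eqP => // ->.
  by move=> /(_ i); rewrite /= inE irs eqxx; exact.
apply: (@integral_independent _ _ _ P G (X r) _ _ Gm (mX r) _
  (fun tz : g_sigma_algebraType G * R =>
     (f (s + \sum_(i <- rs) X i tz.1 *: e i + tz.2 *: v))%:E)).
- move=> _ _ [B1 mB1 ->] [B2 mB2 ->]; exists (fun i => B1 i `&` B2 i).
    by move=> i; exact: measurableI.
  by rewrite /cyl -bigcapI.
- exists (fun=> setT) => //; rewrite /cyl.
  by apply/seteqP; split => // t _ i _.
- move=> _ B [Bs mBs ->] mB.
  pose Bs' i := if i == r then B else Bs i.
  have mBs' i : measurable (Bs' i) by rewrite /Bs'; case: ifP.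
  have rJ : r \notin J by rewrite inE.
  have -> : cyl Bs `&` X r @^-1` B =
      \bigcap_(i in [set` (r |: J)%SET]) (X i @^-1` Bs' i).
    apply/seteqP; split => t.
      move=> [cB XB] i /=; rewrite !inE /Bs'.
      by case: eqP => [->//|ir] /= irs; apply: cB; rewrite /= inE.
    move=> h; split; last first.
      by have := h r; rewrite /= !inE eqxx /Bs' eqxx; exact.
    move=> i /= iJ; have := h i; rewrite /= !inE /Bs'.
    have ir : i != r by apply: contraNneq rJ => <-.
    have irs : i \in rs by move: iJ; rewrite /= inE.
    by rewrite (negbTE ir) irs; apply.
  rewrite indX// big_setU1//= muleC /Bs' eqxx nX// /cyl indX//; congr (_ * _)%E.
  apply: eq_bigr => i iJ.
  have ir : i != r by apply: contraNneq rJ => <-.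
  by rewrite (negbTE ir).
- apply/measurable_EFinP; apply: mf => i j.
  under eq_fun do rewrite mxE.
  apply: measurable_funD.
    apply: (measurable_mx_sum _ _ (X := fun i (tz : g_sigma_algebraType G * R) => X i tz.1)) => k krs.
    by apply: measurableT_comp => //; exact: mXG.
  by under eq_fun do rewrite mxE; exact: measurable_funM.
- by move=> tz; rewrite lee_fin.
Qed.

(** Replacing one variable by its signs changes [f] into an average with the same regularity
    constants, so the induction can continue with the remaining variables. *)
Lemma normal_to_ravg (R : realType) (m n : nat) (d : measure_display)
    (T : measurableType d) (P : probability T R) (I : finType) (X : I -> T -> R)
    (rs : seq I) (e : I -> 'M[R]_(m, n)) (s : 'M[R]_(m, n)) (f : 'M[R]_(m, n) -> R)
    (C : R) (N : nat) :
  mutually_independent P X -> (forall i, std_normal P (X i)) -> uniq rs ->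
  (forall x, 0 <= f x <= 1) -> line_continuous f -> mx_measurable f ->
  (forall i, sym_taylor f (e i) C) ->
  `|\int[P]_t f (s + \sum_(i <- rs) X i t *: e i)
    - ravg (flatten [seq nseq N.+1 (((Num.sqrt N.+1%:R)^-1 * normal_sd R) *: e i) | i <- rs]) f s|
  <= (size rs)%:R * (C * lindeberg_cst R / Num.sqrt N.+1%:R).
Proof.
move=> iX nX + + + +; elim: rs f => [|r rs IH] f urs f01 cf mf fe.
  rewrite /= mul0r.
  have -> : \int[P]_t f (s + \sum_(i <- [::]) X i t *: e i) = f s.
    rewrite (_ : (fun t => _) = cst (f s)); last first.
      by apply/funext => z; rewrite big_nil addr0.
    rewrite (Rintegral_cst P measurableT).
    transitivity (f s * fine 1%E); last by rewrite mulr1.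
    congr (_ * fine _); exact: probability_setT.
  by rewrite subrr normr0.
have /andP[rrs {}urs] : (r \notin rs) && uniq rs by [].
set q := Num.sqrt N.+1%:R in IH *.
have q0 : 0 < q by rewrite sqrtr_gt0 ltr0n.
set v := (q^-1 * normal_sd R) *: e r.
set g := ravg (nseq N.+1 v) f.
have g01 : forall x, 0 <= g x <= 1 by exact: ravg_01.
have cg : line_continuous g by exact: ravg_line_continuous.
have mg : mx_measurable g by exact: ravg_mx_measurable.
have ge i : sym_taylor g (e i) C by apply: ravg_sym_taylor.
have := IH g urs g01 cg mg ge.
have fl (x : seq 'M[R]_(m, n)) xs : flatten (x :: xs) = x ++ flatten xs by [].
rewrite map_cons fl ravg_cat -/v -/g.
set a := ravg _ _ _.
have f0 x : 0 <= f x by have /andP[] := f01 x.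
have [mX _] := iX.
have W0 z t : f (s + \sum_(i <- rs) X i t *: e i + z *: e r) =
    f (s + \sum_(i <- rs) X i t *: e i + (1 * z) *: e r) by rewrite mul1r.
have fin t : (\int[normal_prob 0 1]_z (f (s + \sum_(i <- rs) X i t *: e i + z *: e r))%:E)%E
    \is a fin_num.
  under eq_integral do rewrite W0.
  by apply: integrable_fin_num => //; exact: line_integrable.
have stepE : \int[P]_t f (s + \sum_(i <- r :: rs) X i t *: e i) =
    \int[P]_t \int[normal_prob 0 1]_z f (s + \sum_(i <- rs) X i t *: e i + z *: e r).
  congr fine; transitivity (\int[P]_t (f (s + \sum_(i <- rs) X i t *: e i + X r t *: e r))%:E)%E.
    by apply: eq_integral => t _; rewrite big_cons [X in s + X]addrC addrA.
  rewrite (@integral_fresh_normal _ _ _ _ _ P _ X rs r e s (e r) f)//.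
  by apply: eq_integral => t _; rewrite fineK.
rewrite stepE.
have B : `|\int[P]_t \int[normal_prob 0 1]_z f (s + \sum_(i <- rs) X i t *: e i + z *: e r)
   - \int[P]_t g (s + \sum_(i <- rs) X i t *: e i)| <= C * lindeberg_cst R / q.
  apply: Rintegral_dist.
  - apply: (@bounded_integrable _ _ _ P _ 1).
      apply/measurable_EFinP.
      rewrite (_ : EFin \o _ = fun t => \int[normal_prob 0 1]_z
         (f (s + \sum_(i <- rs) X i t *: e i + z *: e r))%:E)%E; last first.
        by apply/funext => t /=; rewrite fineK.
      apply: (@measurable_fun_fubini_tonelli_F _ _ _ _ _ (normal_prob 0 1)
        (fun tz : T * R => (f (s + \sum_(i <- rs) X i tz.1 *: e i + tz.2 *: e r))%:E)); last first.
        by move=> tz; rewrite lee_fin.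
      apply/measurable_EFinP; apply: mf => i j.
      under eq_fun do rewrite mxE.
      apply: measurable_funD.
        apply: (measurable_mx_sum _ _ (X := fun i (tz : T * R) => X i tz.1)) => k krs.
        by apply: measurableT_comp => //; exact: mX.
      by under eq_fun do rewrite mxE; exact: measurable_funM.
    move=> t; rewrite ger0_norm; last exact: Rintegral_ge0.
    rewrite -lee_fin fineK//.
    apply: (@le_trans _ _ (\int[normal_prob 0 1]_(x in [set: R]) cst 1%E x)%E).
      apply: ge0_le_integral => //.
      + by move=> z' _; rewrite lee_fin.
      + have := measurable_int _ (line_integrable (s + \sum_(i <- rs) X i t *: e i) (e r) 1 f01 cf).
        by apply: eq_measurable_fun => z _ /=; rewrite mul1r.
      + by move=> z' _; rewrite lee_fin; have /andP[] := f01 (s + \sum_(i <- rs) X i t *: e i + z' *: e r).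
    rewrite integral_cst// mul1e.
    exact: (@probability_le1 _ _ _ (normal_prob 0 1)).
  - apply: (@bounded_integrable _ _ _ P _ 1).
      by apply: mg; apply: measurable_mx_sum.
    by move=> t; have := g01 (s + \sum_(i <- rs) X i t *: e i); rewrite ler_norml; lra.
  - move=> t; set w := s + _.
    have := @gauss_rademacher _ _ f (e r) w C q^-1 N.+1 f01 cf (fe r).
    rewrite invr_gt0 q0 => /(_ isT).
    have -> : N.+1%:R = q ^+ 2 by rewrite sqr_sqrtr// ler0n.
    rewrite -/q -/v -/g.
    (* There are [q^2] increments, each with an error of order [q^-3]; this yields the rate
       [1 / q]. *)
    have -> : q ^+ 2 * (C * lindeberg_cst R * q^-1 ^+ 3) = C * lindeberg_cst R / q.
      by field; rewrite gt_eqF.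
    rewrite (_ : Num.sqrt (q ^+ 2) = q); last by rewrite sqrtr_sqr gtr0_norm.
    rewrite (_ : (fun z => f (w + (q / q * z) *: e r)) = (fun z => f (w + z *: e r)))//.
    by apply/funext => z; rewrite divff ?gt_eqF// mul1r.
move: B; rewrite -[(size rs).+1%:R]natr1 !ler_norml.
set I1 := Rintegral _ _ _; set I2 := Rintegral _ _ _.
by move=> /andP[? ?] /andP[? ?]; apply/andP; split; lra.
Qed.

(** * A smooth test function *)

Definition ppart (R : realType) (x : R) : R := Num.max x 0.

Lemma ppart_ge (R : realType) (x : R) : 0 <= x -> ppart x = x.
Proof. by move=> x0; rewrite /ppart max_l. Qed.

Lemma ppart_le (R : realType) (x : R) : x <= 0 -> ppart x = 0.
Proof. by move=> x0; rewrite /ppart max_r. Qed.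

(** The second derivative of [ppart x ^+ 3] is [6 * ppart x], which is 6-Lipschitz, so the Taylor
    remainder is at most [|h|^3]. *)
Lemma ppart_cube_taylor (R : realType) (x h : R) :
  `|ppart (x + h) ^+ 3 - ppart x ^+ 3 - 3 * ppart x ^+ 2 * h - 3 * ppart x * h ^+ 2|
  <= `|h| ^+ 3.
Proof.
have cubeP (y z : R) : 0 <= y -> y <= z -> y ^+ 3 <= z ^+ 3.
  by move=> y0 yz; rewrite lerXn2r// nnegrE (le_trans y0).
have [x0|/ltW x0] := leP 0 x; have [xh0|/ltW xh0] := leP 0 (x + h).
- rewrite !ppart_ge// -normrX.
  by rewrite (_ : _ - _ = h ^+ 3)//; ring.
- rewrite (ppart_ge x0) (ppart_le xh0) expr0n/=.
  have h0 : h <= 0 by lra.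
  rewrite (_ : _ - _ = (- (x + h)) ^+ 3 - (- h) ^+ 3); last by ring.
  have h1 : 0 <= - (x + h) by lra.
  have h2 : - (x + h) <= - h by lra.
  have := cubeP _ _ h1 h2; have := exprn_ge0 3 h1.
  by rewrite (ler0_norm h0) ler_norml; lra.
- rewrite (ppart_le x0) (ppart_ge xh0) expr0n/= expr0n/= mulr0 !mul0r !subr0.
  have h0 : 0 <= h by lra.
  rewrite (ger0_norm h0) ger0_norm ?exprn_ge0//.
  by apply: cubeP => //; lra.
- rewrite (ppart_le x0) (ppart_le xh0) expr0n/= expr0n/= mulr0 !mul0r !subr0 normr0.
  by rewrite exprn_ge0.
Qed.

(* The cubic spline whose derivative is the quadratic B-spline with knots 0, 1, 2, 3. *)
Definition sstep (R : realType) (x : R) : R :=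
  (ppart x ^+ 3 - 3 * ppart (x - 1) ^+ 3 + 3 * ppart (x - 2) ^+ 3 - ppart (x - 3) ^+ 3) / 6.

Definition sstep1 (R : realType) (x : R) : R :=
  (ppart x ^+ 2 - 3 * ppart (x - 1) ^+ 2 + 3 * ppart (x - 2) ^+ 2 - ppart (x - 3) ^+ 2) / 2.

(** Half of the second derivative of [sstep], the coefficient of [h ^+ 2] in its expansion. *)
Definition sstep2 (R : realType) (x : R) : R :=
  (ppart x - 3 * ppart (x - 1) + 3 * ppart (x - 2) - ppart (x - 3)) / 2.

(** The four cubes contribute [(1 + 3 + 3 + 1) / 6] to the constant, which is below 2. *)
Lemma sstep_taylor (R : realType) (x h : R) :
  `|sstep (x + h) - sstep x - sstep1 x * h - sstep2 x * h ^+ 2| <= 2 * `|h| ^+ 3.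
Proof.
have H y := ppart_cube_taylor y h.
have := H x; have := H (x - 1); have := H (x - 2); have := H (x - 3).
rewrite /sstep /sstep1 /sstep2 !(addrAC x h).
have := exprn_ge0 3 (normr_ge0 h).
rewrite !ler_norml; set A := `|h| ^+ 3.
by move=> A0 /andP[? ?] /andP[? ?] /andP[? ?] /andP[? ?]; apply/andP; split; lra.
Qed.

Lemma sstep_cases (R : realType) (x : R) :
  [\/ x <= 0 /\ [/\ sstep x = 0, sstep1 x = 0 & sstep2 x = 0],
      0 <= x <= 1 /\ [/\ sstep x = x ^+ 3 / 6, sstep1 x = x ^+ 2 / 2 & sstep2 x = x / 2],
      exists2 y, 0 <= y <= 1 & [/\ sstep x = (1 + 3 * y + 3 * y ^+ 2 - 2 * y ^+ 3) / 6,
        sstep1 x = (1 + 2 * y - 2 * y ^+ 2) / 2 & sstep2 x = (1 - 2 * y) / 2] |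
      exists2 y, 0 <= y <= 1 & [/\ sstep x = 1 - y ^+ 3 / 6,
        sstep1 x = y ^+ 2 / 2 & sstep2 x = - y / 2]] \/
  3 <= x /\ [/\ sstep x = 1, sstep1 x = 0 & sstep2 x = 0].
Proof.
rewrite /sstep /sstep1 /sstep2.
have [x0|/ltW x0] := leP x 0.
  left; apply: Or41; split => //.
  by rewrite !ppart_le; [split; lra|lra..].
have [x1|/ltW x1] := leP x 1.
  left; apply: Or42; split; first by apply/andP.
  rewrite (ppart_ge x0) !(@ppart_le _ (x - _)); [|lra..].
  by split; field.
have [x2|/ltW x2] := leP x 2.
  left; apply: Or43; exists (x - 1); first by lra.
  rewrite (ppart_ge x0) (@ppart_ge _ (x - 1)); last lra.
  rewrite !(@ppart_le _ (x - _)); [|lra..].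
  by split; field.
have [x3|/ltW x3] := leP x 3.
  left; apply: Or44; exists (3 - x); first by lra.
  rewrite (ppart_ge x0) (@ppart_ge _ (x - 1)); last lra.
  rewrite (@ppart_ge _ (x - 2)); last lra.
  rewrite !(@ppart_le _ (x - _)); [|lra..].
  by split; field.
right; split => //.
rewrite !ppart_ge; [|lra..].
by split; field.
Qed.

Lemma sstep_le0 (R : realType) (x : R) : x <= 0 -> sstep x = 0.
Proof. by move=> x0; rewrite /sstep !ppart_le; lra. Qed.

Lemma sstep_ge3 (R : realType) (x : R) : 3 <= x -> sstep x = 1.
Proof. by move=> x0; rewrite /sstep !ppart_ge; [field|lra..]. Qed.

Lemma sstep_bounds (R : realType) (x : R) :
  [/\ 0 <= sstep x <= 1, 0 <= sstep1 x <= 1 & `|sstep2 x| <= 1].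
Proof.
have pow (y : R) : 0 <= y <= 1 -> [/\ 0 <= y ^+ 3, y ^+ 3 <= y ^+ 2 & y ^+ 2 <= y].
  move=> /andP[y0 y1]; split; first exact: exprn_ge0.
    by rewrite exprS ler_piMl// exprn_ge0.
  by rewrite expr2 ler_piMl.
rewrite ler_norml.
have [[[x0 [-> -> ->]]|[x01 [-> -> ->]]|[y y01 [-> -> ->]]|[y y01 [-> -> ->]]]|
  [x3 [-> -> ->]]] := sstep_cases x.
- by split; lra.
- by have [] := pow _ x01; move=> *; split; lra.
- have [h1 h2 h3] := pow _ y01.
  have h4 : 0 <= (1 - y) ^+ 2 * (1 + 2 * y) by rewrite mulr_ge0 ?sqr_ge0//; lra.
  have h5 := sqr_ge0 (2 * y - 1).
  by split; lra.
- by have [] := pow _ y01; move=> *; split; lra.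
- by split; lra.
Qed.

Lemma measurable_sstep (R : realType) : measurable_fun setT (@sstep R).
Proof.
have mp (a : R) : measurable_fun setT (fun x : R => ppart (x - a) ^+ 3).
  apply: measurable_funX; rewrite /ppart; apply: measurable_maxr => //.
  exact: measurable_funB.
have mp0 : measurable_fun setT (fun x : R => ppart x ^+ 3).
  by have := mp 0; apply: eq_measurable_fun => x _; rewrite subr0.
apply: measurable_funM => //; apply: measurable_funB => //.
apply: measurable_funD; last exact: measurable_funM.
by apply: measurable_funB => //; exact: measurable_funM.
Qed.

(** * Second order Taylor expansions of functions of a matrix *)

Definition entry (R : realType) (m n : nat) (h : 'M[R]_(m, n)) (a : 'I_m * 'I_n) : R :=
  h a.1 a.2.

Definition norm1 (R : realType) (m n : nat) (h : 'M[R]_(m, n)) : R :=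
  \sum_a `|entry h a|.

Definition linpart (R : realType) (m n : nat) (D : 'I_m * 'I_n -> R) (h : 'M[R]_(m, n)) : R :=
  \sum_a D a * entry h a.

Definition quadpart (R : realType) (m n : nat) (D : 'I_m * 'I_n -> 'I_m * 'I_n -> R)
    (h : 'M[R]_(m, n)) : R :=
  \sum_a \sum_b D a b * (entry h a * entry h b).

Lemma norm1_ge0 (R : realType) (m n : nat) (h : 'M[R]_(m, n)) : 0 <= norm1 h.
Proof. by apply: sumr_ge0 => a _. Qed.

Lemma linpart_le (R : realType) (m n : nat) D (h : 'M[R]_(m, n)) C :
  (forall a, `|D a| <= C) -> `|linpart D h| <= C * norm1 h.
Proof.
move=> DC; apply: (le_trans (ler_norm_sum _ _ _)).
rewrite /norm1 mulr_sumr; apply: ler_sum => a _.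
by rewrite normrM ler_wpM2r.
Qed.

Lemma quadpart_le (R : realType) (m n : nat) D (h : 'M[R]_(m, n)) C :
  (forall a b, `|D a b| <= C) -> `|quadpart D h| <= C * norm1 h ^+ 2.
Proof.
move=> DC; apply: (le_trans (ler_norm_sum _ _ _)).
rewrite expr2 /norm1 big_distrlr /= mulr_sumr; apply: ler_sum => a _.
apply: (le_trans (ler_norm_sum _ _ _)).
rewrite mulr_sumr; apply: ler_sum => b _.
by rewrite normrM ler_pM// normrM.
Qed.

(* [D2] is half of the Hessian. *)
Definition taylor2 (R : realType) (m n : nat) (f : 'M[R]_(m, n) -> R)
    (D1 : 'M[R]_(m, n) -> 'I_m * 'I_n -> R)
    (D2 : 'M[R]_(m, n) -> 'I_m * 'I_n -> 'I_m * 'I_n -> R) (C : R) :=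
  [/\ 0 <= C, forall s a, `|D1 s a| <= C, forall s a b, `|D2 s a b| <= C &
    forall s h, norm1 h <= 1 ->
      `|f (s + h) - f s - linpart (D1 s) h - quadpart (D2 s) h| <= C * norm1 h ^+ 3].

(** The unprimed letters expand the first factor, the primed ones the second. The hypothesis on
    [g + l' + q' + r'] is the bound on the shifted second factor: [r] multiplies it unexpanded, and
    all other leftover terms have order at least three. *)
Lemma product_remainder (R : realType) (N C C' f l q r g l' q' r' : R) :
  0 <= N <= 1 -> 0 <= C -> 0 <= C' -> `|f| <= 1 -> `|g + l' + q' + r'| <= 1 ->
  `|l| <= C * N -> `|q| <= C * N ^+ 2 -> `|r| <= C * N ^+ 3 ->
  `|l'| <= C' * N -> `|q'| <= C' * N ^+ 2 -> `|r'| <= C' * N ^+ 3 ->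
  `|(f + l + q + r) * (g + l' + q' + r') - f * g - (l * g + f * l')
    - (q * g + f * q' + l * l')| <= (C + (1 + 2 * C) * C' + 3 * C * C') * N ^+ 3.
Proof.
move=> /andP[N0 N1] C0 C'0 f1 g1 lC qC rC lC' qC' rC'.
have N20 : 0 <= N ^+ 2 by exact: exprn_ge0.
have N30 : 0 <= N ^+ 3 by exact: exprn_ge0.
have N2 : N ^+ 2 <= 1 by rewrite exprn_ile1.
have N43 : N ^+ 4 <= N ^+ 3 by rewrite (exprSr _ 3) ler_piMr.
have -> : (f + l + q + r) * (g + l' + q' + r') - f * g - (l * g + f * l')
    - (q * g + f * q' + l * l') =
    r * (g + l' + q' + r') + (f + l + q) * r' + (l * q' + q * l' + q * q') by ring.
apply: (le_trans (ler_normD _ _)).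
have -> : (C + (1 + 2 * C) * C' + 3 * C * C') * N ^+ 3 =
  C * N ^+ 3 + (1 + 2 * C) * (C' * N ^+ 3) + 3 * C * C' * N ^+ 3 by ring.
apply: lerD; last first.
  apply: (@le_trans _ _ (C * C' * N ^+ 3 + C * C' * N ^+ 3 + C * C' * N ^+ 3)); last by lra.
  apply: (le_trans (ler_normD _ _)); apply: lerD.
    apply: (le_trans (ler_normD _ _)); rewrite !normrM; apply: lerD.
      apply: (le_trans (ler_pM _ _ lC qC')) => //.
      by rewrite le_eqVlt; apply/orP; left; apply/eqP; ring.
    apply: (le_trans (ler_pM _ _ qC lC')) => //.
    by rewrite le_eqVlt; apply/orP; left; apply/eqP; ring.
  rewrite normrM; apply: (le_trans (ler_pM _ _ qC qC')) => //.
  have -> : C * N ^+ 2 * (C' * N ^+ 2) = C * C' * N ^+ 4 by ring.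
  by rewrite ler_wpM2l// mulr_ge0.
apply: (le_trans (ler_normD _ _)); apply: lerD.
  by rewrite normrM -[leRHS]mulr1 ler_pM.
rewrite normrM; apply: ler_pM => //.
apply: (le_trans (ler_normD _ _)).
have : `|f + l| <= 1 + C.
  apply: (le_trans (ler_normD _ _)); apply: lerD => //.
  by apply: (le_trans lC); rewrite ler_piMr.
have : `|q| <= C by apply: (le_trans qC); rewrite ler_piMr.
lra.
Qed.

Lemma linpartD (R : realType) (m n : nat) D D' (h : 'M[R]_(m, n)) :
  linpart (fun a => D a + D' a) h = linpart D h + linpart D' h.
Proof. by rewrite /linpart -big_split; apply: eq_bigr => a _; rewrite mulrDl. Qed.

Lemma linpartZ (R : realType) (m n : nat) D c (h : 'M[R]_(m, n)) :
  linpart (fun a => c * D a) h = c * linpart D h.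
Proof. by rewrite /linpart mulr_sumr; apply: eq_bigr => a _; rewrite mulrA. Qed.

Lemma quadpartD (R : realType) (m n : nat) D D' (h : 'M[R]_(m, n)) :
  quadpart (fun a b => D a b + D' a b) h = quadpart D h + quadpart D' h.
Proof.
rewrite /quadpart -big_split; apply: eq_bigr => a _; rewrite -big_split.
by apply: eq_bigr => b _; rewrite mulrDl.
Qed.

Lemma quadpartZ (R : realType) (m n : nat) D c (h : 'M[R]_(m, n)) :
  quadpart (fun a b => c * D a b) h = c * quadpart D h.
Proof.
rewrite /quadpart mulr_sumr; apply: eq_bigr => a _; rewrite mulr_sumr.
by apply: eq_bigr => b _; rewrite -mulrA.
Qed.

Lemma quadpart_rank1 (R : realType) (m n : nat) D D' (h : 'M[R]_(m, n)) :
  quadpart (fun a b => D a * D' b) h = linpart D h * linpart D' h.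
Proof.
rewrite /quadpart /linpart big_distrlr /=; apply: eq_bigr => a _.
by apply: eq_bigr => b _; rewrite mulrACA.
Qed.

(** The cross term [D1 s a * D1' s b] is not symmetrized: a quadratic form does not see the
    difference, and each entry keeps the sign that its factors give it. *)
Lemma taylor2M (R : realType) (m n : nat) (f g : 'M[R]_(m, n) -> R) D1 D2 C D1' D2' C' :
  (forall s, 0 <= f s <= 1) -> (forall s, 0 <= g s <= 1) ->
  taylor2 f D1 D2 C -> taylor2 g D1' D2' C' ->
  taylor2 (fun s => f s * g s) (fun s a => g s * D1 s a + f s * D1' s a)
    (fun s a b => g s * D2 s a b + f s * D2' s a b + D1 s a * D1' s b)
    (C + (1 + 2 * C) * C' + 3 * C * C').
Proof.
move=> f01 g01 [C0 D1C D2C fT] [C'0 D1C' D2C' gT].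
have CC' : 0 <= C * C' by rewrite mulr_ge0.
have f1 s : `|f s| <= 1 by have := f01 s; rewrite ler_norml; lra.
have g1 s : `|g s| <= 1 by have := g01 s; rewrite ler_norml; lra.
have sc (x y z : R) : `|x| <= 1 -> `|y| <= z -> `|x * y| <= z.
  by move=> x1 yz; rewrite normrM -[leRHS]mul1r ler_pM.
split.
- by lra.
- move=> s a; apply: (le_trans (ler_normD _ _)).
  by have := sc _ _ _ (g1 s) (D1C s a); have := sc _ _ _ (f1 s) (D1C' s a); lra.
- move=> s a b; apply: (le_trans (ler_normD _ _)).
  apply: (@le_trans _ _ (C + C' + C * C')); last by lra.
  apply: lerD; last by rewrite normrM ler_pM.
  apply: (le_trans (ler_normD _ _)).
  by have := sc _ _ _ (g1 s) (D2C s a b); have := sc _ _ _ (f1 s) (D2C' s a b); lra.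
- move=> s h h1.
  rewrite linpartD !linpartZ !quadpartD !quadpartZ quadpart_rank1.
  have l1 := linpart_le h (D1C s); have q1 := quadpart_le h (D2C s); have r1 := fT s h h1.
  have l1' := linpart_le h (D1C' s); have q1' := quadpart_le h (D2C' s); have r1' := gT s h h1.
  set l := linpart (D1 s) h in l1 r1 *; set q := quadpart (D2 s) h in q1 r1 *.
  set l' := linpart (D1' s) h in l1' r1' *; set q' := quadpart (D2' s) h in q1' r1' *.
  have N01 : 0 <= norm1 h <= 1 by rewrite norm1_ge0.
  have := @product_remainder _ (norm1 h) C C' (f s) l q _ (g s) l' q' _ N01 C0 C'0 (f1 s) _
    l1 q1 r1 l1' q1' r1'.
  have -> : f s + l + q + (f (s + h) - f s - l - q) = f (s + h) by ring.
  have -> : g s + l' + q' + (g (s + h) - g s - l' - q') = g (s + h) by ring.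
  move=> /(_ (g1 _)).
  by rewrite !(mulrC (g s)).
Qed.

Lemma taylor2_onem (R : realType) (m n : nat) (f : 'M[R]_(m, n) -> R) D1 D2 C :
  taylor2 f D1 D2 C ->
  taylor2 (fun s => 1 - f s) (fun s a => - D1 s a) (fun s a b => - D2 s a b) C.
Proof.
move=> [C0 D1C D2C fT]; split => //.
- by move=> s a; rewrite normrN.
- by move=> s a b; rewrite normrN.
- move=> s h h1; have := fT s h h1.
  have -> : linpart (fun a => - D1 s a) h = - linpart (D1 s) h.
    by rewrite -mulN1r -linpartZ; apply: eq_bigr => a _; rewrite mulN1r.
  have -> : quadpart (fun a b => - D2 s a b) h = - quadpart (D2 s) h.
    rewrite -mulN1r -quadpartZ; apply: eq_bigr => a _; apply: eq_bigr => b _.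
    by rewrite mulN1r.
  by rewrite -normrN; congr (`|_| <= _); ring.
Qed.

Lemma taylor2_cst1 (R : realType) (m n : nat) :
  taylor2 (fun _ : 'M[R]_(m, n) => 1) (fun _ _ => 0) (fun _ _ _ => 0) 0.
Proof.
split => //.
- by move=> s a; rewrite normr0.
- by move=> s a b; rewrite normr0.
- move=> s h _; rewrite /linpart /quadpart big1 ?subr0; last by move=> a _; rewrite mul0r.
  rewrite big1 ?subr0 ?subrr ?normr0 ?mul0r//.
  by move=> a _; rewrite big1// => b _; rewrite mul0r.
Qed.

Lemma norm1Z (R : realType) (m n : nat) (t : R) (e : 'M[R]_(m, n)) :
  norm1 (t *: e) = `|t| * norm1 e.
Proof.
by rewrite /norm1 mulr_sumr; apply: eq_bigr => a _; rewrite /entry mxE normrM.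
Qed.

Lemma linpartN (R : realType) (m n : nat) D (h : 'M[R]_(m, n)) :
  linpart D (- h) = - linpart D h.
Proof.
by rewrite /linpart -sumrN; apply: eq_bigr => a _; rewrite /entry mxE mulrN.
Qed.

Lemma quadpart_scale (R : realType) (m n : nat) D (h : 'M[R]_(m, n)) (t : R) :
  quadpart D (t *: h) = quadpart D h * t ^+ 2.
Proof.
rewrite /quadpart mulr_suml; apply: eq_bigr => a _; rewrite mulr_suml.
by apply: eq_bigr => b _; rewrite /entry !mxE; ring.
Qed.

(** For increments of norm at most 1 the expansions at [h] and [- h] are averaged. For larger ones
    no expansion is available, but [f] takes values in [[0, 1]] and [norm1 h ^+ 3] exceeds both 1
    and [norm1 h ^+ 2]; this is the source of [1 + C]. *)
Lemma taylor2_sym_taylor (R : realType) (m n : nat) (f : 'M[R]_(m, n) -> R) D1 D2 C e :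
  (forall s, 0 <= f s <= 1) -> taylor2 f D1 D2 C ->
  sym_taylor f e ((1 + C) * norm1 e ^+ 3).
Proof.
move=> f01 [C0 D1C D2C fT] s; exists (quadpart (D2 s) e) => t.
rewrite -mulrA -exprMn [norm1 e * _]mulrC -norm1Z.
have qt := quadpart_scale (D2 s) e t.
rewrite -qt; have qN : quadpart (D2 s) (- (t *: e)) = quadpart (D2 s) (t *: e).
  by rewrite -scaleN1r quadpart_scale sqrrN expr1n mulr1.
have N0 := norm1_ge0 (t *: e).
have NN : norm1 (- (t *: e)) = norm1 (t *: e).
  by rewrite -scaleN1r norm1Z normrN1 mul1r.
set h := t *: e in qN N0 NN *.
have [h1|h1] := leP (norm1 h) 1.
  have T1 := fT s h h1; have := fT s (- h); rewrite NN => /(_ h1).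
  rewrite linpartN qN => T2; rewrite /savg.
  have N3 : 0 <= norm1 h ^+ 3 by exact: exprn_ge0.
  by move: T1 T2; rewrite !ler_norml => /andP[? ?] /andP[? ?]; apply/andP; split; lra.
have N2 : norm1 h ^+ 2 <= norm1 h ^+ 3 by rewrite [leRHS]exprS ler_peMl ?exprn_ge0// ltW.
have N21 : 1 <= norm1 h ^+ 2 by rewrite exprn_ege1// ltW.
have := quadpart_le h (D2C s).
have := savg_01 h f01 s; have := f01 s.
have CN : C * norm1 h ^+ 2 <= C * norm1 h ^+ 3 by rewrite ler_wpM2l.
rewrite !ler_norml => /andP[? ?] /andP[? ?] /andP[? ?].
by apply/andP; split; lra.
Qed.

Lemma taylor2_line_continuous (R : realType) (m n : nat) (f : 'M[R]_(m, n) -> R) D1 D2 C :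
  taylor2 f D1 D2 C -> line_continuous f.
Proof.
move=> [C0 D1C D2C fT] s e z; apply/cvgrPdist_le => /= eps eps0.
pose K := 3 * C * norm1 e.
have K0 : 0 <= K by rewrite !mulr_ge0 ?norm1_ge0.
have Ke : 0 < K + norm1 e + 1 by rewrite ltr_wpDl// addr_ge0// norm1_ge0.
near=> y.
have yz : `|z - y| <= Num.min 1 eps / (K + norm1 e + 1).
  near: y; apply/nbhs_ballP; exists (Num.min 1 eps / (K + norm1 e + 1)) => /=.
    by rewrite divr_gt0// lt_min ltr01.
  by move=> y /= /ltW.
have h1' : `|y - z| * norm1 e <= 1.
  rewrite distrC; move: yz; rewrite ler_pdivlMr// => yz.
  apply: (@le_trans _ _ (`|z - y| * (K + norm1 e + 1))).
    by rewrite ler_wpM2l//; lra.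
  by apply: (le_trans yz); rewrite ge_min lexx.
have h1 : norm1 ((y - z) *: e) <= 1 by rewrite norm1Z.
have := fT (s + z *: e) _ h1.
have -> : s + z *: e + (y - z) *: e = s + y *: e.
  by rewrite -addrA -scalerDl; congr (_ + _ *: _); ring.
have := linpart_le ((y - z) *: e) (D1C (s + z *: e)).
have := quadpart_le ((y - z) *: e) (D2C (s + z *: e)).
have N0 := norm1_ge0 ((y - z) *: e).
set N := norm1 _ in h1 N0 *.
have N2 : N ^+ 2 <= N by rewrite expr2 ler_piMl.
have N3 : N ^+ 3 <= N by rewrite exprS ler_piMr// exprn_ile1.
have CN2 : C * N ^+ 2 <= C * N by rewrite ler_wpM2l.
have CN3 : C * N ^+ 3 <= C * N by rewrite ler_wpM2l.
have Neps : 3 * (C * N) <= eps.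
  rewrite /N norm1Z distrC; move: yz; rewrite ler_pdivlMr// => yz.
  rewrite (_ : 3 * (C * (`|z - y| * norm1 e)) = `|z - y| * K); last by rewrite /K; ring.
  apply: (@le_trans _ _ (`|z - y| * (K + norm1 e + 1))).
    by rewrite ler_wpM2l//; have := norm1_ge0 e; lra.
  by apply: (le_trans yz); rewrite ge_min lexx orbT.
rewrite !ler_norml => /andP[? ?] /andP[? ?] /andP[? ?].
by apply/andP; split; lra.
Unshelve. all: by end_near. Qed.

(** The constant adds the bounds for the gradient, for the half Hessian and for the remainder. *)
Lemma taylor2_sstep (R : realType) (m n : nat) (i : 'I_m) (j : 'I_n) (L c : R) :
  0 <= L ->
  taylor2 (fun s : 'M[R]_(m, n) => sstep (L * s i j + c))
    (fun s a => L * sstep1 (L * s i j + c) * (a == (i, j))%:R)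
    (fun s a b => L ^+ 2 * sstep2 (L * s i j + c) * (a == (i, j))%:R * (b == (i, j))%:R)
    (L + L ^+ 2 + 2 * L ^+ 3).
Proof.
move=> L0; have L2 : 0 <= L ^+ 2 by exact: exprn_ge0.
have L3 : 0 <= L ^+ 3 by exact: exprn_ge0.
have b1 (p : bool) (x y : R) : `|x| <= y -> `|x * p%:R| <= y.
  by move=> xy; case: p; rewrite ?mulr1// mulr0 normr0 (le_trans _ xy).
split.
- by lra.
- move=> s a; apply: b1; rewrite normrM (ger0_norm L0).
  have [_ /andP[? ?] _] := sstep_bounds (L * s i j + c).
  apply: (@le_trans _ _ (L * 1)); last by lra.
  by rewrite ler_wpM2l// ger0_norm.
- move=> s a b; apply/b1/b1; rewrite normrM (ger0_norm L2).
  have [_ _ ?] := sstep_bounds (L * s i j + c).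
  apply: (@le_trans _ _ (L ^+ 2 * 1)); last by lra.
  by rewrite ler_wpM2l.
- move=> s h h1.
  have -> : linpart (fun a => L * sstep1 (L * s i j + c) * (a == (i, j))%:R) h =
      sstep1 (L * s i j + c) * (L * h i j).
    rewrite /linpart (bigD1 (i, j))//= big1 ?addr0; last first.
      by move=> a /negbTE ->; rewrite mulr0 mul0r.
    by rewrite eqxx /entry /=; ring.
  have -> : quadpart (fun a b => L ^+ 2 * sstep2 (L * s i j + c) * (a == (i, j))%:R * (b == (i, j))%:R) h =
      sstep2 (L * s i j + c) * (L * h i j) ^+ 2.
    rewrite /quadpart (bigD1 (i, j))//= [X in _ + X]big1 ?addr0; last first.
      by move=> a /negbTE ->; rewrite big1// => b _; rewrite mulr0 !mul0r.
    rewrite (bigD1 (i, j))//= big1 ?addr0; last first.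
      by move=> b /negbTE ->; rewrite mulr0 mul0r.
    by rewrite eqxx /entry /=; ring.
  rewrite mxE (_ : L * (s i j + h i j) + c = L * s i j + c + L * h i j); last by ring.
  apply: (le_trans (sstep_taylor _ _)).
  have hN : `|h i j| <= norm1 h.
    rewrite /norm1 (bigD1 (i, j))//= /entry /= lerDl.
    by apply: sumr_ge0.
  rewrite normrM (ger0_norm L0) exprMn.
  apply: (@le_trans _ _ (2 * (L ^+ 3 * norm1 h ^+ 3))).
    rewrite ler_wpM2l// ler_wpM2l// lerXn2r// nnegrE; exact: norm1_ge0.
  have := norm1_ge0 h => N0; have N3 : 0 <= norm1 h ^+ 3 by exact: exprn_ge0.
  rewrite mulrA ler_wpM2r//; lra.
Qed.

(** * Sign conditions on the derivatives of the test function *)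

Definition row_dec (R : realType) (m n : nat) (i0 : 'I_m) (f : 'M[R]_(m, n) -> R) :=
  [/\ forall s, 0 <= f s <= 1, mx_measurable f & exists D1 D2 C,
    [/\ taylor2 f D1 D2 C, forall s a, D1 s a <= 0,
      forall s a, a.1 != i0 -> D1 s a = 0 &
      forall s a b, a.1 != b.1 -> D2 s a b = 0]].

(** Nonnegativity of the gradient is carried along because the product rule creates the mixed terms
    [D1 a * D1' b]. Second derivatives within a row are left free: there the complement of a product
    of decreasing functions has mixed derivatives of the wrong sign, and Gordon's condition makes
    the covariances equal instead. *)
Definition cross_inc (R : realType) (m n : nat) (f : 'M[R]_(m, n) -> R) :=
  [/\ forall s, 0 <= f s <= 1, mx_measurable f & exists D1 D2 C,
    [/\ taylor2 f D1 D2 C, forall s a, 0 <= D1 s a &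
      forall s a b, a.1 != b.1 -> 0 <= D2 s a b]].

Lemma mul01 (R : realType) (T : Type) (f g : T -> R) :
  (forall s, 0 <= f s <= 1) -> (forall s, 0 <= g s <= 1) ->
  forall s, 0 <= f s * g s <= 1.
Proof.
move=> f01 g01 s; have /andP[f0 f1] := f01 s; have /andP[g0 g1] := g01 s.
by rewrite mulr_ge0//= mulr_ile1.
Qed.

Lemma mx_measurableM (R : realType) (m n : nat) (f g : 'M[R]_(m, n) -> R) :
  mx_measurable f -> mx_measurable g -> mx_measurable (fun s => f s * g s).
Proof. by move=> mf mg d T X mX; apply: measurable_funM; [exact: mf|exact: mg]. Qed.

(** Both gradients live on row [i0], so a mixed term for entries in distinct rows has a vanishing
    factor. *)
Lemma row_decM (R : realType) (m n : nat) (i0 : 'I_m) (f g : 'M[R]_(m, n) -> R) :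
  row_dec i0 f -> row_dec i0 g -> row_dec i0 (fun s => f s * g s).
Proof.
move=> [f01 mf [D1 [D2 [C [fT D1n D10 D20]]]]] [g01 mg [D1' [D2' [C' [gT D1n' D10' D20']]]]].
split; [exact: mul01|exact: mx_measurableM|].
do 3 eexists; split; first exact: (taylor2M f01 g01 fT gT).
- move=> s a /=; have /andP[f0 _] := f01 s; have /andP[g0 _] := g01 s.
  by have := mulr_ge0_le0 g0 (D1n s a); have := mulr_ge0_le0 f0 (D1n' s a); lra.
- by move=> s a ai /=; rewrite D10// D10'// !mulr0 addr0.
- move=> s a b ab /=; rewrite D20// D20'// !mulr0 !add0r.
  have [ai|/D10 ->] := eqVneq a.1 i0; last by rewrite mul0r.
  by rewrite D10' ?mulr0// -ai eq_sym.
Qed.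

Lemma cross_incM (R : realType) (m n : nat) (f g : 'M[R]_(m, n) -> R) :
  cross_inc f -> cross_inc g -> cross_inc (fun s => f s * g s).
Proof.
move=> [f01 mf [D1 [D2 [C [fT D1p D2p]]]]] [g01 mg [D1' [D2' [C' [gT D1p' D2p']]]]].
split; [exact: mul01|exact: mx_measurableM|].
do 3 eexists; split; first exact: (taylor2M f01 g01 fT gT).
- move=> s a /=; have /andP[f0 _] := f01 s; have /andP[g0 _] := g01 s.
  by rewrite addr_ge0// mulr_ge0.
- move=> s a b ab /=; have /andP[f0 _] := f01 s; have /andP[g0 _] := g01 s.
  by rewrite !addr_ge0// mulr_ge0// (D2p, D2p').
Qed.

Lemma row_dec_onem (R : realType) (m n : nat) (i0 : 'I_m) (f : 'M[R]_(m, n) -> R) :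
  row_dec i0 f -> cross_inc (fun s => 1 - f s).
Proof.
move=> [f01 mf [D1 [D2 [C [fT D1n D10 D20]]]]]; split.
- by move=> s; have := f01 s; lra.
- by move=> d T X mX; apply: measurable_funB => //; exact: mf.
- do 3 eexists; split; first exact: (taylor2_onem fT).
  + by move=> s a; rewrite oppr_ge0.
  + by move=> s a b ab /=; rewrite D20// oppr0.
Qed.

Lemma row_dec_sstep (R : realType) (m n : nat) (i : 'I_m) (j : 'I_n) (L c : R) :
  0 <= L -> row_dec i (fun s : 'M[R]_(m, n) => 1 - sstep (L * s i j + c)).
Proof.
move=> L0; split.
- by move=> s; have [] := sstep_bounds (L * s i j + c); lra.
- move=> d T X mX; apply: measurable_funB => //.
  apply: (measurableT_comp (@measurable_sstep R)).
  by apply: measurable_funD => //; exact: measurable_funM.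
- do 3 eexists; split; first exact: (taylor2_onem (taylor2_sstep i j c L0)).
  + move=> s a /=; rewrite oppr_le0; have [_ /andP[? _] _] := sstep_bounds (L * s i j + c).
    by rewrite mulr_ge0 ?ler0n// mulr_ge0.
  + move=> s [a1 a2] /= ai; case: eqP => [[]|_]; last by rewrite mulr0 oppr0.
    by move=> a1i; rewrite a1i eqxx in ai.
  + move=> s a b ab /=; case: eqP => [ai|_]; last by rewrite mulr0 mul0r oppr0.
    case: eqP => [bi|_]; last by rewrite mulr0 oppr0.
    by rewrite ai bi eqxx in ab.
Qed.

Lemma row_dec_prod (R : realType) (m n : nat) (i : 'I_m) (L : R) (c : 'M[R]_(m, n)) (js : seq 'I_n) :
  0 <= L -> row_dec i (fun s : 'M[R]_(m, n) => \prod_(j <- js) (1 - sstep (L * s i j + c i j))).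
Proof.
move=> L0; elim: js => [|j js IH].
  rewrite (_ : (fun s => _) = fun=> 1); last by apply/funext => s; rewrite big_nil.
  split; [by move=> s; rewrite ler01 lexx|by move=> d T X _; exact: measurable_cst|].
  by do 3 eexists; split; [exact: taylor2_cst1|..].
rewrite (_ : (fun s => _) = fun s : 'M[R]_(m, n) => (1 - sstep (L * s i j + c i j)) *
    \prod_(j <- js) (1 - sstep (L * s i j + c i j))); last first.
  by apply/funext => s; rewrite big_cons.
by apply: row_decM => //; exact: row_dec_sstep.
Qed.

(* A smooth lower approximation of the indicator of [forall i, exists j, 0 < L * s i j + c i j]. *)
Definition minmax_test (R : realType) (m n : nat) (L : R) (c s : 'M[R]_(m, n)) : R :=
  \prod_i (1 - \prod_j (1 - sstep (L * s i j + c i j))).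

Lemma cross_inc_minmax_test (R : realType) (m n : nat) (L : R) (c : 'M[R]_(m, n)) :
  0 <= L -> cross_inc (minmax_test L c).
Proof.
move=> L0; rewrite /minmax_test.
elim: (index_enum 'I_m) => [|i r IH].
  rewrite (_ : (fun s => _) = fun=> 1); last by apply/funext => s; rewrite big_nil.
  split; [by move=> s; rewrite ler01 lexx|by move=> d T X _; exact: measurable_cst|].
  by do 3 eexists; split; [exact: taylor2_cst1|..].
rewrite (_ : (fun s => _) = fun s : 'M[R]_(m, n) => (1 - \prod_j (1 - sstep (L * s i j + c i j))) *
    \prod_(i <- r) (1 - \prod_j (1 - sstep (L * s i j + c i j)))); last first.
  by apply/funext => s; rewrite big_cons.
apply: cross_incM => //; apply: (@row_dec_onem _ _ _ i); exact: row_dec_prod.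
Qed.

Lemma sstep_homo (R : realType) (x y : R) : x <= y -> sstep x <= sstep y.
Proof.
move=> xy.
(* the contribution of each unit interval is a nondecreasing cubic of the clamped variable *)
pose cl (u : R) := Num.min (ppart u) 1.
pose A (u : R) := u ^+ 3 / 6.
pose B (u : R) := (3 * u + 3 * u ^+ 2 - 2 * u ^+ 3) / 6.
pose C (u : R) := 1 / 6 - (1 - u) ^+ 3 / 6.
have cl0 u : u <= 0 -> cl u = 0 by move=> u0; rewrite /cl ppart_le// min_l.
have cl1 u : 1 <= u -> cl u = 1 by move=> u1; rewrite /cl ppart_ge ?min_r//; lra.
have clid u : 0 <= u <= 1 -> cl u = u.
  by move=> /andP[u0 u1]; rewrite /cl ppart_ge// min_l.
have cl01 u : 0 <= cl u <= 1.
  by rewrite /cl /ppart ge_min lexx orbT le_min ler01 andbT le_max lexx orbT.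
have clle u v : u <= v -> cl u <= cl v.
  move=> uv; have := cl01 v; have := cl01 u.
  have [u0|/ltW u0] := leP u 0; first by rewrite (cl0 u)//; lra.
  have [v1|/ltW v1] := leP 1 v; first by rewrite (cl1 v)//; lra.
  by rewrite !clid//; lra.
have poly (u v : R) : 0 <= u -> u <= v -> v <= 1 -> [/\ A u <= A v, B u <= B v & C u <= C v].
  move=> u0 uv v1.
  have c1 (a b : R) : 0 <= a -> a <= b -> a ^+ 3 <= b ^+ 3.
    by move=> a0 ab; rewrite lerXn2r// nnegrE (le_trans a0).
  split.
  - by have := c1 _ _ u0 uv; rewrite /A; lra.
  - have : 0 <= (v - u) * (3 + 3 * (u + v) - 2 * (u ^+ 2 + u * v + v ^+ 2)).
      apply: mulr_ge0; first lra.
      have : u ^+ 2 <= u by rewrite expr2 ler_piMl//; lra.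
      have : v ^+ 2 <= v by rewrite expr2 ler_piMl//; lra.
      have : u * v <= v by rewrite ler_piMl//; lra.
      lra.
    by rewrite /B; lra.
  - have h1 : 0 <= 1 - v by lra.
    have h2 : 1 - v <= 1 - u by lra.
    by have := c1 _ _ h1 h2; rewrite /C; lra.
have E z : sstep z = A (cl z) + B (cl (z - 1)) + C (cl (z - 2)).
  have [z0|/ltW z0] := leP z 0.
    by rewrite sstep_le0// !cl0; [rewrite /A /B /C; field|lra..].
  have [z1|/ltW z1] := leP z 1.
    rewrite clid ?z0// !(@cl0 (z - _)); [|lra..].
    by rewrite /sstep /A /B /C (ppart_ge z0) !(@ppart_le _ (z - _)); [field|lra..].
  have [z2|/ltW z2] := leP z 2.
    rewrite (@cl1 z)// (@clid (z - 1)); last lra.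
    rewrite (@cl0 (z - 2)); last lra.
    rewrite /sstep /A /B /C (ppart_ge z0) (@ppart_ge _ (z - 1)); last lra.
    by rewrite !(@ppart_le _ (z - _)); [field|lra..].
  have [z3|/ltW z3] := leP z 3.
    rewrite (@cl1 z); last lra.
    rewrite (@cl1 (z - 1)); last lra.
    rewrite (@clid (z - 2)); last lra.
    rewrite /sstep /A /B /C (ppart_ge z0) (@ppart_ge _ (z - 1)); last lra.
    rewrite (@ppart_ge _ (z - 2)); last lra.
    by rewrite !(@ppart_le _ (z - _)); [field|lra..].
  by rewrite sstep_ge3// !cl1; [rewrite /A /B /C; field|lra..].
have P0 (a : R) : [/\ A (cl (x - a)) <= A (cl (y - a)), B (cl (x - a)) <= B (cl (y - a)) &
    C (cl (x - a)) <= C (cl (y - a))].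
  have /andP[c0 _] := cl01 (x - a); have /andP[_ c1] := cl01 (y - a).
  by apply: poly => //; apply: clle; lra.
rewrite !E; have [a1 _ _] := P0 0; have [_ a2 _] := P0 1; have [_ _ a3] := P0 2.
by move: a1; rewrite !subr0 => a1; lra.
Qed.

Lemma minmax_test_le (R : realType) (m n : nat) (L : R) (c s s' : 'M[R]_(m, n)) :
  (forall i j, L * s i j <= L * s' i j) -> minmax_test L c s <= minmax_test L c s'.
Proof.
move=> ss'.
have b (s0 : 'M[R]_(m, n)) i j : 0 <= 1 - sstep (L * s0 i j + c i j) <= 1.
  by have [] := sstep_bounds (L * s0 i j + c i j); lra.
have p01 (s0 : 'M[R]_(m, n)) i : 0 <= \prod_j (1 - sstep (L * s0 i j + c i j)) <= 1.
  apply/andP; split; first by apply: prodr_ge0 => j _; have /andP[] := b s0 i j.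
  by apply: prodr_ile1 => j _; exact: b.
apply: ler_prod => i _; apply/andP; split.
  by have := p01 s i; lra.
rewrite lerD2l lerN2; apply: ler_prod => j _; have /andP[-> _] := b s' i j.
by rewrite lerD2l lerN2 sstep_homo// lerD2r.
Qed.

Lemma minmax_test_eq0 (R : realType) (m n : nat) (L : R) (c s : 'M[R]_(m, n)) (i : 'I_m) :
  (forall j, L * s i j + c i j <= 0) -> minmax_test L c s = 0.
Proof.
move=> h; rewrite /minmax_test (bigD1 i)//= big1 ?subrr ?mul0r// => j _.
by rewrite sstep_le0// subr0.
Qed.

Lemma minmax_test_eq1 (R : realType) (m n : nat) (L : R) (c s : 'M[R]_(m, n)) :
  (forall i, exists j, 3 <= L * s i j + c i j) -> minmax_test L c s = 1.
Proof.
move=> h; rewrite /minmax_test big1// => i _; have [j sj] := h i.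
by rewrite (bigD1 j)//= sstep_ge3// subrr mul0r subr0.
Qed.

(** * Gordon's comparison for finite families *)

(** Sign averages commute; this allows the signs to be regrouped by variable or by packet. *)
Lemma ravg_perm (R : realType) (E : lmodType R) (es1 es2 : seq E) (f : E -> R) :
  perm_eq es1 es2 -> ravg es1 f = ravg es2 f.
Proof.
move=> /permP; elim: es1 es2 f => [|e es1 IH] es2 f.
  by case: es2 => // e es2 /(_ predT).
move=> pe.
have /splitPr es2E : e \in es2.
  by rewrite -has_pred1 has_count -pe /= eqxx.
case: es2E pe => p1 p2 pe.
have swap (ps : seq E) (h : E -> R) : ravg ps (savg e h) = savg e (ravg ps h).
  by elim: ps h => //= p ps IH' h; rewrite -IH' savgC.
rewrite ravg_cat /= -swap -ravg_cat; apply: IH => a.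
by have := pe a; rewrite /= !count_cat /= addnCA => /addnI.
Qed.

Lemma ravgD (R : realType) (E : lmodType R) (es : seq E) (f g : E -> R) (s : E) :
  ravg es (fun x => f x + g x) s = ravg es f s + ravg es g s.
Proof.
elim: es f g => //= e es IH f g; rewrite -IH; congr ravg.
by apply/funext => x; rewrite /savg; field.
Qed.

Lemma ravgZ (R : realType) (E : lmodType R) (es : seq E) (c : R) (f : E -> R) (s : E) :
  ravg es (fun x => c * f x) s = c * ravg es f s.
Proof.
elim: es f => //= e es IH f; rewrite -IH; congr ravg.
by apply/funext => x; rewrite /savg; field.
Qed.

Lemma ravg_cst (R : realType) (E : lmodType R) (es : seq E) (c : R) (s : E) :
  ravg es (fun=> c) s = c.
Proof.
elim: es => //= e es IH; rewrite (_ : savg e _ = fun=> c)//.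
by apply/funext => x; rewrite /savg; field.
Qed.

Lemma ravg_le (R : realType) (E : lmodType R) (es : seq E) (f g : E -> R) :
  (forall x, f x <= g x) -> forall s, ravg es f s <= ravg es g s.
Proof.
elim: es f g => //= e es IH f g fg s; apply: IH => x; rewrite /savg.
by have := fg (x + e); have := fg (x - e); lra.
Qed.

Lemma ravg_onem (R : realType) (E : lmodType R) (es : seq E) (f : E -> R) (s : E) :
  ravg es (fun x => 1 - f x) s = 1 - ravg es f s.
Proof.
rewrite (_ : (fun x => _) = (fun x => 1 + -1 * f x)); last first.
  by apply/funext => x; rewrite mulN1r.
by rewrite ravgD ravg_cst ravgZ mulN1r.
Qed.

Lemma ravg_reflect (R : realType) (E : lmodType R) (es : seq E) (f : E -> R) (s : E) :
  ravg es (fun x => f (s - x)) = (fun x => ravg es f (s - x)).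
Proof.
elim: es f => //= e es IH f; rewrite -IH; congr ravg.
apply/funext => x; rewrite /savg.
have -> : s - (x + e) = s - x - e by rewrite opprD addrA.
have -> : s - (x - e) = s - x + e by rewrite opprB addrA addrAC.
by rewrite [f _ + _]addrC.
Qed.

(** The signs never leave the line through [s] directed by [v], so a lower bound on this line
    suffices. *)
Lemma ravg_line_ge (R : realType) (E : lmodType R) (v s : E) (N : nat) (f : E -> R) (a : R) :
  (forall t : R, a <= f (s + t *: v)) ->
  forall t : R, a <= ravg (nseq N v) f (s + t *: v).
Proof.
elim: N f => //= N IH f fa t; apply: IH => {}t; rewrite /savg.
have := fa (t + 1); have := fa (t - 1).
by rewrite scalerBl scalerDl !scale1r !addrA; lra.
Qed.

(* By symmetry the sum of the signs is nonpositive with probability at least one half. *)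
Lemma ravg_half (R : realType) (E : lmodType R) (v s : E) (N : nat) (f : E -> R) :
  (forall x, 0 <= f x) -> (forall t : R, t <= 0 -> f s <= f (s + t *: v)) ->
  f s <= 2 * ravg (nseq N v) f s.
Proof.
move=> f0 fs.
(* Pairing [x] with its reflection [s + s - x]: one of the two has a nonpositive coordinate along
   [v], and the value at the other is nonnegative. *)
have -> : 2 * ravg (nseq N v) f s = ravg (nseq N v) (fun x => f x + f (s + s - x)) s.
  by rewrite ravgD ravg_reflect addrK; ring.
rewrite -[X in _ <= ravg _ _ X]addr0 -(scale0r v).
apply: ravg_line_ge => t; have [t0|/ltW t0] := leP t 0.
  by rewrite -[leLHS]addr0 lerD// fs.
rewrite -[leLHS]add0r lerD// opprD addrACA subrr add0r -scaleNr.
by apply: fs; rewrite oppr_le0.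
Qed.

Definition mx_antitone (R : realType) (m n : nat) (f : 'M[R]_(m, n) -> R) :=
  forall s s' : 'M[R]_(m, n), (forall i j, s i j <= s' i j) -> f s' <= f s.

Lemma savg_antitone (R : realType) (m n : nat) (f : 'M[R]_(m, n) -> R) e :
  mx_antitone f -> mx_antitone (savg e f).
Proof.
move=> af s s' ss'; rewrite /savg.
have : f (s' + e) <= f (s + e) by apply: af => i j; rewrite !mxE lerD2r.
have : f (s' - e) <= f (s - e) by apply: af => i j; rewrite !mxE lerD2r.
lra.
Qed.

Lemma ravg_antitone (R : realType) (m n : nat) (es : seq 'M[R]_(m, n)) f :
  mx_antitone f -> mx_antitone (ravg es f).
Proof. by elim: es f => //= e es IH f af; apply: IH; exact: savg_antitone. Qed.

Lemma ravg_ge0 (R : realType) (E : lmodType R) (es : seq E) (f : E -> R) :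
  (forall x, 0 <= f x) -> forall s, 0 <= ravg es f s.
Proof. by move=> f0 s; rewrite -(ravg_cst es 0 s); exact: ravg_le. Qed.

(** A nonpositive multiple of an entrywise nonnegative [c] lowers the argument and raises an
    antitone [f], so [ravg_half] applies to each direction in turn; averaging over the earlier ones
    preserves nonnegativity and antitonicity. Each factor 2 stands for one event [gamma_l <= 0]. *)
Lemma ravg_pow_half (R : realType) (m n : nat) (cs : seq 'M[R]_(m, n)) (t : R) (N : nat)
    (f : 'M[R]_(m, n) -> R) (s : 'M[R]_(m, n)) :
  0 <= t -> (forall c, c \in cs -> forall i j, 0 <= c i j) ->
  (forall x, 0 <= f x) -> mx_antitone f ->
  f s <= 2 ^+ size cs * ravg (flatten [seq nseq N (t *: c) | c <- cs]) f s.
Proof.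
move=> t0; elim: cs f => [|c cs IH] f c0 f0 af; first by rewrite expr0 mul1r.
rewrite [flatten _]/= ravg_cat exprS.
have h : f s <= 2 * ravg (nseq N (t *: c)) f s.
  apply: ravg_half => // u u0; apply: af => i j.
  rewrite !mxE gerDl mulr_le0_ge0// mulr_ge0//.
  by apply: c0; rewrite inE eqxx.
apply: (le_trans h); rewrite -mulrA ler_wpM2l//; apply: IH.
- by move=> c' c'cs; apply: c0; rewrite inE c'cs orbT.
- exact: ravg_ge0.
- exact: ravg_antitone.
Qed.

Lemma ravg_local (R : realType) (m n : nat) (es : seq 'M[R]_(m, n)) f g (s : 'M[R]_(m, n)) eps :
  (forall x, norm1 (x - s) <= \sum_(e <- es) norm1 e -> `|f x - g x| <= eps) ->
  `|ravg es f s - ravg es g s| <= eps.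
Proof.
elim: es f g => [|e es IH] f g fg /=.
  by apply: fg; rewrite big_nil subrr /norm1 big1// => a _; rewrite /entry mxE normr0.
apply: IH => x xs.
have tri (y z : 'M[R]_(m, n)) : norm1 (y + z) <= norm1 y + norm1 z.
  rewrite /norm1 -big_split; apply: ler_sum => a _.
  by rewrite /entry mxE ler_normD.
have h1 : `|f (x + e) - g (x + e)| <= eps.
  by apply: fg; rewrite big_cons addrAC addrC (le_trans (tri _ _))// lerD2l.
have h2 : `|f (x - e) - g (x - e)| <= eps.
  apply: fg; rewrite big_cons addrAC addrC (le_trans (tri _ _))// lerD//.
  by rewrite -scaleN1r norm1Z normrN1 mul1r.
rewrite /savg; move: h1 h2; rewrite !ler_norml => /andP[? ?] /andP[? ?].
by apply/andP; split; lra.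
Qed.

Lemma quadpart_parallelogram (R : realType) (m n : nat) D (h e : 'M[R]_(m, n)) :
  quadpart D (h + e) + quadpart D (h - e) = 2 * quadpart D h + 2 * quadpart D e.
Proof.
rewrite /quadpart !mulr_sumr -!big_split; apply: eq_bigr => a _ /=.
rewrite !mulr_sumr -!big_split; apply: eq_bigr => b _ /=.
by rewrite /entry !mxE; ring.
Qed.

Lemma linpart_add (R : realType) (m n : nat) D (h e : 'M[R]_(m, n)) :
  linpart D (h + e) = linpart D h + linpart D e.
Proof.
by rewrite /linpart -big_split; apply: eq_bigr => a _; rewrite /entry mxE mulrDr.
Qed.

(** By the parallelogram law each sign adds exactly its own quadratic term: linear terms cancel and
    no cross term between distinct signs survives. *)
Lemma ravg_quadratic (R : realType) (m n : nat) (es : seq 'M[R]_(m, n)) (c : R) D1 D2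
    (s x : 'M[R]_(m, n)) :
  ravg es (fun x => c + linpart D1 (x - s) + quadpart D2 (x - s)) x =
  c + linpart D1 (x - s) + quadpart D2 (x - s) + \sum_(e <- es) quadpart D2 e.
Proof.
elim: es c => [|e es IH] c /=; first by rewrite big_nil addr0.
have -> : savg e (fun x => c + linpart D1 (x - s) + quadpart D2 (x - s)) =
    (fun x => (c + quadpart D2 e) + linpart D1 (x - s) + quadpart D2 (x - s)).
  apply/funext => y; rewrite /savg.
  have := quadpart_parallelogram D2 (y - s) e.
  rewrite !(addrAC y _ (- s)); move: (y - s) => h.
  rewrite !linpart_add linpartN => qe.
  rewrite (_ : _ / 2 = c + linpart D1 h +
    (quadpart D2 (h + e) + quadpart D2 (h - e)) / 2); last by field.
  by rewrite qe; field.
by rewrite IH big_cons; ring.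
Qed.

Lemma ravg_taylor2 (R : realType) (m n : nat) (es : seq 'M[R]_(m, n)) f D1 D2 C (s : 'M[R]_(m, n)) :
  taylor2 f D1 D2 C -> \sum_(e <- es) norm1 e <= 1 ->
  `|ravg es f s - f s - \sum_(e <- es) quadpart (D2 s) e| <= C * (\sum_(e <- es) norm1 e) ^+ 3.
Proof.
move=> [C0 _ _ fT] es1.
have := @ravg_local _ _ _ es f
  (fun x => f s + linpart (D1 s) (x - s) + quadpart (D2 s) (x - s)) s
  (C * (\sum_(e <- es) norm1 e) ^+ 3).
rewrite ravg_quadratic subrr.
have -> : linpart (D1 s) 0 = 0.
  by rewrite /linpart big1// => a _; rewrite /entry mxE mulr0.
have -> : quadpart (D2 s) 0 = 0.
  by rewrite -(scale0r (0 : 'M[R]_(m, n))) quadpart_scale expr0n mulr0.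
rewrite !addr0 opprD addrA; apply => x xs.
have := fT s (x - s) (le_trans xs es1); rewrite (_ : s + (x - s) = x); last by rewrite addrC subrK.
rewrite !opprD !addrA => /le_trans; apply; rewrite ler_wpM2l//.
by rewrite lerXn2r// nnegrE ?norm1_ge0// sumr_ge0// => e _; exact: norm1_ge0.
Qed.

Lemma quadpart_gram (R : realType) (m n : nat) D (es : seq 'M[R]_(m, n)) (t : R) :
  \sum_(e <- [seq t *: e | e <- es]) quadpart D e =
  t ^+ 2 * \sum_a \sum_b D a b * (\sum_(e <- es) entry e a * entry e b).
Proof.
rewrite big_map; under eq_bigr do rewrite quadpart_scale mulrC.
rewrite -mulr_sumr; congr (_ * _); rewrite /quadpart exchange_big /=.
apply: eq_bigr => a _; rewrite exchange_big /=; apply: eq_bigr => b _.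
by rewrite mulr_sumr.
Qed.

(* Gordon's hypothesis on the covariances of the Gaussian matrices [sum_e g_e e], the row index
   being the variable of the outer minimum. *)
Definition gordon_dominated (R : realType) (m n : nat) (ys xs : seq 'M[R]_(m, n)) :=
  forall a b : 'I_m * 'I_n,
    \sum_(e <- ys) entry e a * entry e b <= \sum_(e <- xs) entry e a * entry e b /\
    (a.1 = b.1 -> \sum_(e <- ys) entry e a * entry e b = \sum_(e <- xs) entry e a * entry e b).

(** The second order terms of a packet are [t^2] times the pairing of [D2 s] with the covariance
    matrix. In a common row the covariances agree, whatever the sign of [D2]; across rows they are
    ordered and [D2] is nonnegative. The two third order remainders give the factor 2. *)
Lemma ravg_gordon (R : realType) (m n : nat) (f : 'M[R]_(m, n) -> R) D1 D2 C
    (xs ys : seq 'M[R]_(m, n)) (t rho : R) (s : 'M[R]_(m, n)) :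
  taylor2 f D1 D2 C -> (forall s a b, a.1 != b.1 -> 0 <= D2 s a b) ->
  gordon_dominated ys xs ->
  \sum_(e <- xs) norm1 e <= rho -> \sum_(e <- ys) norm1 e <= rho ->
  0 <= t -> t * rho <= 1 ->
  ravg [seq t *: e | e <- ys] f s <=
  ravg [seq t *: e | e <- xs] f s + 2 * C * (t * rho) ^+ 3.
Proof.
move=> fT D2p dom xr yr t0 tr.
have C0 : 0 <= C by case: fT.
have nE (es : seq 'M[R]_(m, n)) :
    \sum_(e <- [seq t *: e | e <- es]) norm1 e = t * \sum_(e <- es) norm1 e.
  by rewrite big_map mulr_sumr; apply: eq_bigr => e _; rewrite norm1Z ger0_norm.
have bnd (es : seq 'M[R]_(m, n)) : \sum_(e <- es) norm1 e <= rho ->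
    `|ravg [seq t *: e | e <- es] f s - f s -
      \sum_(e <- [seq t *: e | e <- es]) quadpart (D2 s) e| <= C * (t * rho) ^+ 3.
  move=> er; have h1 : t * \sum_(e <- es) norm1 e <= t * rho by rewrite ler_wpM2l.
  have s0 : 0 <= \sum_(e <- es) norm1 e by rewrite sumr_ge0// => e _; exact: norm1_ge0.
  apply: (le_trans (ravg_taylor2 s fT _)); first by rewrite nE (le_trans h1).
  by rewrite nE ler_wpM2l// lerXn2r// nnegrE ?mulr_ge0// (le_trans s0).
have := bnd _ xr; have := bnd _ yr.
rewrite !quadpart_gram.
set SX := \sum_a _; set SY := \sum_a _.
have SXY : t ^+ 2 * SX <= t ^+ 2 * SY.
  rewrite ler_wpM2l ?exprn_ge0//; apply: ler_sum => a _; apply: ler_sum => b _.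
  have [le_ab eq_ab] := dom a b; have [/eq_ab ->//|ab] := eqVneq a.1 b.1.
  by rewrite ler_wpM2l// D2p.
rewrite !ler_norml => /andP[? ?] /andP[? ?].
lra.
Qed.

(** The one-packet comparison holds at every base point, so it survives averaging over the other
    packets, and the errors add up. *)
Lemma ravg_gordon_iter (R : realType) (m n : nat) (f : 'M[R]_(m, n) -> R)
    (xs ys : seq 'M[R]_(m, n)) (eps : R) (N : nat) :
  (forall s, ravg ys f s <= ravg xs f s + eps) ->
  forall s, ravg (flatten (nseq N ys)) f s <= ravg (flatten (nseq N xs)) f s + N%:R * eps.
Proof.
move=> h; elim: N => [|N IH] s; first by rewrite /= mul0r addr0.
rewrite [nseq N.+1 ys]/= [nseq N.+1 xs]/= [flatten (ys :: _)]/= [flatten (xs :: _)]/=.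
rewrite ravg_cat.
apply: (le_trans (ravg_le _ h s)).
rewrite ravgD ravg_cst -[N.+1%:R]natr1 mulrDl mul1r addrA lerD2r.
rewrite -ravg_cat (ravg_perm f (es2 := flatten (nseq N ys) ++ xs)); last first.
  by rewrite perm_catC.
rewrite ravg_cat; apply: (le_trans (ravg_le _ IH s)).
rewrite ravgD ravg_cst -ravg_cat (ravg_perm f (es2 := xs ++ flatten (nseq N xs)))//.
by rewrite perm_catC.
Qed.

(** Replacing Gaussians one after the other groups the signs by variable, whereas Gordon's
    comparison needs packets with one sign per variable. *)
Lemma perm_flatten_nseq (T : eqType) (xs : seq T) (N : nat) :
  perm_eq (flatten [seq nseq N x | x <- xs]) (flatten (nseq N xs)).
Proof.
elim: xs => [|x xs IH] /=; first by elim: N.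
have h : perm_eq (flatten (nseq N (x :: xs))) (nseq N x ++ flatten (nseq N xs)).
  elim: {IH} N => //= N IH; rewrite perm_cons.
  by rewrite perm_sym perm_catCA perm_cat2l perm_sym.
by rewrite perm_sym (perm_trans h)// perm_cat2l perm_sym.
Qed.

Lemma le_of_sqrt_rate (R : realType) (a b K K0 : R) :
  (forall N : nat, K0 <= Num.sqrt N.+1%:R -> a <= b + K / Num.sqrt N.+1%:R) -> a <= b.
Proof.
move=> h; rewrite leNgt; apply/negP => ba.
pose M := Num.max 1 (Num.max K0 ((`|K| + 1) / (a - b))).
have M1 : 1 <= M by rewrite /M le_max lexx.
have M0 : 0 <= M by lra.
have MK0 : K0 <= M by rewrite /M !le_max lexx !orbT.
have MK : (`|K| + 1) / (a - b) <= M by rewrite /M !le_max lexx !orbT.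
have qM : M <= Num.sqrt (Num.bound (M ^+ 2)).+1%:R.
  rewrite -[leLHS](ger0_norm M0) -sqrtr_sqr ler_wsqrtr//.
  have /ltW h1 := archi_boundP (sqr_ge0 M).
  by apply: (le_trans h1); rewrite ler_nat.
have := h _ (le_trans MK0 qM); set q := Num.sqrt _ in qM *.
have q0 : 0 < q by lra.
rewrite -lerBlDl ler_pdivlMr//.
have : `|K| + 1 <= q * (a - b).
  by rewrite -ler_pdivrMr ?subr_gt0// (le_trans MK).
have := ler_norm K; lra.
Qed.

Lemma minmax_test_antitone (R : realType) (m n : nat) (L : R) (c : 'M[R]_(m, n)) :
  0 <= L -> mx_antitone (fun s => 1 - minmax_test L c s).
Proof.
move=> L0 s s' ss'; rewrite lerD2l lerN2; apply: minmax_test_le => i j.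
by rewrite ler_wpM2l.
Qed.

(* The entries of [cs] stand for the coefficients of additional Gaussians that are only realized as
   Rademacher sums; discarding them costs a factor 2 each. *)
Lemma gordon_expectation (R : realType) (m n : nat) (d : measure_display)
    (T : measurableType d) (P : probability T R) (I : finType) (X : I -> T -> R)
    (x y : I -> 'M[R]_(m, n)) (cs : seq 'M[R]_(m, n)) (L : R) (c : 'M[R]_(m, n)) :
  mutually_independent P X -> (forall i, std_normal P (X i)) -> 0 <= L ->
  (forall e, e \in cs -> forall i j, 0 <= e i j) ->
  gordon_dominated [seq y i | i <- enum I] (cs ++ [seq x i | i <- enum I]) ->
  1 - \int[P]_t minmax_test L c (0 + \sum_(i <- enum I) X i t *: x i) <=
  2 ^+ size cs * (1 - \int[P]_t minmax_test L c (0 + \sum_(i <- enum I) X i t *: y i)).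
Proof.
move=> iX nX L0 cs0 dom.
have [f01 mf [D1 [D2 [C [fT _ D2p]]]]] := cross_inc_minmax_test c L0.
set f := minmax_test L c in f01 mf fT *.
have cf := taylor2_line_continuous fT.
pose xs := [seq x i | i <- enum I]; pose ys := [seq y i | i <- enum I].
pose rho := \sum_(e <- cs ++ xs) norm1 e + \sum_(e <- ys) norm1 e.
have sn0 (es : seq 'M[R]_(m, n)) : 0 <= \sum_(e <- es) norm1 e.
  by rewrite sumr_ge0// => e _; exact: norm1_ge0.
have rho0 : 0 <= rho by rewrite addr_ge0.
have xr : \sum_(e <- cs ++ xs) norm1 e <= rho by rewrite lerDl.
have yr : \sum_(e <- ys) norm1 e <= rho by rewrite lerDr.
have C0 : 0 <= C by case: fT.
have mem_le (es : seq 'M[R]_(m, n)) e : e \in es -> norm1 e <= \sum_(e <- es) norm1 e.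
  move=> ees; rewrite (perm_big _ (perm_to_rem ees)) big_cons lerDl.
  exact: sn0.
have sym e : norm1 e <= rho -> sym_taylor f e ((1 + C) * rho ^+ 3).
  move=> er s; have [D HD] := taylor2_sym_taylor e f01 fT s.
  exists D => t; apply: (le_trans (HD t)).
  rewrite ler_wpM2r ?exprn_ge0// ler_wpM2l//; first by lra.
  by rewrite lerXn2r// nnegrE norm1_ge0.
have symx i : sym_taylor f (x i) ((1 + C) * rho ^+ 3).
  apply: sym; apply: (le_trans _ xr); apply: mem_le.
  by rewrite mem_cat map_f ?orbT// mem_enum.
have symy i : sym_taylor f (y i) ((1 + C) * rho ^+ 3).
  by apply: sym; apply: (le_trans _ yr); apply: mem_le; rewrite map_f// mem_enum.
set Ex := Rintegral _ _ _; set Ey := Rintegral _ _ _.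
pose k2 : R := 2 ^+ size cs.
have k20 : 0 <= k2 by rewrite exprn_ge0.
(* [A0] collects the cost of passing from Gaussians to signs, [B0] that of exchanging packets; the
   threshold [normal_sd R * rho] keeps a packet within the unit ball, where the Taylor bound
   holds. *)
pose A0 := (size (enum I))%:R * ((1 + C) * rho ^+ 3 * lindeberg_cst R).
pose B0 := 2 * C * (normal_sd R * rho) ^+ 3.
apply: (@le_of_sqrt_rate _ _ _ (A0 + k2 * A0 + k2 * B0) (normal_sd R * rho)) => N qN.
have q0 : 0 < Num.sqrt N.+1%:R :> R by rewrite sqrtr_gt0 ltr0n.
have := @normal_to_ravg _ _ _ _ _ P _ X (enum I) y 0 f _ N iX nX (enum_uniq I) f01 cf mf symy.
have := @normal_to_ravg _ _ _ _ _ P _ X (enum I) x 0 f _ N iX nX (enum_uniq I) f01 cf mf symx.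
rewrite -/Ex -/Ey; set q := Num.sqrt N.+1%:R in q0 qN *.
set t := q^-1 * normal_sd R.
have t0 : 0 <= t by rewrite mulr_ge0 ?normal_sd_ge0// invr_ge0 ltW.
have tr : t * rho <= 1.
  by rewrite /t -mulrA mulrC ler_pdivrMr// mul1r.
set RX := ravg _ f 0; set RY := ravg _ f 0.
have reshape (z : I -> 'M[R]_(m, n)) : [seq nseq N.+1 (t *: z i) | i <- enum I] =
    [seq nseq N.+1 e | e <- [seq t *: e | e <- [seq z i | i <- enum I]]].
  by rewrite -!map_comp.
pose Z := ravg (flatten (nseq N.+1 [seq t *: e | e <- cs ++ xs])) f 0.
have RYZ : RY <= Z + N.+1%:R * (2 * C * (t * rho) ^+ 3).
  rewrite /RY reshape (ravg_perm _ (perm_flatten_nseq _ _)).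
  by apply: ravg_gordon_iter => s; exact: (ravg_gordon s fT D2p dom xr yr t0 tr).
(* For each realization of the signs of [xs], the signs of [cs] are discarded at the price of the
   factor [k2]. *)
have RXZ : 1 - RX <= k2 * (1 - Z).
  rewrite /RX reshape /Z -!ravg_onem.
  rewrite -(ravg_perm _ (perm_flatten_nseq [seq t *: e | e <- cs ++ xs] _)).
  rewrite !map_cat flatten_cat ravg_cat -ravgZ; apply: ravg_le => s.
  rewrite -map_comp.
  apply: (@ravg_pow_half _ _ _ _ _ _ (fun s => 1 - f s)) => //.
    by move=> s'; have := f01 s'; lra.
  exact: minmax_test_antitone.
have eA : (size (enum I))%:R * ((1 + C) * rho ^+ 3 * lindeberg_cst R / q) = A0 / q.
  by rewrite mulrA.
have eB : N.+1%:R * (2 * C * (t * rho) ^+ 3) = B0 / q.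
  have -> : N.+1%:R = q ^+ 2 by rewrite sqr_sqrtr// ler0n.
  by rewrite /t /B0; field; rewrite gt_eqF.
rewrite eA !ler_norml => /andP[? ?] /andP[? ?].
rewrite eB in RYZ.
have h1 : k2 * RY <= k2 * (Z + B0 / q) by rewrite ler_wpM2l.
have h2 : k2 * (Ey - RY) <= k2 * (A0 / q) by rewrite ler_wpM2l.
rewrite -/k2; have -> : (A0 + k2 * A0 + k2 * B0) / q = A0 / q + k2 * (A0 / q) + k2 * (B0 / q) by ring.
lra.
Qed.

Lemma probability_le_integral (R : realType) (d : measure_display)
    (T : measurableType d) (P : probability T R) (A : set T) (g : T -> R) :
  measurable A -> measurable_fun setT g -> (forall t, 0 <= g t) ->
  (forall t, A t -> 1 <= g t) -> (P A <= \int[P]_t (g t)%:E)%E.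
Proof.
move=> mA mg g0 gA.
rewrite (_ : P A = \int[P]_t (\1_A t)%:E)%E; last by rewrite integral_indic// setIT.
apply: ge0_le_integral => //.
- exact/measurable_EFinP/measurable_indic.
- exact/measurable_EFinP.
- move=> t _; rewrite lee_fin indicE.
  by case: (boolP (t \in A)) => [/set_mem/gA|_].
Qed.

Lemma integral_le_probability (R : realType) (d : measure_display)
    (T : measurableType d) (P : probability T R) (A : set T) (g : T -> R) :
  measurable A -> measurable_fun setT g -> (forall t, 0 <= g t <= 1) ->
  (forall t, ~ A t -> g t = 0) -> (\int[P]_t (g t)%:E <= P A)%E.
Proof.
move=> mA mg g01 gA.
rewrite (_ : P A = \int[P]_t (\1_A t)%:E)%E; last by rewrite integral_indic// setIT.
apply: ge0_le_integral => //.
- by move=> t _; rewrite lee_fin; have /andP[] := g01 t.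
- exact/measurable_EFinP.
- exact/measurable_EFinP/measurable_indic.
- move=> t _; rewrite lee_fin indicE.
  case: (boolP (t \in A)) => [_|]; first by have /andP[] := g01 t.
  by rewrite notin_setE => /gA ->.
Qed.

(** [1 - minmax_test] is 1 on the first event and 0 off the second. The matrix [psi] only shifts the
    thresholds inside the test function. *)
Lemma gordon_probability (R : realType) (m n : nat) (d : measure_display)
    (T : measurableType d) (P : probability T R) (I : finType) (X : I -> T -> R)
    (x y : I -> 'M[R]_(m, n)) (cs : seq 'M[R]_(m, n)) (psi : 'M[R]_(m, n)) (c delta : R) :
  mutually_independent P X -> (forall i, std_normal P (X i)) -> 0 < delta ->
  (forall e, e \in cs -> forall i j, 0 <= e i j) ->
  gordon_dominated [seq y i | i <- enum I] (cs ++ [seq x i | i <- enum I]) ->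
  (P [set t | exists i, forall j, (\sum_r X r t * x r i j + psi i j < c)%R] <=
  (2 ^ size cs)%:R%:E *
    P [set t | exists i, forall j, (\sum_r X r t * y r i j + psi i j < c + delta)%R])%E.
Proof.
move=> iX nX delta0 cs0 dom.
have [mX _] := iX.
(* [sstep] climbs from 0 to 1 on an interval of length 3, which this scaling shrinks to [delta]. *)
pose L := 3 / delta.
have L0 : 0 < L by rewrite divr_gt0.
pose cm : 'M[R]_(m, n) := \matrix_(i, j) (L * (psi i j - c)).
have cmE i j : cm i j = L * (psi i j - c) by rewrite mxE.
have := gordon_expectation cm iX nX (ltW L0) cs0 dom.
pose W (z : I -> 'M[R]_(m, n)) t : 'M[R]_(m, n) := 0 + \sum_(i <- enum I) X i t *: z i.
have WE z t i j : W z t i j = \sum_r X r t * z r i j.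
  rewrite /W add0r summxE big_enum /=; apply: eq_bigr => r _.
  by rewrite mxE.
have mW z i j : measurable_fun setT (fun t => W z t i j).
  by apply: measurable_mx_sum => r _; exact: mX.
have [f01 mf _] := @cross_inc_minmax_test _ m n L cm (ltW L0).
pose g z t := 1 - minmax_test L cm (W z t).
have g01 z t : 0 <= g z t <= 1 by have := f01 (W z t); rewrite /g; lra.
have mg z : measurable_fun setT (g z).
  by apply: measurable_funB => //; apply: mf => i j; exact: mW.
have mE (z : I -> 'M[R]_(m, n)) (a : R) : measurable [set t | exists i, forall j, \sum_r X r t * z r i j + psi i j < a].
  rewrite (_ : [set t | _] = \bigcup_(i in [set: 'I_m]) \bigcap_(j in [set: 'I_n])
      [set t | W z t i j + psi i j < a]); last first.
    apply/seteqP; split => [t [i ti]|t [i _ ti]].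
      by exists i => // j _ /=; rewrite WE.
    by exists i => j; rewrite -WE; exact: ti.
  apply: fin_bigcup_measurable => // i _; apply: fin_bigcap_measurable => // j _.
  have := (measurable_funD (mW z i j) (measurable_cst (psi i j))) measurableT _ (measurable_itv `]-oo, a[).
  by rewrite setTI; congr (measurable _); apply/seteqP; split => t /=; rewrite in_itv.
have gi z : P.-integrable setT (EFin \o g z).
  by apply: (@bounded_integrable _ _ _ P _ 1) => // t; have := g01 z t; rewrite ler_norml; lra.
have fi z : P.-integrable setT (EFin \o (fun t => minmax_test L cm (W z t))).
  apply: (@bounded_integrable _ _ _ P _ 1); first by apply: mf => i j; exact: mW.
  by move=> t; have := f01 (W z t); rewrite ler_norml; lra.
have gE z : (\int[P]_t (g z t)%:E)%E = (1 - \int[P]_t minmax_test L cm (W z t))%:E.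
  rewrite /g -[LHS]fineK; last by apply: integrable_fin_num => //; exact: gi.
  congr EFin; transitivity (\int[P]_t cst 1 t - \int[P]_t minmax_test L cm (W z t)).
    rewrite -RintegralB//; exact: finite_measure_integrable_cst.
  congr (_ - _); rewrite (Rintegral_cst P measurableT) mul1r.
  by transitivity (fine 1%E : R) => //; congr fine; exact: probability_setT.
rewrite -lee_fin EFinM -/(W x) -/(W y) -!gE => H.
apply: (@le_trans _ _ (\int[P]_t (g x t)%:E)%E).
  apply: probability_le_integral => //.
    by move=> t; have /andP[] := g01 x t.
  move=> t [i ti]; rewrite /g (@minmax_test_eq0 _ _ _ _ _ _ i) ?subr0// => j.
  rewrite cmE -mulrDr WE mulr_ge0_le0 ?(ltW L0)//.
  by have := ti j; lra.
apply: (le_trans H); rewrite -natrX lee_wpmul2l// ?lee_fin//.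
apply: integral_le_probability => //.
move=> t /forallNP tA; rewrite /g minmax_test_eq1 ?subrr// => i.
have /existsNP[j /negP] := tA i; rewrite -leNgt => tj.
exists j; rewrite cmE -mulrDr WE.
have -> : 3 = L * delta by rewrite /L divfK// gt_eqF.
by rewrite ler_pM2l//; lra.
Qed.

(** * Discretization by finite nets *)

(** Total boundedness of [SW] for the pseudometric that takes the supremum of [|f j w v - f j w' v|]
    over [v] in [SV] and over [j]. *)
Definition uniform_net (R : realType) (W V : Type) (SW : set W) (SV : set V) (J : finType)
    (f : J -> W -> V -> R) :=
  forall eps : R, 0 < eps -> exists p (ws : 'I_p -> W), (forall i, SW (ws i)) /\
    forall w, SW w -> exists i, forall v, SV v -> forall j, `|f j w v - f j (ws i) v| <= eps.

(** The index [None] holds the deterministic term, [Some r] the coefficient of the Gaussian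
    [X r]. *)
Definition process (R : realType) (T W V : Type) (I : finType) (X : I -> T -> R)
    (f : option I -> W -> V -> R) (t : T) (w : W) (v : V) : R :=
  \sum_r X r t * f (Some r) w v + f None w v.

Definition size1 (R : realType) (T : Type) (I : finType) (X : I -> T -> R) (t : T) : R :=
  \sum_r `|X r t|.

(** For bounded processes this is the event that the inf-sup is below [c], see [infsup_ltP]. The
    margin [e] is there because a strict bound for every [v] would only give a supremum at most
    [c]. *)
Definition lower_event (R : realType) (T W V : Type) (SW : set W) (SV : set V)
    (F : T -> W -> V -> R) (c : R) : set T :=
  [set t | exists e, 0 < e /\ exists2 w, SW w & forall v, SV v -> F t w v <= c - e].

Lemma size1_ge0 (R : realType) (T : Type) (I : finType) (X : I -> T -> R) (t : T) :
  0 <= size1 X t.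
Proof. by apply: sumr_ge0. Qed.

(** All dependence on the sample is in the factor [1 + size1 X t], so nets chosen independently of
    [t] serve for all samples. *)
Lemma process_close (R : realType) (T W V : Type) (I : finType) (X : I -> T -> R)
    (f : option I -> W -> V -> R) (t : T) (w w' : W) (v v' : V) (eps : R) :
  (forall j, `|f j w v - f j w' v'| <= eps) ->
  `|process X f t w v - process X f t w' v'| <= eps * (1 + size1 X t).
Proof.
move=> h; rewrite /process.
have -> : \sum_r X r t * f (Some r) w v + f None w v -
    (\sum_r X r t * f (Some r) w' v' + f None w' v') =
  (f None w v - f None w' v') + \sum_r X r t * (f (Some r) w v - f (Some r) w' v').
  under [in RHS]eq_bigr do rewrite mulrBr.
  by rewrite sumrB; ring.
rewrite mulrDr mulr1 (le_trans (ler_normD _ _))// lerD//.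
apply: (le_trans (ler_norm_sum _ _ _)); rewrite /size1 mulr_sumr.
by apply: ler_sum => r _; rewrite normrM mulrC ler_wpM2r.
Qed.

Lemma measurable_process (R : realType) (d : measure_display) (T : measurableType d)
    (W V : Type) (I : finType) (X : I -> T -> R) (f : option I -> W -> V -> R) w v :
  (forall i, measurable_fun setT (X i)) ->
  measurable_fun setT (fun t => process X f t w v).
Proof.
move=> mX; apply: measurable_funD => //.
by apply: measurable_sum => r; exact: measurable_funM.
Qed.

Lemma measurable_size1 (R : realType) (d : measure_display) (T : measurableType d)
    (I : finType) (X : I -> T -> R) :
  (forall i, measurable_fun setT (X i)) -> measurable_fun setT (size1 X).
Proof.
by move=> mX; apply: measurable_sum => r; apply: measurableT_comp => //; exact: mX.
Qed.

Lemma measurable_lt (R : realType) (d : measure_display) (T : measurableType d)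
    (f g : T -> R) : measurable_fun setT f -> measurable_fun setT g ->
  measurable [set t | f t < g t].
Proof.
move=> mf mg; have := measurable_funB mf mg measurableT (measurable_itv `]-oo, 0[%R).
by rewrite setTI; congr (measurable _); apply/seteqP; split => t /=;
  rewrite in_itv/= subr_lt0.
Qed.

Lemma measurable_net_event (R : realType) (d : measure_display) (T : measurableType d)
    (p q : nat) (F : T -> 'I_p -> 'I_q -> R) (c : T -> R) :
  (forall i j, measurable_fun setT (fun t => F t i j)) -> measurable_fun setT c ->
  measurable [set t | exists i, forall j, F t i j < c t].
Proof.
move=> mF mc.
rewrite (_ : [set t | _] = \bigcup_(i in [set: 'I_p]) \bigcap_(j in [set: 'I_q])
    [set t | F t i j < c t]); last first.
  apply/seteqP; split => [t [i ti]|t [i _ ti]].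
    by exists i => // j _; exact: ti.
  by exists i => j; exact: ti.
apply: fin_bigcup_measurable => // i _; apply: fin_bigcap_measurable => // j _.
exact: measurable_lt.
Qed.

(** With nets of mesh [1 / (m + 1)] the event becomes a countable union of events involving finitely
    many pairs of points. *)
Lemma measurable_lower_event (R : realType) (d : measure_display) (T : measurableType d)
    (W V : Type) (SW : set W) (SV : set V) (I : finType) (X : I -> T -> R)
    (f : option I -> W -> V -> R) (c : R) :
  (forall i, measurable_fun setT (X i)) ->
  uniform_net SW SV f -> uniform_net SV SW (fun j v w => f j w v) ->
  measurable (lower_event SW SV (process X f) c).
Proof.
move=> mX nW nV.
have e0 (m : nat) : 0 < m.+1%:R^-1 :> R by rewrite invr_gt0 ltr0n.
pose p m := sval (cid (nW _ (e0 m))).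
pose ws m := sval (cid (svalP (cid (nW _ (e0 m))))).
have wsP m : (forall i, SW (ws m i)) /\ forall w, SW w -> exists i, forall v, SV v ->
    forall j, `|f j w v - f j (ws m i) v| <= m.+1%:R^-1.
  exact: (svalP (cid (svalP (cid (nW _ (e0 m)))))).
pose q m := sval (cid (nV _ (e0 m))).
pose vs m := sval (cid (svalP (cid (nV _ (e0 m))))).
have vsP m : (forall i, SV (vs m i)) /\ forall v, SV v -> exists i, forall w, SW w ->
    forall j, `|f j w v - f j w (vs m i)| <= m.+1%:R^-1.
  exact: (svalP (cid (svalP (cid (nV _ (e0 m)))))).
rewrite (_ : lower_event _ _ _ _ = \bigcup_m [set t | exists i, forall j,
    process X f t (ws m i) (vs m j) < c - 2 * m.+1%:R^-1 * (1 + size1 X t)]).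
  apply: bigcupT_measurable => m; apply: measurable_net_event.
    by move=> i j; exact: measurable_process.
  apply: measurable_funB => //; apply: measurable_funM => //.
  by apply: measurable_funD => //; exact: measurable_size1.
apply/seteqP; split => t.
  move=> [e [e0' [w SWw Fw]]].
  have S0 := size1_ge0 X t.
  (* Three mesh errors must fit into the margin: one moves [w] to the net, one moves a net point to
     an arbitrary [v] in the converse inclusion, and one is left there as the margin. *)
  pose m := Num.bound (3 * (1 + size1 X t) / e).
  have me : 3 * m.+1%:R^-1 * (1 + size1 X t) < e.
    rewrite mulrAC ltr_pdivrMr ?ltr0n// -ltr_pdivrMl// mulrC.
    apply: (@lt_le_trans _ _ m%:R); last by rewrite ler_nat.
    by apply: archi_boundP; rewrite divr_ge0 ?(ltW e0')//; lra.
  exists m => //; have [wsS wsN] := wsP m; have [vsS _] := vsP m.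
  have [i wi] := wsN _ SWw; exists i => j.
  move: me (process_close X t (wi _ (vsS j))) (Fw _ (vsS j)).
  by rewrite ler_norml; move: (m.+1%:R^-1) => u ? /andP[? ?] ?; lra.
move=> [m _ [i ti]]; exists (m.+1%:R^-1 * (1 + size1 X t)).
have S0 := size1_ge0 X t.
split; first by rewrite mulr_gt0//; lra.
have [wsS _] := wsP m; have [vsS vsN] := vsP m.
exists (ws m i) => // v SVv.
have [j vj] := vsN _ SVv.
move: (process_close X t (vj _ (wsS i))) (ti j).
by rewrite ler_norml; move: (m.+1%:R^-1) => u /andP[? ?] ?; lra.
Qed.

Lemma size1_tail (R : realType) (d : measure_display) (T : measurableType d)
    (P : probability T R) (I : finType) (X : I -> T -> R) (eta : R) :
  (forall i, measurable_fun setT (X i)) -> 0 < eta ->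
  exists2 K : R, 0 <= K & (P [set t | (K < size1 X t)%R] <= eta%:E)%E.
Proof.
move=> mX eta0.
pose A (m : nat) := [set t | m%:R < size1 X t].
have mA m : measurable (A m).
  by apply: measurable_lt => //; exact: measurable_size1.
have capA : \bigcap_m A m = set0.
  apply/seteqP; split => // t tA.
  have := tA (Num.bound (size1 X t)) Logic.I; rewrite /A /= ltNge => /negP; apply.
  by apply/ltW/archi_boundP; exact: size1_ge0.
have niA : nonincreasing_seq A.
  by move=> m n mn; apply/subsetPset => t /=; apply: le_lt_trans; rewrite ler_nat.
have PA0 : (P (A 0%N) < +oo)%E.
  by apply: (le_lt_trans (probability_le1 P (mA 0%N))); exact: ltry.
have := @nonincreasing_cvg_mu _ _ _ P A PA0 mA.
rewrite capA measure0 => /(_ measurable0 niA) cvA.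
have [m Pm] : exists m, (P (A m) <= eta%:E)%E; last by exists m%:R.
apply: contrapT => /forallNP h.
have : (eta%:E <= 0)%E; last by rewrite lee_fin leNgt eta0.
rewrite -(cvg_lim _ cvA)//; apply: lime_ge; first by apply/cvg_ex; exists 0%E.
by apply: nearW => m; apply/ltW; rewrite ltNge; exact/negP/h.
Qed.

Lemma uniform_net_pair (R : realType) (W V : Type) (SW : set W) (SV : set V) (J : finType)
    (f g : J -> W -> V -> R) :
  uniform_net SW SV (fun (bj : bool * J) w v => if bj.1 then f bj.2 w v else g bj.2 w v) ->
  uniform_net SW SV f /\ uniform_net SW SV g.
Proof.
move=> fg; split => eps eps0; have [p [ws [wsS wsN]]] := fg _ eps0; exists p, ws; split => // w SWw;
  have [i wi] := wsN _ SWw; exists i => v SVv j.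
- exact: (wi v SVv (true, j)).
- exact: (wi v SVv (false, j)).
Qed.

Definition gordon_gram (R : realType) (W V : Type) (I : finType)
    (f g : option I -> W -> V -> R) (cs : seq (W -> V -> R)) :=
  forall w v w' v',
    let Y := \sum_r g (Some r) w v * g (Some r) w' v' in
    let X := \sum_(c <- cs) c w v * c w' v' + \sum_r f (Some r) w v * f (Some r) w' v' in
    Y <= X /\ (w = w' -> Y = X).

(** Outside an event of small probability [size1] is at most [K], so fixed nets approximate both
    processes uniformly and the finite comparison applies to the matrices of their coefficients. *)
Lemma lower_event_slack (R : realType) (d : measure_display) (T : measurableType d)
    (P : probability T R) (W V : Type) (SW : set W) (SV : set V) (I : finType) (X : I -> T -> R)
    (f g : option I -> W -> V -> R) (cs : seq (W -> V -> R)) (c delta : R) :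
  mutually_independent P X -> (forall i, std_normal P (X i)) ->
  uniform_net SW SV
    (fun (bj : bool * option I) w v => if bj.1 then f bj.2 w v else g bj.2 w v) ->
  uniform_net SV SW
    (fun (bj : bool * option I) v w => if bj.1 then f bj.2 w v else g bj.2 w v) ->
  f None = g None ->
  (forall e, List.In e cs -> forall w v, 0 <= e w v) -> gordon_gram f g cs -> 0 < delta ->
  (P (lower_event SW SV (process X f) c) <=
   (2 ^ size cs)%:R%:E * P (lower_event SW SV (process X g) (c + delta)))%E.
Proof.
move=> iX nX nW nV fgN cs0 gram delta0.
have [mX _] := iX.
have [nWf nWg] := uniform_net_pair nW; 
have [nVf nVg] := @uniform_net_pair _ _ _ _ _ _ (fun j v w => f j w v) (fun j v w => g j w v) nV.
apply/lee_addgt0Pr => eta eta0.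
pose k2 : R := (2 ^ size cs)%:R.
have k20 : 0 <= k2 by [].
(* The exceptional event is paid once for [f] and [k2] times for [g]. *)
pose eta' := eta / (1 + k2).
have eta'0 : 0 < eta' by rewrite divr_gt0//; lra.
have [K K0 PK] := size1_tail P mX eta'0.
pose eps := delta / (8 * (1 + K)).
have eps0 : 0 < eps by rewrite divr_gt0// mulr_gt0//; lra.
have epsK t : size1 X t <= K -> eps * (1 + size1 X t) <= delta / 8.
  move=> SK; have -> : delta / 8 = eps * (1 + K).
    by rewrite /eps invfM mulrA divfK// gt_eqF// ltr_pwDl.
  by rewrite ler_wpM2l ?(ltW eps0)//; lra.
have [p [ws [wsS wsN]]] := nW _ eps0; have [q [vs [vsS vsN]]] := nV _ eps0.
pose x r : 'M[R]_(p, q) := \matrix_(i, j) f (Some r) (ws i) (vs j).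
pose y r : 'M[R]_(p, q) := \matrix_(i, j) g (Some r) (ws i) (vs j).
pose psi : 'M[R]_(p, q) := \matrix_(i, j) f None (ws i) (vs j).
pose cm : seq 'M[R]_(p, q) := [seq \matrix_(i, j) e (ws i) (vs j) | e <- cs].
have cm0 e : e \in cm -> forall i j, 0 <= e i j.
  rewrite /cm; elim: (cs) cs0 => //= e' cs' IH cs0'.
  rewrite inE => /predU1P[-> i j|ecs]; first by rewrite mxE; apply: cs0'; left.
  by apply: IH => // e'' h; apply: cs0'; right.
have dom : gordon_dominated [seq y i | i <- enum I] (cm ++ [seq x i | i <- enum I]).
  move=> [i j] [i' j']; have [le_YX eq_YX] := gram (ws i) (vs j) (ws i') (vs j').
  have enumE (z : I -> 'M[R]_(p, q)) a b :
      \sum_(e <- [seq z r | r <- enum I]) entry e a * entry e b =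
      \sum_r z r a.1 a.2 * z r b.1 b.2 by rewrite big_map big_enum.
  have YE : \sum_r y r i j * y r i' j' = \sum_r g (Some r) (ws i) (vs j) * g (Some r) (ws i') (vs j').
    by apply: eq_bigr => r _; rewrite !mxE.
  have XE : \sum_r x r i j * x r i' j' = \sum_r f (Some r) (ws i) (vs j) * f (Some r) (ws i') (vs j').
    by apply: eq_bigr => r _; rewrite !mxE.
  have CE : \sum_(e <- cm) entry e (i, j) * entry e (i', j') =
      \sum_(e <- cs) e (ws i) (vs j) * e (ws i') (vs j').
    by rewrite /cm big_map; apply: eq_bigr => e _; rewrite /entry !mxE.
  rewrite !big_cat !enumE /= YE XE CE.
  by split => // ii'; apply: eq_YX; rewrite ii'.
(* The threshold rises by [delta / 8] for the net of [f], [delta / 2] for the smoothing and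
   [delta / 8] for the net of [g]; the remaining [delta / 4] is the margin required by
   [lower_event]. *)
have delta20 : 0 < delta / 2 by lra.
have := gordon_probability psi (c + delta / 8) iX nX delta20 cm0 dom.
rewrite size_map.
set E1 := [set t | _]; set E2 := [set t | _] => gor.
pose B := [set t | K < size1 X t].
have mB : measurable B by apply: measurable_lt => //; exact: measurable_size1.
have xE t i j : \sum_r X r t * x r i j + psi i j = process X f t (ws i) (vs j).
  by rewrite /process mxE; congr (_ + _); apply: eq_bigr => r _; rewrite mxE.
have yE t i j : \sum_r X r t * y r i j + psi i j = process X g t (ws i) (vs j).
  by rewrite /process mxE fgN; congr (_ + _); apply: eq_bigr => r _; rewrite mxE.
have mE1 : measurable E1.
  rewrite (_ : E1 = [set t | exists i, forall j, process X f t (ws i) (vs j) < c + delta / 8]).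
    by apply: measurable_net_event => // i j; exact: measurable_process.
  by apply/seteqP; split => t [i ti]; exists i => j; have := ti j; rewrite xE.
have mE2 : measurable E2.
  rewrite (_ : E2 = [set t | exists i, forall j, process X g t (ws i) (vs j) < c + delta / 8 + delta / 2]).
    by apply: measurable_net_event => // i j; exact: measurable_process.
  by apply/seteqP; split => t [i ti]; exists i => j; have := ti j; rewrite yE.
have mL1 := measurable_lower_event c mX nWf nVf.
have mL2 := measurable_lower_event (c + delta) mX nWg nVg.
set L1 := lower_event _ _ _ _ in mL1 *; set L2 := lower_event _ _ _ _ in mL2 *.
have PU (A A1 A2 : set T) : measurable A -> measurable A1 -> measurable A2 ->
    A `<=` A1 `|` A2 -> (P A <= P A1 + P A2)%E.
  move=> mA mA1 mA2 AA; apply: (@le_trans _ _ (P (A1 `|` A2))).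
    by apply: le_measure => //; rewrite inE//; exact: measurableU.
  exact: measureU2.
have h1 : (P L1 <= P E1 + P B)%E.
  apply: PU => // t [e [e0 [w SWw Fw]]].
  have [SK|SK] := leP (size1 X t) K; last by right.
  left; have [i wi] := wsN _ SWw; exists i => j; rewrite xE.
  have := process_close X t (fun j' => wi _ (vsS j) (true, j')).
  by have := epsK _ SK; have := Fw _ (vsS j); rewrite ler_norml /=; lra.
have h2 : (P E2 <= P L2 + P B)%E.
  apply: PU => // t [i ti].
  have [SK|SK] := leP (size1 X t) K; last by right.
  left; exists (delta / 4); split; first by lra.
  exists (ws i) => // v SVv; have [j vj] := vsN _ SVv.
  have := process_close X t (fun j' => vj _ (wsS i) (false, j')).
  by have := epsK _ SK; have := ti j; rewrite yE ler_norml /=; lra.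
apply: (le_trans h1); apply: (@le_trans _ _ (k2%:E * (P L2 + eta'%:E) + eta'%:E)%E).
  apply: leeD => //; apply: (le_trans gor); rewrite lee_wpmul2l ?lee_fin//.
  by apply: (le_trans h2); rewrite leeD2l.
rewrite ge0_muleDr ?lee_fin ?(ltW eta'0)// -addeA leeD2l//.
rewrite -EFinM -EFinD lee_fin -[leRHS](@divfK _ (1 + k2)) ?gt_eqF ?ltr_pwDl//.
by rewrite -/eta' mulrDr mulr1 addrC mulrC.
Qed.

(** The event at [c] is the increasing union of the events at [c - 1 / (m + 1)], to each of which
    [lower_event_slack] applies with [delta = 1 / (m + 1)]; continuity from below removes the
    slack. *)
Lemma lower_event_comparison (R : realType) (d : measure_display) (T : measurableType d)
    (P : probability T R) (W V : Type) (SW : set W) (SV : set V) (I : finType) (X : I -> T -> R)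
    (f g : option I -> W -> V -> R) (cs : seq (W -> V -> R)) (c : R) :
  mutually_independent P X -> (forall i, std_normal P (X i)) ->
  uniform_net SW SV
    (fun (bj : bool * option I) w v => if bj.1 then f bj.2 w v else g bj.2 w v) ->
  uniform_net SV SW
    (fun (bj : bool * option I) v w => if bj.1 then f bj.2 w v else g bj.2 w v) ->
  f None = g None ->
  (forall e, List.In e cs -> forall w v, 0 <= e w v) -> gordon_gram f g cs ->
  (P (lower_event SW SV (process X f) c) <=
   (2 ^ size cs)%:R%:E * P (lower_event SW SV (process X g) c))%E.
Proof.
move=> iX nX nW nV fgN cs0 gram; have [mX _] := iX.
have [nWf _] := uniform_net_pair nW; 
have [nVf _] := @uniform_net_pair _ _ _ _ _ _ (fun j v w => f j w v) (fun j v w => g j w v) nV.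
pose A (m : nat) := lower_event SW SV (process X f) (c - m.+1%:R^-1).
have e0 (m : nat) : 0 < m.+1%:R^-1 :> R by rewrite invr_gt0 ltr0n.
have AE : lower_event SW SV (process X f) c = \bigcup_m A m.
  apply/seteqP; split => t.
    move=> [e [e0' [w SWw Fw]]].
    pose m := Num.bound (2 / e).
    have me : m.+1%:R^-1 < e / 2.
      rewrite -[e / 2]invrK ltf_pV2 ?posrE ?ltr0n// ?invr_gt0 ?divr_gt0// invf_div.
      apply: (@lt_le_trans _ _ m%:R); last by rewrite ler_nat.
      by apply: archi_boundP; rewrite divr_ge0 ?(ltW e0').
    exists m => //; exists (e / 2); split; first by lra.
    exists w => // v /Fw h; apply: (le_trans h).
    by move: (m.+1%:R^-1) me => u me; lra.
  move=> [m _ [e [e0' [w SWw Fw]]]]; exists e; split => //; exists w => // v /Fw.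
  by move: (m.+1%:R^-1) (e0 m) => u u0; lra.
have mA m : measurable (A m) by exact: measurable_lower_event.
have ndA : nondecreasing_seq A.
  move=> m n mn; apply/subsetPset => t [e [e0' [w SWw Fw]]].
  exists e; split => //; exists w => // v /Fw /le_trans; apply.
  by rewrite lerD2r lerD2l lerN2 lef_pV2 ?posrE ?ltr0n// ler_nat ltnS.
have := @nondecreasing_cvg_mu _ _ _ P A mA (bigcupT_measurable _ mA) ndA.
rewrite -AE => cvA; rewrite -(cvg_lim _ cvA)//.
apply: lime_le; first by apply/cvg_ex; exists (P (lower_event SW SV (process X f) c)).
apply: nearW => m /=.
have := lower_event_slack (c - m.+1%:R^-1) iX nX nW nV fgN cs0 gram (e0 m).
by rewrite subrK.
Qed.

(** * The two Gaussian processes *)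

Definition cdot (R : realType) (m : nat) (u v : 'cV[R]_m) : R := \sum_i u i 0 * v i 0.

Lemma enorm_ge0 (R : realType) (m : nat) (u : 'cV[R]_m) : 0 <= enorm u.
Proof. exact: sqrtr_ge0. Qed.

Lemma enorm_sqr (R : realType) (m : nat) (u : 'cV[R]_m) : enorm u ^+ 2 = cdot u u.
Proof.
rewrite sqr_sqrtr; last by rewrite sumr_ge0// => i _; exact: sqr_ge0.
by apply: eq_bigr => i _; rewrite expr2.
Qed.

Lemma cdot_le_enorm (R : realType) (m : nat) (u v : 'cV[R]_m) :
  cdot u v <= enorm u * enorm v.
Proof.
set a := enorm u; set b := enorm v.
have H (x y : R) : \sum_i (x * u i 0 - y * v i 0) ^+ 2 =
    x ^+ 2 * a ^+ 2 - 2 * x * y * cdot u v + y ^+ 2 * b ^+ 2.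
  rewrite /a /b !enorm_sqr /cdot !mulr_sumr -sumrB -big_split.
  by apply: eq_bigr => i _ /=; ring.
have a0 : 0 <= a by exact: enorm_ge0.
have b0 : 0 <= b by exact: enorm_ge0.
have sq x y : 0 <= x ^+ 2 * a ^+ 2 - 2 * x * y * cdot u v + y ^+ 2 * b ^+ 2.
  by rewrite -H sumr_ge0// => i _; exact: sqr_ge0.
have zero (w : 'cV[R]_m) : enorm w = 0 -> forall i, w i 0 = 0.
  move=> w0 i; have := enorm_sqr w; rewrite w0 expr0n /= /cdot => /esym/eqP.
  rewrite psumr_eq0; last by move=> j _; rewrite -expr2 sqr_ge0.
  by move=> /allP/(_ i); rewrite mem_index_enum /= mulf_eq0 orbb => /(_ isT)/eqP.
have [a00|a00] := eqVneq a 0.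
  rewrite a00 mul0r /cdot big1// => i _; by rewrite (zero u)// mul0r.
have [b00|b00] := eqVneq b 0.
  rewrite b00 mulr0 /cdot big1// => i _; by rewrite (zero v)// mulr0.
have ab0 : 0 < a * b by rewrite mulr_gt0// lt_neqAle eq_sym ?a00 ?b00.
(* This is the expansion [|b u - a v|^2 = 2 a b (a b - cdot u v)]. *)
have := sq b a.
rewrite (_ : _ + _ = (2 * (a * b)) * (a * b - cdot u v)); last by ring.
have ab2 : 0 < 2 * (a * b) by rewrite mulr_gt0.
by rewrite (pmulr_rge0 _ ab2) subr_ge0.
Qed.

Lemma big_gidx (R : realType) (k d : nat) (n : 'I_k -> nat)
    (f : {l : 'I_k & ('I_(n l) * 'I_d + 'I_d + 'I_(n l))%type} -> R) :
  \sum_r f r = \sum_l (\sum_i \sum_c f (existT _ l (inl (inl (i, c)))) +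
    \sum_c f (existT _ l (inl (inr c))) + \sum_i f (existT _ l (inr i))).
Proof.
transitivity (\sum_l \sum_(j : 'I_(n l) * 'I_d + 'I_d + 'I_(n l)) f (existT _ l j)).
  apply/esym; etransitivity.
    exact: (@sig_big_dep R 0 _ 'I_k
      (fun l => ('I_(n l) * 'I_d + 'I_d + 'I_(n l))%type : finType)
      xpredT (fun l => xpredT) (fun l j => f (existT _ l j))).
  by apply: eq_bigr => -[].
apply: eq_bigr => l _; rewrite !big_sumType /= pair_bigA /=.
by congr (_ + _ + _); apply: eq_bigr => -[].
Qed.

(** The index type lists the entries of [g] and [h] as well, with coefficient 0, so that both
    processes are driven by one family of Gaussians. *)
Definition Phi_coef (R : realType) (k d : nat) (n : 'I_k -> nat) (W V : Type)
    (alpha : 'I_k -> W -> 'cV[R]_d) (beta : forall l : 'I_k, V -> 'cV[R]_(n l))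
    (psi : W -> V -> R)
    (o : option {l : 'I_k & ('I_(n l) * 'I_d + 'I_d + 'I_(n l))%type}) (w : W) (v : V) : R :=
  match o with
  | None => psi w v
  | Some (existT l (inl (inl (i, c)))) => beta l v i 0 * alpha l w c 0
  | Some _ => 0
  end.

Definition phi_coef (R : realType) (k d : nat) (n : 'I_k -> nat) (W V : Type)
    (alpha : 'I_k -> W -> 'cV[R]_d) (beta : forall l : 'I_k, V -> 'cV[R]_(n l))
    (psi : W -> V -> R)
    (o : option {l : 'I_k & ('I_(n l) * 'I_d + 'I_d + 'I_(n l))%type}) (w : W) (v : V) : R :=
  match o with
  | None => psi w v
  | Some (existT l (inl (inl _))) => 0
  | Some (existT l (inl (inr c))) => enorm (beta l v) * alpha l w c 0
  | Some (existT l (inr i)) => enorm (alpha l w) * beta l v i 0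
  end.

Lemma Phi_gramE (R : realType) (k d : nat) (n : 'I_k -> nat) (W V : Type)
    (alpha : 'I_k -> W -> 'cV[R]_d) (beta : forall l : 'I_k, V -> 'cV[R]_(n l)) psi w v w' v' :
  \sum_r Phi_coef alpha beta psi (Some r) w v * Phi_coef alpha beta psi (Some r) w' v' =
  \sum_l cdot (beta l v) (beta l v') * cdot (alpha l w) (alpha l w').
Proof.
rewrite big_gidx; apply: eq_bigr => l _ /=.
rewrite [X in _ + X + _]big1 ?addr0; last by move=> c _; rewrite mulr0.
rewrite [X in _ + X]big1 ?addr0; last by move=> c _; rewrite mulr0.
rewrite /cdot big_distrlr /=; apply: eq_bigr => i _; apply: eq_bigr => c _.
by rewrite mulrACA.
Qed.

Lemma phi_gramE (R : realType) (k d : nat) (n : 'I_k -> nat) (W V : Type)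
    (alpha : 'I_k -> W -> 'cV[R]_d) (beta : forall l : 'I_k, V -> 'cV[R]_(n l)) psi w v w' v' :
  \sum_r phi_coef alpha beta psi (Some r) w v * phi_coef alpha beta psi (Some r) w' v' =
  \sum_l (enorm (beta l v) * enorm (beta l v') * cdot (alpha l w) (alpha l w') +
          enorm (alpha l w) * enorm (alpha l w') * cdot (beta l v) (beta l v')).
Proof.
rewrite big_gidx; apply: eq_bigr => l _ /=.
rewrite [X in X + _ + _]big1 ?add0r; last first.
  by move=> i _; rewrite big1// => c _; rewrite mulr0.
by rewrite /cdot !mulr_sumr; congr (_ + _); apply: eq_bigr => i _; rewrite mulrACA.
Qed.

Lemma gram_gap (R : realType) (k d : nat) (n : 'I_k -> nat) (W V : Type)
    (alpha : 'I_k -> W -> 'cV[R]_d) (beta : forall l : 'I_k, V -> 'cV[R]_(n l)) psi w v w' v' :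
  \sum_l (enorm (alpha l w) * enorm (beta l v)) * (enorm (alpha l w') * enorm (beta l v')) +
  \sum_r Phi_coef alpha beta psi (Some r) w v * Phi_coef alpha beta psi (Some r) w' v' -
  \sum_r phi_coef alpha beta psi (Some r) w v * phi_coef alpha beta psi (Some r) w' v' =
  \sum_l (enorm (alpha l w) * enorm (alpha l w') - cdot (alpha l w) (alpha l w')) *
         (enorm (beta l v) * enorm (beta l v') - cdot (beta l v) (beta l v')).
Proof.
rewrite Phi_gramE phi_gramE -big_split -sumrB; apply: eq_bigr => l _ /=; ring.
Qed.

Lemma gram_gap_ge0 (R : realType) (k d : nat) (n : 'I_k -> nat) (W V : Type)
    (alpha : 'I_k -> W -> 'cV[R]_d) (beta : forall l : 'I_k, V -> 'cV[R]_(n l)) w v w' v' :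
  0 <= \sum_l (enorm (alpha l w) * enorm (alpha l w') - cdot (alpha l w) (alpha l w')) *
         (enorm (beta l v) * enorm (beta l v') - cdot (beta l v) (beta l v')).
Proof.
by rewrite sumr_ge0// => l _; rewrite mulr_ge0// subr_ge0; exact: cdot_le_enorm.
Qed.

Lemma Phi_coefE (R : realType) (k d : nat) (n : 'I_k -> nat) (W V : Type)
    (alpha : 'I_k -> W -> 'cV[R]_d) (beta : forall l : 'I_k, V -> 'cV[R]_(n l)) psi
    (dT : measure_display) (T : measurableType dT)
    (G : forall l, T -> 'M[R]_(n l, d)) (g : 'I_k -> T -> 'cV[R]_d)
    (h : forall l, T -> 'cV[R]_(n l)) t w v :
  process (gentry G g h) (Phi_coef alpha beta psi) t w v =
  \sum_(l < k) ((beta l v)^T *m G l t *m alpha l w) 0 0 + psi w v.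
Proof.
rewrite /process big_gidx; congr (_ + _); apply: eq_bigr => l _ /=.
rewrite [X in _ + X + _]big1 ?addr0; last by move=> c _; rewrite mulr0.
rewrite [X in _ + X]big1 ?addr0; last by move=> c _; rewrite mulr0.
rewrite mxE exchange_big /=; apply: eq_bigr => c _.
by rewrite mxE mulr_suml; apply: eq_bigr => i _; rewrite mxE; ring.
Qed.

Lemma phi_coefE (R : realType) (k d : nat) (n : 'I_k -> nat) (W V : Type)
    (alpha : 'I_k -> W -> 'cV[R]_d) (beta : forall l : 'I_k, V -> 'cV[R]_(n l)) psi
    (dT : measure_display) (T : measurableType dT)
    (G : forall l, T -> 'M[R]_(n l, d)) (g : 'I_k -> T -> 'cV[R]_d)
    (h : forall l, T -> 'cV[R]_(n l)) t w v :
  process (gentry G g h) (phi_coef alpha beta psi) t w v =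
  \sum_(l < k) (enorm (beta l v) * ((g l t)^T *m alpha l w) 0 0
                + enorm (alpha l w) * ((h l t)^T *m beta l v) 0 0) + psi w v.
Proof.
rewrite /process big_gidx; congr (_ + _); apply: eq_bigr => l _ /=.
rewrite [X in X + _ + _]big1 ?add0r; last first.
  by move=> i _; rewrite big1// => c _; rewrite mulr0.
rewrite !mxE !mulr_sumr; congr (_ + _); apply: eq_bigr => c _; rewrite mxE; ring.
Qed.

(** * Compactness and joint continuity *)

Definition jointly_continuous (R : realType) (W V : topologicalType) (SW : set W) (SV : set V)
    (f : W -> V -> R) :=
  forall w v, SW w -> SV v ->
    (fun p : W * V => f p.1 p.2) @ within [set p | SW p.1 /\ SV p.2] (nbhs (w, v)) --> f w v.

Lemma jointly_continuousP (R : realType) (W V : topologicalType) (SW : set W) (SV : set V)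
    (f : W -> V -> R) :
  jointly_continuous SW SV f <->
  forall w v, SW w -> SV v -> forall eps : R, 0 < eps -> exists A B,
    [/\ nbhs w A, nbhs v B & forall w' v', A w' -> B v' -> SW w' -> SV v' ->
      `|f w v - f w' v'| < eps].
Proof.
split=> h w v SWw SVv.
  move=> eps eps0; have /cvgrPdist_lt/(_ eps eps0) := h w v SWw SVv.
  move=> [[A B] /= [nA nB] AB]; exists A, B; split => // w' v' Aw' Bv' Sw' Sv'.
  by apply: (AB (w', v')).
apply/cvgrPdist_lt => eps eps0; have [A [B [nA nB AB]]] := h w v SWw SVv eps eps0.
by exists (A, B) => // -[w' v'] /= [Aw' Bv'] [Sw' Sv']; exact: AB.
Qed.

Lemma jointly_continuous_swap (R : realType) (W V : topologicalType) (SW : set W) (SV : set V)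
    (f : W -> V -> R) :
  jointly_continuous SW SV f -> jointly_continuous SV SW (fun v w => f w v).
Proof.
move=> /jointly_continuousP h; apply/jointly_continuousP => v w SVv SWw eps eps0.
have [A [B [nA nB AB]]] := h w v SWw SVv eps eps0.
by exists B, A; split => // v' w' Bv' Aw' Sv' Sw'; exact: AB.
Qed.

(** A tube lemma: by compactness of [SV] the neighbourhoods of [w] obtained at the various [v] can
    be made uniform in [v]. *)
Lemma tube_close (R : realType) (W V : topologicalType) (SW : set W) (SV : set V) (J : finType)
    (f : J -> W -> V -> R) (eps : R) (w : W) :
  compact SV -> (forall j, jointly_continuous SW SV (f j)) -> 0 < eps -> SW w ->
  \forall w' \near w, SW w' -> forall v, SV v -> forall j, `|f j w v - f j w' v| <= eps.
Proof.
move=> cV cf eps0 SWw.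
have /compact_near_coveringP/near_covering_withinP cov := cV.
have := cov W (nbhs w) (fun w' v => SW w' -> forall j, `|f j w v - f j w' v| <= eps) _.
move=> H; have {H} : \forall w' \near w, SV `<=` (fun v => SW w' -> forall j, `|f j w v - f j w' v| <= eps).
  apply: H => v SVv.
  have : filter_prod (nbhs v) (nbhs w) [set x | forall j, SV x.1 -> SW x.2 ->
      `|f j w x.1 - f j x.2 x.1| <= eps].
    have FF : Filter (filter_prod (nbhs v) (nbhs w)) by exact: filter_prod_filter.
    apply: (@filter_forall _ J (fun j (x : V * W) => SV x.1 -> SW x.2 ->
      `|f j w x.1 - f j x.2 x.1| <= eps) _ FF) => j.
    have eps20 : 0 < eps / 2 by rewrite divr_gt0.
    have /jointly_continuousP/(_ w v SWw SVv _ eps20) [A [B [nA nB AB]]] := cf j.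
    exists (B, A) => // -[v' w'] /= [Bv' Aw'] SVv' SWw'.
    have h1 := AB w' v' Aw' Bv' SWw' SVv'.
    have h2 := AB w v' (nbhs_singleton nA) Bv' SWw SVv'.
    move: h1 h2; rewrite ltr_norml ltr_norml ler_norml => /andP[? ?] /andP[? ?].
    by apply/andP; split; lra.
  by apply: filterS => -[v' w'] /= h SVv' SWw' j; exact: h.
by apply: filterS => w' h SWw' v SVv j; exact: h.
Qed.

Lemma compact_uniform_net (R : realType) (W V : topologicalType) (SW : set W) (SV : set V)
    (J : finType) (f : J -> W -> V -> R) :
  compact SW -> compact SV -> (forall j, jointly_continuous SW SV (f j)) ->
  uniform_net SW SV f.
Proof.
move=> cW cV cf eps eps0.
(* The filter of finite lists in [SW], ordered by inclusion. In the near-covering form of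
   compactness, what holds eventually along it near each point holds eventually on all of [SW], and
   this produces a finite net. *)
pose F : set_system (seq W) := [set A : set (seq W) | exists2 s : seq W, (forall x, x \in s -> SW x) &
  forall s', (forall x, x \in s' -> SW x) -> {subset s <= s'} -> A s'].
have FF : Filter F.
  split.
  - by exists [::].
  - move=> A B [s1 S1 A1] [s2 S2 B2]; exists (s1 ++ s2).
      by move=> x; rewrite mem_cat => /orP[/S1|/S2].
    move=> s' S' ss'; split; [apply: A1 => //|apply: B2 => //] => x xs;
      by apply: ss'; rewrite mem_cat xs ?orbT.
  - by move=> A B AB [s S As]; exists s => // s' S' ss'; apply: AB; exact: As.
have /compact_near_coveringP/near_covering_withinP cov := cW.
have H := cov (seq W) F (fun (s : seq W) w => exists2 w0, w0 \in s &
   forall v, SV v -> forall j, `|f j w v - f j w0 v| <= eps) FF.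
have [s S sP] : F [set s : seq W | SW `<=` (fun w => exists2 w0, w0 \in s &
   forall v, SV v -> forall j, `|f j w v - f j w0 v| <= eps)].
  apply: H => w SWw.
  exists ((fun w' => SW w' -> forall v, SV v -> forall j, `|f j w v - f j w' v| <= eps),
          [set s : seq W | w \in s]) => /=.
    split; first exact: tube_close.
    exists [:: w]; first by move=> x; rewrite inE => /eqP ->.
    by move=> s' _; apply; rewrite inE.
  move=> [w' s] /= [hw' ws] SWw'; exists w => // v SVv j.
  by rewrite distrC; exact: hw'.
have {}sP := sP s S (fun _ => id).
exists (size s), (tnth (in_tuple s)); split => [i|w SWw].
  by apply: S; rewrite -[X in _ \in X]/(tval (in_tuple s)) mem_tnth.
have [w0 w0s hw0] := sP _ SWw.
by have /tnthP[i wi] : w0 \in in_tuple s by []; exists i => v SVv j; rewrite -wi; exact: hw0.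
Qed.

Lemma jointly_continuousM (R : realType) (W V : topologicalType) (SW : set W) (SV : set V)
    (f g : W -> V -> R) :
  jointly_continuous SW SV f -> jointly_continuous SW SV g ->
  jointly_continuous SW SV (fun w v => f w v * g w v).
Proof. by move=> cf cg w v SWw SVv; apply: cvgM; [exact: cf|exact: cg]. Qed.

Lemma jointly_continuous_left (R : realType) (W V : topologicalType) (SW : set W) (SV : set V)
    (f : W -> R) : continuous f -> jointly_continuous SW SV (fun w _ => f w).
Proof.
move=> cf w v _ _; apply: cvg_within_filter.
by apply: (cvg_comp (fun p : W * V => p.1) f); [exact: cvg_fst|exact: cf].
Qed.

Lemma jointly_continuous_right (R : realType) (W V : topologicalType) (SW : set W) (SV : set V)
    (f : V -> R) : continuous f -> jointly_continuous SW SV (fun _ v => f v).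
Proof.
move=> cf w v _ _; apply: cvg_within_filter.
by apply: (cvg_comp (fun p : W * V => p.2) f); [exact: cvg_snd|exact: cf].
Qed.

Lemma continuous_sum (R : realType) (W : topologicalType) (I : Type) (r : seq I)
    (f : I -> W -> R) : (forall i, continuous (f i)) ->
  continuous (fun w => \sum_(i <- r) f i w).
Proof.
move=> cf; elim: r => [|i r IH] w.
  rewrite (_ : (fun w => _) = fun=> 0); first exact: cvg_cst.
  by apply/funext => x; rewrite big_nil.
rewrite (_ : (fun w => _) = fun w => f i w + \sum_(j <- r) f j w); last first.
  by apply/funext => x; rewrite big_cons.
by apply: cvgD; [exact: cf|exact: IH].
Qed.

Lemma continuous_affine_coord (R : realType) (m p : nat) (A : 'M[R]_(m, p)) (b : 'cV[R]_m) i :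
  continuous (fun u : 'cV[R]_p => (A *m u + b) i 0).
Proof.
have -> : (fun u : 'cV[R]_p => (A *m u + b) i 0) = (fun u => \sum_j A i j * u j 0 + b i 0).
  by apply/funext => x; rewrite mxE mxE.
move=> u; apply: (@cvgD _ _ _ (nbhs u)); last exact: cvg_cst.
apply: continuous_sum => j {}u; apply: (@cvgM _ _ (nbhs u)); first exact: cvg_cst.
exact: coord_continuous.
Qed.

Lemma continuous_enorm_affine (R : realType) (m p : nat) (A : 'M[R]_(m, p)) (b : 'cV[R]_m) :
  continuous (fun u : 'cV[R]_p => enorm (A *m u + b)).
Proof.
move=> u; apply: (@continuous_comp _ _ _ (fun u : 'cV[R]_p => \sum_i (A *m u + b) i 0 ^+ 2) Num.sqrt);
  last exact: sqrt_continuous.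
apply: continuous_sum => i w.
apply: (@continuous_comp _ _ _ (fun u : 'cV[R]_p => (A *m u + b) i 0) (fun x => x ^+ 2)).
  exact: continuous_affine_coord.
exact: exprn_continuous.
Qed.

(** * Min-max values *)

Definition infsup (R : realType) (W V : Type) (SW : set W) (SV : set V) (F : W -> V -> R) : R :=
  inf [set (sup [set F w v | v in SV]) | w in SW].

Lemma infsup_bounds (R : realType) (W V : Type) (SW : set W) (SV : set V) (F : W -> V -> R) M :
  SW !=set0 -> SV !=set0 -> (forall w v, SW w -> SV v -> `|F w v| <= M) ->
  [/\ forall w, SW w -> has_sup [set F w v | v in SV],
      has_inf [set (sup [set F w v | v in SV]) | w in SW] &
      forall w v, SW w -> SV v -> F w v <= sup [set F w v | v in SV]].
Proof.
move=> [w0 SWw0] [v0 SVv0] FM.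
have hs w : SW w -> has_sup [set F w v | v in SV].
  move=> SWw; split; first by exists (F w v0), v0.
  by exists M => _ [v SVv <-]; rewrite (le_trans (ler_norm _))// FM.
have Fs w v : SW w -> SV v -> F w v <= sup [set F w v | v in SV].
  by move=> SWw SVv; apply: ub_le_sup; [exact: (hs w SWw).2|exists v].
split => //; split; first by exists (sup [set F w0 v | v in SV]), w0.
exists (- M) => _ [w SWw <-]; apply: le_trans (Fs _ _ SWw SVv0).
by have := FM w v0 SWw SVv0; rewrite ler_norml => /andP[].
Qed.

Lemma infsup_ltP (R : realType) (W V : Type) (SW : set W) (SV : set V) (F : W -> V -> R) M a :
  SW !=set0 -> SV !=set0 -> (forall w v, SW w -> SV v -> `|F w v| <= M) ->
  infsup SW SV F < a <->
  exists e, 0 < e /\ exists2 w, SW w & forall v, SV v -> F w v <= a - e.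
Proof.
move=> W0 V0 FM; have [hs hi Fs] := infsup_bounds W0 V0 FM; split.
  move=> /(inf_lt hi.1)[_ [w SWw <-] wa].
  exists (a - sup [set F w v | v in SV]); rewrite subr_gt0; split => //.
  by exists w => // v SVv; rewrite subKr; exact: Fs.
move=> [e [e0 [w SWw Fw]]]; apply: (@le_lt_trans _ _ (a - e)); last by rewrite ltrBlDr ltrDl.
apply: (@le_trans _ _ (sup [set F w v | v in SV])).
  by apply: ge_inf; [exact: hi.2|exists w].
apply: ge_sup; first exact: (hs w SWw).1.
by move=> _ [v SVv <-]; exact: Fw.
Qed.

Lemma infsup_gtW (R : realType) (W V : Type) (SW : set W) (SV : set V) (F : W -> V -> R) M a :
  SW !=set0 -> SV !=set0 -> (forall w v, SW w -> SV v -> `|F w v| <= M) ->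
  a < infsup SW SV F ->
  exists e, 0 < e /\ forall w, SW w -> exists2 v, SV v & a + e <= F w v.
Proof.
move=> W0 V0 FM aF; have [hs hi Fs] := infsup_bounds W0 V0 FM.
exists ((infsup SW SV F - a) / 2); rewrite divr_gt0 ?subr_gt0//; split => // w SWw.
have : a + (infsup SW SV F - a) / 2 < sup [set F w v | v in SV].
  apply: (@lt_le_trans _ _ (infsup SW SV F)); first by lra.
  by apply: ge_inf; [exact: hi.2|exists w].
by move=> /(sup_gt (hs w SWw).1)[_ [v SVv <-] /ltW]; exists v.
Qed.

Lemma infsup_gt (R : realType) (W V : Type) (SW : set W) (SV : set V) (F : W -> V -> R) M a e v :
  SW !=set0 -> SV !=set0 -> (forall w v, SW w -> SV v -> `|F w v| <= M) ->
  0 < e -> SV v -> (forall w, SW w -> a + e <= F w v) -> a < infsup SW SV F.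
Proof.
move=> W0 V0 FM e0 SVv Fv; have [hs hi Fs] := infsup_bounds W0 V0 FM.
apply: (@lt_le_trans _ _ (a + e)); first by rewrite ltrDl.
apply: lb_le_inf; first exact: hi.1.
by move=> _ [w SWw <-]; apply: le_trans (Fs _ _ SWw SVv); exact: Fv.
Qed.

Lemma process_bounded (R : realType) (T W V : Type) (SW : set W) (SV : set V) (I : finType)
    (X : I -> T -> R) (f : option I -> W -> V -> R) (t : T) :
  uniform_net SW SV f -> uniform_net SV SW (fun j v w => f j w v) ->
  exists M, forall w v, SW w -> SV v -> `|process X f t w v| <= M.
Proof.
move=> nW nV; have [p [ws [wsS wsN]]] := nW 1 ltr01; have [q [vs [vsS vsN]]] := nV 1 ltr01.
exists (\sum_i \sum_j `|process X f t (ws i) (vs j)| + 2 * (1 + size1 X t)) => w v SWw SVv.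
have [i wi] := wsN _ SWw; have [j vj] := vsN _ SVv.
have := process_close X t (wi _ SVv); have := process_close X t (vj _ (wsS i)).
have : `|process X f t (ws i) (vs j)| <= \sum_i \sum_j `|process X f t (ws i) (vs j)|.
  rewrite (bigD1 i)//= (bigD1 j)//= -addrA lerDl addr_ge0// sumr_ge0// => i' _.
  exact: sumr_ge0.
set Sg := \sum_i _; rewrite !mul1r !ler_norml => /andP[? ?] /andP[? ?] /andP[? ?].
by apply/andP; split; lra.
Qed.

(** The net [vs] reduces the maximization to finitely many points, at the price of half the gap [e];
    the finite minimax theorem then yields one [v] that works for all [w]. *)
Lemma infsup_upper_event (R : realType) (T W V : Type) (SW : set W) (SV : set V) (I : finType)
    (X : I -> T -> R) (f : option I -> W -> V -> R) (t : T) (a : R) :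
  SW !=set0 -> SV !=set0 ->
  uniform_net SW SV f -> uniform_net SV SW (fun j v w => f j w v) ->
  convexlike SW SV (process X f t) -> convexlike SV SW (fun v w => - process X f t w v) ->
  a < infsup SW SV (process X f t) ->
  exists e, 0 < e /\ exists2 v, SV v & forall w, SW w -> a + e <= process X f t w v.
Proof.
move=> W0 V0 nW nV cW cV; have [M FM] := process_bounded X t nW nV.
move=> /(infsup_gtW W0 V0 FM)[e [e0 Fe]].
have S0 := size1_ge0 X t.
have S1 : 0 < 1 + size1 X t by lra.
have eps0 : 0 < e / 2 / (1 + size1 X t) by rewrite !divr_gt0.
have [q [vs [vsS vsN]]] := nV _ eps0.
exists (e / 2); split; first by rewrite divr_gt0.
have [||v SVv Fv] := @convexlike_finite_minimax _ _ _ SW SV (process X f t) (a + e / 2) q vs cW cV V0.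
- exact: vsS.
- move=> w SWw; have [v SVv Fv] := Fe w SWw; have [j vj] := vsN _ SVv; exists j.
  have := process_close X t (vj _ SWw); rewrite divfK ?gt_eqF//.
  by rewrite ler_norml => /andP[? ?]; lra.
by exists v.
Qed.

(** The coefficients of the Gaussians have to be exactly affine since [X r t] may have either sign;
    the deterministic term may be convex. *)
Lemma process_convexlike (R : realType) (T W V : Type) (SW : set W) (SV : set V) (I : finType)
    (X : I -> T -> R) (f : option I -> W -> V -> R) (t : T) :
  (forall w1 w2, SW w1 -> SW w2 -> forall u : R, 0 <= u <= 1 -> exists2 w, SW w & forall v, SV v ->
    (forall r, f (Some r) w v = u * f (Some r) w1 v + (1 - u) * f (Some r) w2 v) /\
    f None w v <= u * f None w1 v + (1 - u) * f None w2 v) ->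
  convexlike SW SV (process X f t).
Proof.
move=> cf w1 w2 SW1 SW2 u u01; have [w SWw fw] := cf _ _ SW1 SW2 u u01.
exists w => // v SVv; have [fr fN] := fw v SVv; rewrite /process.
have -> : \sum_r X r t * f (Some r) w v =
    u * \sum_r X r t * f (Some r) w1 v + (1 - u) * \sum_r X r t * f (Some r) w2 v.
  rewrite !mulr_sumr -big_split; apply: eq_bigr => r _ /=; rewrite fr; ring.
by move: fN; lra.
Qed.

Lemma processN (R : realType) (T W V : Type) (I : finType) (X : I -> T -> R)
    (f : option I -> W -> V -> R) (t : T) (w : W) (v : V) :
  process X (fun o v w => - f o w v) t v w = - process X f t w v.
Proof.
rewrite /process opprD -sumrN; congr (_ + _).
by apply: eq_bigr => r _; rewrite mulrN.
Qed.

Lemma uniform_net_opp (R : realType) (W V : Type) (SW : set W) (SV : set V) (J : finType)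
    (f g : J -> W -> V -> R) :
  uniform_net SW SV (fun (bj : bool * J) w v => if bj.1 then f bj.2 w v else g bj.2 w v) ->
  uniform_net SW SV (fun (bj : bool * J) w v => if bj.1 then - f bj.2 w v else - g bj.2 w v).
Proof.
move=> nW eps eps0; have [p [ws [wsS wsN]]] := nW _ eps0; exists p, ws; split => // w SWw.
have [i wi] := wsN _ SWw; exists i => v SVv [b j]; have := wi v SVv (b, j).
by case: b => /=; rewrite -opprD normrN.
Qed.

(** [a < infsup] says that [infsup] is not below [a + 1 / (m + 1)] for some [m], which reduces the
    matter to complements of lower events. *)
Lemma measurable_infsup_gt (R : realType) (d : measure_display) (T : measurableType d)
    (W V : Type) (SW : set W) (SV : set V) (I : finType) (X : I -> T -> R)
    (f : option I -> W -> V -> R) (a : R) :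
  (forall i, measurable_fun setT (X i)) -> SW !=set0 -> SV !=set0 ->
  uniform_net SW SV f -> uniform_net SV SW (fun j v w => f j w v) ->
  measurable [set t | a < infsup SW SV (process X f t)].
Proof.
move=> mX W0 V0 nW nV.
rewrite (_ : [set t | _] = \bigcup_m ~` (lower_event SW SV (process X f) (a + m.+1%:R^-1))).
  by apply: bigcupT_measurable => m; apply: measurableC; exact: measurable_lower_event.
apply/seteqP; split => t; have [M FM] := process_bounded X t nW nV.
  move=> /= at_; pose m := Num.bound (infsup SW SV (process X f t) - a)^-1.
  exists m => // /(infsup_ltP _ W0 V0 FM); apply/negP; rewrite -leNgt -lerBrDl.
  rewrite -[leRHS]invrK lef_pV2 ?posrE ?ltr0n ?invr_gt0 ?subr_gt0//.
  apply: (@le_trans _ _ m%:R); last by rewrite ler_nat.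
  by apply/ltW/archi_boundP; rewrite invr_ge0 subr_ge0 ltW.
move=> [m _ /= h]; apply: (@lt_le_trans _ _ (a + m.+1%:R^-1)).
  by rewrite ltrDl invr_gt0 ltr0n.
by rewrite leNgt; apply/negP => /(infsup_ltP _ W0 V0 FM).
Qed.

Lemma infsup_comparison (R : realType) (d : measure_display) (T : measurableType d)
    (P : probability T R) (W V : Type) (SW : set W) (SV : set V) (I : finType) (X : I -> T -> R)
    (f g : option I -> W -> V -> R) (cs : seq (W -> V -> R)) (c eta : R) :
  mutually_independent P X -> (forall i, std_normal P (X i)) -> SW !=set0 -> SV !=set0 ->
  uniform_net SW SV
    (fun (bj : bool * option I) w v => if bj.1 then f bj.2 w v else g bj.2 w v) ->
  uniform_net SV SW
    (fun (bj : bool * option I) v w => if bj.1 then f bj.2 w v else g bj.2 w v) ->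
  f None = g None ->
  (forall t, convexlike SW SV (process X f t)) ->
  (forall t, convexlike SV SW (fun v w => - process X f t w v)) ->
  (forall e, List.In e cs -> forall w v, 0 <= e w v) -> gordon_gram f g cs ->
  gordon_gram (fun o v w => - f o w v) (fun o v w => - g o w v) [seq (fun v w => e w v) | e <- cs] ->
  0 < eta ->
  (P [set t | (eta < `|infsup SW SV (process X f t) - c|)%R] <=
   (2 ^ size cs)%:R%:E * P [set t | (eta < `|infsup SW SV (process X g t) - c|)%R])%E.
Proof.
move=> iX nX W0 V0 nW nV fgN cW cV cs0 gram gramN eta0.
have [mX _] := iX.
have [nWf nWg] := uniform_net_pair nW.
have [nVf nVg] := @uniform_net_pair _ _ _ _ _ _ (fun j v w => f j w v) (fun j v w => g j w v) nV.
have nWN := uniform_net_opp nW.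
have nVN := @uniform_net_opp _ _ _ _ _ _ (fun j v w => f j w v) (fun j v w => g j w v) nV.
have [nVNf nVNg] := @uniform_net_pair _ _ _ _ _ _ (fun j v w => - f j w v) (fun j v w => - g j w v) nVN.
have [nWNf nWNg] := @uniform_net_pair _ _ _ _ _ _ (fun j w v => - f j w v) (fun j w v => - g j w v) nWN.
pose up h := lower_event SV SW (process X (fun o v w => - h o w v)) (- (c + eta)).
pose lo h := lower_event SW SV (process X h) (c - eta).
have mlof : measurable (lo f) by exact: measurable_lower_event.
have mlog : measurable (lo g) by exact: measurable_lower_event.
have mupf : measurable (up f) by exact: measurable_lower_event.
have mupg : measurable (up g) by exact: measurable_lower_event.
have evE h : uniform_net SW SV h -> uniform_net SV SW (fun j v w => h j w v) ->
    [set t | (eta < `|infsup SW SV (process X h t) - c|)%R] =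
    lo h `|` [set t | c + eta < infsup SW SV (process X h t)].
  move=> nWh nVh; apply/seteqP; split => t /=; have [M FM] := process_bounded X t nWh nVh.
    rewrite lter_normr => /orP[h1|h1]; first by right => /=; lra.
    by left; apply/(infsup_ltP _ W0 V0 FM); lra.
  rewrite lter_normr => -[/(infsup_ltP _ W0 V0 FM)|] h1; apply/orP.
    by right; lra.
  by left; lra.
(* The minimax theorem is used here: it provides a single [v] for all [w]. *)
have upf : [set t | c + eta < infsup SW SV (process X f t)] `<=` up f.
  move=> t /(infsup_upper_event W0 V0 nWf nVf (cW t) (cV t))[e [e0 [v SVv Fv]]].
  exists e; split => //; exists v => // w SWw; rewrite processN -opprD lerN2.
  exact: Fv.
(* For the decoupled process the elementary inequality between max-min and min-max points in the
   right direction. *)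
have upg : up g `<=` [set t | c + eta < infsup SW SV (process X g t)].
  move=> t [e [e0 [v SVv Fv]]]; have [M FM] := process_bounded X t nWg nVg.
  apply: (infsup_gt W0 V0 FM e0 SVv) => w SWw.
  by have := Fv w SWw; rewrite processN -opprD lerN2.
have mgtg := measurable_infsup_gt (c + eta) mX W0 V0 nWg nVg.
have mgtf := measurable_infsup_gt (c + eta) mX W0 V0 nWf nVf.
have lo_le : (P (lo f) <= (2 ^ size cs)%:R%:E * P (lo g))%E.
  exact: lower_event_comparison.
have up_le : (P (up f) <= (2 ^ size cs)%:R%:E * P (up g))%E.
  have := @lower_event_comparison _ _ _ P V W SV SW I X (fun o v w => - f o w v)
    (fun o v w => - g o w v) [seq (fun v w => e w v) | e <- cs] (- (c + eta)) iX nX nVN nWN.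
  rewrite size_map; apply => //.
    by rewrite fgN.
  elim: (cs) cs0 => //= e' cs' IH cs0' e [<- v w|ecs]; first by apply: cs0'; left.
  by apply: IH => // e'' h; apply: cs0'; right.
rewrite !evE//.
apply: (@le_trans _ _ (P (lo f) + P (up f))%E).
  apply: (@le_trans _ _ (P (lo f `|` up f))); last exact: measureU2.
  apply: le_measure; rewrite ?inE; [exact: measurableU|exact: measurableU|].
  by apply: setUS.
apply: (le_trans (leeD lo_le up_le)); rewrite -ge0_muleDr//.
rewrite lee_wpmul2l ?lee_fin//.
(* The two tails of [g] are disjoint as [eta > 0], so their probabilities add up to that of the
   union and no further factor 2 appears. *)
rewrite -measureU//; last first.
  apply/seteqP; split => // t [lot /upg]; have [M FM] := process_bounded X t nWg nVg.
  by move: lot => /(infsup_ltP _ W0 V0 FM) /= h1 h2; clear -h1 h2 eta0; lra.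
apply: le_measure; rewrite ?inE; [exact: measurableU|exact: measurableU|].
by apply: setUS.
Qed.

(** * Compact convex sets of vectors and of tuples *)

Lemma continuous_on_prod_jointly (R : realType) (k d : nat) (n : 'I_k -> nat)
    (Sw : set 'cV[R]_d) (Sv : forall l : 'I_k, set 'cV[R]_(n l)) (psi : 'cV[R]_d -> vtuple R n -> R) :
  continuous_on_prod Sw Sv psi ->
  @jointly_continuous R 'cV[R]_d (prod_topology (fun l => 'cV[R]_(n l))) Sw (in_prod Sv) psi.
Proof.
move=> cpsi; apply/jointly_continuousP => w v Sww Svv eps eps0.
have [del del0 H] := cpsi w v Sww Svv eps eps0.
have ball (m : nat) (u : 'cV[R]_m) : \forall u' \near u, enorm (u' - u) < del.
  have := @continuous_enorm_affine R m m 1%:M (- u) u => /cvgr_lt.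
  rewrite mul1mx subrr => /(_ del).
  have -> : enorm (0 : 'cV[R]_m) = 0.
    by rewrite /enorm big1 ?sqrtr0// => i _; rewrite mxE expr0n.
  move=> /(_ del0); apply: filterS => u'.
  by rewrite mul1mx.
exists [set w' | enorm (w' - w) < del], [set v' | forall l, enorm (v' l - v l) < del]; split.
- exact: ball.
- apply: (@filter_forall _ _ (fun l (v' : prod_topology (fun l => 'cV[R]_(n l))) =>
    enorm (v' l - v l) < del) (nbhs (v : prod_topology (fun l => 'cV[R]_(n l))))) => l.
  exact: (@proj_continuous _ (fun l => 'cV[R]_(n l)) l v _ (ball _ (v l))).
- by move=> w' v' /= hw hv Sw' Sv'; rewrite distrC; exact: H.
Qed.

Theorem theorem4p2 (R : realType) (k d : nat) (n : 'I_k -> nat)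
  (hk : (1 <= k)%N) (hd : (1 <= d)%N) (hn : forall l, (1 <= n l)%N)
  (Sw : set 'cV[R]_d) (Sv : forall l : 'I_k, set 'cV[R]_(n l))
  (hSw_cpt : compact Sw) (hSw_cvx : cvx_set Sw) (hSw0 : Sw !=set0)
  (hSv_cpt : forall l, compact (Sv l)) (hSv_cvx : forall l, cvx_set (Sv l))
  (hSv0 : forall l, Sv l !=set0)
  (psi : 'cV[R]_d -> vtuple R n -> R)
  (hpsi_cont : continuous_on_prod Sw Sv psi)
  (hpsi_cc : convex_concave Sw Sv psi)
  (A : 'I_k -> 'M[R]_d) (a : 'I_k -> 'cV[R]_d)
  (B : forall l, 'M[R]_(n l)) (b : forall l, 'cV[R]_(n l))
  (dT : measure_display) (T : measurableType dT) (P : probability T R)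
  (G : forall l, T -> 'M[R]_(n l, d)) (g : 'I_k -> T -> 'cV[R]_d)
  (h : forall l, T -> 'cV[R]_(n l))
  (hindep : mutually_independent P (gentry G g h))
  (hgauss : forall j, std_normal P (gentry G g h j))
  (c eta : R) (heta : 0 < eta) :
  (P [set t | (eta < `|PhiG Sw Sv A a B b psi (fun l => G l t) - c|)%R]
   <= (2 ^ k)%:R%:E *
      P [set t | (eta < `|phigh Sw Sv A a B b psi (fun l => g l t) (fun l => h l t) - c|)%R])%E.
Proof.
(* [vtuple] with its product topology, in which the product of the compact sets is compact by
   Tychonoff's theorem. *)
pose V := prod_topology (fun l : 'I_k => 'cV[R]_(n l)).
pose alpha (l : 'I_k) (w : 'cV[R]_d) := A l *m w + a l.
pose beta (l : 'I_k) (v : vtuple R n) := B l *m v l + b l.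
pose I : finType := {l : 'I_k & ('I_(n l) * 'I_d + 'I_d + 'I_(n l))%type}.
pose X : I -> T -> R := gentry G g h.
pose f : option I -> 'cV[R]_d -> vtuple R n -> R := Phi_coef alpha beta psi.
pose f' : option I -> 'cV[R]_d -> vtuple R n -> R := phi_coef alpha beta psi.
(* The coefficients of the additional variables [gamma_l]; there are [k] of them, whence [2^k]. *)
pose cs := [seq (fun (w : 'cV[R]_d) (v : vtuple R n) => enorm (alpha l w) * enorm (beta l v)) | l <- enum 'I_k].
have SV0 : in_prod Sv !=set0.
  exists (fun l => sval (cid (hSv0 l))) => l; exact: (svalP (cid (hSv0 l))).
have cSV : @compact V (in_prod Sv) by exact: tychonoff.
have csE (F : ('cV[R]_d -> vtuple R n -> R) -> R) :
    \sum_(e <- cs) F e = \sum_l F (fun w v => enorm (alpha l w) * enorm (beta l v)).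
  by rewrite /cs big_map big_enum.
have calpha l i : continuous (fun w => alpha l w i 0) by exact: continuous_affine_coord.
have cnalpha l : continuous (fun w => enorm (alpha l w)) by exact: continuous_enorm_affine.
have cproj (l : 'I_k) (F : 'cV[R]_(n l) -> R) : continuous F -> continuous (fun v : V => F (v l)).
  move=> cF v; apply: (@cvg_comp _ _ _ (fun v : V => v l) F); last exact: cF.
  exact: (@proj_continuous _ (fun l => 'cV[R]_(n l)) l v).
have cbeta l i : continuous (fun v : V => beta l v i 0).
  exact: (cproj l (fun u => (B l *m u + b l) i 0) (@continuous_affine_coord _ _ _ _ _ i)).
have cnbeta l : continuous (fun v : V => enorm (beta l v)).
  exact: (cproj l (fun u => enorm (B l *m u + b l)) (@continuous_enorm_affine _ _ _ _ _)).
have jc (bj : bool * option I) : @jointly_continuous R 'cV[R]_d V Sw (in_prod Sv)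
    (fun w v => if bj.1 then f bj.2 w v else f' bj.2 w v).
  have j0 : @jointly_continuous R 'cV[R]_d V Sw (in_prod Sv) (fun _ _ => 0).
    by move=> w v _ _; exact: cvg_cst.
  have jpsi := continuous_on_prod_jointly hpsi_cont.
  case: bj => -[] [[l [[[i j]|j]|i]]|] //=.
  - apply: jointly_continuousM; first exact: jointly_continuous_right.
    exact: jointly_continuous_left.
  - apply: jointly_continuousM; first exact: jointly_continuous_right.
    exact: jointly_continuous_left.
  - apply: jointly_continuousM; first exact: jointly_continuous_left.
    exact: jointly_continuous_right.
have nW := @compact_uniform_net R 'cV[R]_d V Sw (in_prod Sv) _ _ hSw_cpt cSV jc.
have nV := @compact_uniform_net R V 'cV[R]_d (in_prod Sv) Sw _ _ cSV hSw_cpt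
  (fun bj => jointly_continuous_swap (jc bj)).
(* The weights add up to 1, so the translation part [a l] is reproduced. *)
have alphaD l w1 w2 (u : R) : alpha l (u *: w1 + (1 - u) *: w2) = u *: alpha l w1 + (1 - u) *: alpha l w2.
  rewrite /alpha mulmxDr -!scalemxAr !scalerDr addrACA -scalerDl addrC.
  by rewrite (_ : u + (1 - u) = 1) ?scale1r 1?addrC//; ring.
have betaD l (v1 v2 : vtuple R n) (u : R) :
    beta l (fun l => u *: v1 l + (1 - u) *: v2 l) = u *: beta l v1 + (1 - u) *: beta l v2.
  rewrite /beta mulmxDr -!scalemxAr !scalerDr addrACA -scalerDl addrC.
  by rewrite (_ : u + (1 - u) = 1) ?scale1r 1?addrC//; ring.
have [cvxpsi ccvpsi] := hpsi_cc.
have cW t : convexlike Sw (in_prod Sv) (process X f t).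
  apply: process_convexlike => w1 w2 Sw1 Sw2 u u01.
  exists (u *: w1 + (1 - u) *: w2); first exact: hSw_cvx.
  move=> v Svv; split => [[l [[[i j]|j]|i]]|] /=; rewrite ?mulr0 ?addr0//.
    by rewrite alphaD !mxE; ring.
  exact: cvxpsi.
have cV t : convexlike (in_prod Sv) Sw (fun v w => - process X f t w v).
  move=> v1 v2 Sv1 Sv2 u u01.
  have : convexlike (in_prod Sv) Sw (process X (fun o v w => - f o w v) t).
    apply: process_convexlike => {}v1 {}v2 {}Sv1 {}Sv2 {}u {}u01.
    exists (fun l => u *: v1 l + (1 - u) *: v2 l); first by move=> l; exact: hSv_cvx.
    move=> w Sww; split => [[l [[[i j]|j]|i]]|] /=; rewrite ?oppr0 ?mulr0 ?addr0//.
      by rewrite betaD !mxE; ring.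
    by have := ccvpsi w Sww v1 v2 Sv1 Sv2 u u01; lra.
  move=> /(_ v1 v2 Sv1 Sv2 u u01)[v Svv Fv]; exists v => // w Sww.
  by have := Fv w Sww; rewrite !processN.
have cs0 e : List.In e cs -> forall w v, 0 <= e w v.
  rewrite /cs; elim: (enum 'I_k) => //= l s IH [<- w v|]; last exact: IH.
  by rewrite mulr_ge0 ?enorm_ge0.
have gram : gordon_gram f f' cs.
  move=> w v w' v' /=; rewrite (csE (fun e => e w v * e w' v')).
  have gap := gram_gap alpha beta psi w v w' v'.
  split; first by rewrite -subr_ge0 gap; exact: gram_gap_ge0.
  (* With equal [w] the first factor of each term in [gram_gap] is [|alpha|^2 - alpha.alpha = 0]. *)
  move=> ww'; apply/esym/eqP; rewrite -subr_eq0 gap ww'.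
  by rewrite big1// => l _; rewrite -expr2 enorm_sqr subrr mul0r.
have gramN : gordon_gram (fun o v w => - f o w v) (fun o v w => - f' o w v)
    [seq (fun v w => e w v) | e <- cs].
  move=> v w v' w' /=; rewrite big_map (csE (fun e => e w v * e w' v')).
  under eq_bigr do rewrite mulrNN.
  under [X in _ <= _ + X]eq_bigr do rewrite mulrNN.
  under [X in _ = _ + X]eq_bigr do rewrite mulrNN.
  have gap := gram_gap alpha beta psi w v w' v'.
  split; first by rewrite -subr_ge0 gap; exact: gram_gap_ge0.
  (* With the roles exchanged, equal [v] annihilate the second factor instead. *)
  move=> vv'; apply/esym/eqP; rewrite -subr_eq0 gap vv'.
  by rewrite big1// => l _; rewrite -[X in _ * (X - _)]expr2 enorm_sqr subrr mulr0.
have PhiE t : infsup Sw (in_prod Sv) (process X f t) = PhiG Sw Sv A a B b psi (fun l => G l t).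
  by congr infsup; apply/funext => w; apply/funext => v; exact: Phi_coefE.
have phiE t : infsup Sw (in_prod Sv) (process X f' t) =
    phigh Sw Sv A a B b psi (fun l => g l t) (fun l => h l t).
  by congr infsup; apply/funext => w; apply/funext => v; exact: phi_coefE.
have := infsup_comparison c hindep hgauss hSw0 SV0 nW nV erefl cW cV cs0 gram gramN heta.
rewrite size_map -cardE card_ord.
by under eq_set do rewrite PhiE; under [in X in (_ <= X)%E -> _]eq_set do rewrite phiE.
Qed.
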